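(* For $n\ge 1$ let $u_n$ be the number of connected $3$-leaf power graphs on $n$ vertices, counted up to isomorphism (that is, unlabeled and unrooted). Then the values $u_1,u_2,\dots,u_{20}$ are, in order, $$1,\ 1,\ 2,\ 5,\ 12,\ 32,\ 82,\ 227,\ 629,\ 1840,\ 5456,\ 16701,\ 51939,\ 164688,\ 529070,\ 1722271,\ 5664786,\ 18813360,\ 62996841,\ 212533216,$$ and there are constants $c = 0.70955825396\ldots$ and $\gamma = 3.848442876\ldots$ such that $$u_n \sim c\cdot \gamma^{\,n}\cdot n^{-5/2}\qquad (n\to\infty).$$
   Context: All graphs are finite and simple. A graph $G=(V,E)$ is a $3$-leaf power graph if there is a tree $T$ whose set of leaves is $V$ such that, for distinct $x,y\in V$, one has $xy\in E$ if and only if the distance in $T$ between the leaves $x$ and $y$ is at most $3$ (the one-vertex graph is counted as a $3$-leaf power graph). Here $a_n\sim b_n$ means $a_n/b_n\to 1$; the constants are given by the leading digits of their decimal expansions. *)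

(* Defs.v *)
From Stdlib Require Import BinNat.
From mathcomp Require Import all_boot all_order all_algebra perm.
From mathcomp Require Import boolp reals.

Set Implicit Arguments.
Unset Strict Implicit.
Unset Printing Implicit Defensive.

Import Order.TTheory GRing.Theory Num.Theory.

(* A finite simple graph on V is given by its edge set. *)
Definition sgraph (V : finType) : Type :=
  {E : {set {set V}} | [forall e in E, #|e| == 2]}.

(* Irreflexive, since [set x; x] is a singleton. *)
Definition adj (V : finType) (G : sgraph V) : rel V :=
  [rel x y | [set x; y] \in val G].

Definition connected_graph (V : finType) (G : sgraph V) : bool :=
  (0 < #|V|) && [forall x, forall y, connect (adj G) x y].

Definition acyclic_graph (V : finType) (G : sgraph V) : Prop :=
  forall c : seq V, ucycle (adj G) c -> size c < 3.

Definition is_tree (V : finType) (G : sgraph V) : Prop :=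
  connected_graph G /\ acyclic_graph G.

Definition degree (V : finType) (G : sgraph V) (x : V) : nat := #|adj G x|.

(* The least length of a walk from x to y; it is #|V| if there is no such walk
   (a shortest walk has length < #|V|). *)
Definition dist (V : finType) (G : sgraph V) (x y : V) : nat :=
  find (fun k => [exists p : k.-tuple V, path (adj G) x p && (last x p == y)])
       (iota 0 #|V|).

(* The injection leaf identifies V with the set of leaves (vertices of degree 1)
   of the tree T.  One-vertex graphs are leaf powers by convention: no tree has
   exactly one vertex of degree 1. *)
Definition leaf_power (k : nat) (V : finType) (G : sgraph V) : Prop :=
  #|V| = 1 \/
  exists (W : finType) (T : sgraph W) (leaf : V -> W),
    [/\ is_tree T,
        injective leaf,
        forall w : W, (degree T w == 1) = (w \in codom leaf) &
        forall x y : V, x != y -> adj G x y = (dist T (leaf x) (leaf y) <= k)].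

Definition graph_iso (V : finType) : rel (sgraph V) :=
  [rel G H | [exists s : {perm V},
     [forall x, forall y, adj H (s x) (s y) == adj G x y]]].

Definition num_conn_3leaf_power (n : nat) : nat :=
  #|equivalence_partition (@graph_iso 'I_n)
      [set G : sgraph 'I_n | connected_graph G && `[< leaf_power 3 G >]]|.

(* The decimal expansion of x, truncated after d decimals, is m / 10 ^ d.
   The integer m is in binary because it may be large. *)
Definition decimal_digits (R : realType) (x : R) (m : N) (d : nat) : Prop :=
  ((nat_of_bin m)%:R / 10%:R ^+ d <= x < ((nat_of_bin m).+1)%:R / 10%:R ^+ d)%R.

(* Main.v *)
(* In a connected 3-leaf power the classes of true twins are cliques, and contracting
   them gives a tree; so the connected 3-leaf powers on n vertices correspond to the trees with
   positive integer vertex weights of sum n, except that the n./2 two-vertex trees all give the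
   complete graph.  Rooting a tree at its centroid yields
     u_n = r_n - 1/2 sum_j r_j r_(n-j) + [n even] r_(n/2) / 2 - n./2,
   where r_n counts the rooted weighted trees; these satisfy r = T(phi) with
     phi(z) = z / (1 - z) exp (sum_(k >= 2) r(z^k) / k),   T(x) = sum_k k^(k-1) x^k / k!,
   and Abel's identity turns r - r^2/2 into U(phi) with U_k = k^(k-2) / k!.

   The asymptotics are obtained probabilistically.  Let rho solve e phi(rho) = 1.  Then
   p_j = e phi_j rho^j is a probability distribution with exponentially small tails and some mean mu,
   and rho^n [z^n] U(phi) = sum_k U_k e^-k P(S_k = n), where S_k is the sum of k independent steps
   with law p.  By Stirling U_k e^-k ~ kappa k^(-5/2) with kappa^2 = 1 / (2 pi), by Chernoff only
   k close to n / mu matter, and by the renewal theorem sum_k P(S_k = n) -> 1 / mu.  Therefore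
   gamma = 1 / rho and c = kappa mu^(3/2).  Both are bracketed by evaluating the first 79 nonzero
   coefficients of phi exactly, with tails controlled by phi(11/25) <= 4; kappa^2 is bracketed
   by Wallis' product accelerated with Brouncker's continued fraction. *)

From HB Require Import structures.
Require Import Defs.
From Stdlib Require Import BinNat.
From mathcomp Require Import all_boot all_order all_algebra perm.
From mathcomp Require Import zify boolp.

Set Implicit Arguments.
Unset Strict Implicit.
Unset Printing Implicit Defensive.

(** The relation [rep e S K X] lets a rooted tree describe the graph induced on a vertex set
    together with its root clique, so that gluing and cutting along one tree edge replace any
    quotient of the graph by its twin classes. Two joined cliques with nothing else around form a
    single clique; this makes the two-node trees the only failure of uniqueness. The series are
    handled through the operator z d/dz: the logarithmic derivative [psi] of phi has natural
    coefficients, and the implicit equation for r becomes an identity that determines its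
    coefficients one after the other. The analytic obstacle is that phi is itself built from r, but
    only from r(z^k) with k >= 2. A crude bound for r at 1/5, proved by induction on the truncation
    order, thus controls phi up to the square root of 1/5, well beyond rho = 0.2598...; this margin
    yields the exponential tails of the step law and the error terms of the numerics. No complex
    analysis is involved: nearly all estimates concern partial sums of nonnegative terms. The
    corrections r_(n/2) / 2 and n./2 are negligible by the same bound, since rho times the square
    root of 5 is below 1. *)

(** * Weighted rooted trees and their canonical forms *)

Inductive rtree := Node of nat & seq rtree.

Fixpoint rtree_nested_ind (P : rtree -> Prop)
    (IH : forall w cs, foldr (fun X Q => P X /\ Q) True cs -> P (Node w cs)) X {struct X} : P X :=
  let: Node w cs := X in
  IH w cs
   ((fix aux s : foldr (fun X Q => P X /\ Q) True s :=
       if s is Y :: s' then conj (rtree_nested_ind IH Y) (aux s') else I) cs).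

Fixpoint rtree_enc (X : rtree) : GenTree.tree nat :=
  let: Node w cs := X in GenTree.Node w (map rtree_enc cs).

Fixpoint rtree_dec (t : GenTree.tree nat) : rtree :=
  match t with
  | GenTree.Leaf _ => Node 0 [::]
  | GenTree.Node w ts => Node w (map rtree_dec ts)
  end.

Lemma rtree_encK : cancel rtree_enc rtree_dec.
Proof.
elim/rtree_nested_ind=> w cs /=; rewrite -map_comp => IH; congr Node.
by elim: cs IH => //= X cs IHcs [-> /IHcs ->].
Qed.

HB.instance Definition _ := Countable.copy rtree (can_type rtree_encK).

Lemma rtree_ind_mem (P : rtree -> Prop) :
  (forall w cs, (forall X, X \in cs -> P X) -> P (Node w cs)) -> forall X, P X.
Proof.
move=> IH; elim/rtree_nested_ind=> w cs H; apply: IH.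
elim: cs H => //= Y cs IHcs [PY /IHcs H] X.
by rewrite inE => /predU1P[->|/H].
Qed.

(** Any total order would do; the numbering that comes with countability provides one. It serves to
    sort children and, later, to choose between two centroids. *)
Definition rtree_le : rel rtree := [rel X Y | pickle X <= pickle Y].

Lemma rtree_le_total : total rtree_le.
Proof. by move=> X Y /=; apply: leq_total. Qed.

Lemma rtree_le_trans : transitive rtree_le.
Proof. by move=> X Y Z /=; apply: leq_trans. Qed.

Lemma rtree_le_anti : antisymmetric rtree_le.
Proof.
move=> X Y /= H; apply: (pcan_inj (@pickleK rtree)); apply/eqP.
by rewrite eqn_leq.
Qed.

Lemma rtree_le_refl : reflexive rtree_le.
Proof. by move=> X; apply: leqnn. Qed.

#[local] Hint Resolve rtree_le_total rtree_le_trans rtree_le_anti rtree_le_refl : core.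

Fixpoint wt (X : rtree) : nat :=
  let: Node w cs := X in w + sumn (map wt cs).

Definition children X := let: Node _ cs := X in cs.

(** Children are lists, but the trees meant are unordered. Sorting from the leaves upwards selects
    one representative, so equality of canonical forms expresses isomorphism of rooted weighted
    trees. *)
Fixpoint rcanon (X : rtree) : rtree :=
  let: Node w cs := X in Node w (sort rtree_le (map rcanon cs)).

Fixpoint rpos (X : rtree) : bool :=
  let: Node w cs := X in (0 < w) && all rpos cs.

Fixpoint rcanonical (X : rtree) : bool :=
  let: Node w cs := X in [&& 0 < w, sorted rtree_le cs & all rcanonical cs].

Lemma wt_gt0 X : rpos X -> 0 < wt X.
Proof. by case: X => w cs /= /andP[w0 _]; rewrite addn_gt0 w0. Qed.

Lemma canonical_rpos X : rcanonical X -> rpos X.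
Proof.
elim/rtree_ind_mem: X => w cs IH /= /and3P[-> _ /allP H] /=.
by apply/allP => X Xcs; apply: IH (H _ Xcs).
Qed.

Lemma canonical_canon X : rpos X -> rcanonical (rcanon X).
Proof.
elim/rtree_ind_mem: X => w cs IH /= /andP[-> /allP H] /=.
rewrite sort_sorted //= all_sort all_map; apply/allP => X Xcs /=.
exact: IH (H _ Xcs).
Qed.

Lemma canon_id X : rcanonical X -> rcanon X = X.
Proof.
elim/rtree_ind_mem: X => w cs IH /= /and3P[_ so /allP H].
have -> : map rcanon cs = cs.
  by rewrite -[RHS]map_id; apply/eq_in_map => X Xcs; apply: IH (H _ Xcs).
by rewrite sorted_sort.
Qed.

Lemma wt_canon X : wt (rcanon X) = wt X.
Proof.
elim/rtree_ind_mem: X => w cs IH /=; congr addn.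
rewrite (perm_sumn (perm_map wt (permEl (perm_sort _ _)))) -map_comp.
by congr sumn; apply/eq_in_map => X /IH.
Qed.

Lemma canon_Node_perm w cs ds : rcanon (Node w cs) = rcanon (Node w ds) <->
  perm_eq (map rcanon cs) (map rcanon ds).
Proof.
split=> [[] /perm_sortP -> //|H /=]; congr Node; exact/perm_sortP.
Qed.

(** * Graphs obtained from weighted trees by blowing vertices up to cliques *)

(* The graph e restricted to S is the blow-up of X, and K is the clique replacing the root. *)
Inductive rep (V : finType) (e : rel V) : {set V} -> {set V} -> rtree -> Prop :=
| rep_one (K : {set V}) n :
    K != set0 -> {in K &, forall x y, x != y -> e x y} -> n = #|K| ->
    rep e K K (Node n [::])
| rep_join (A B S K L : {set V}) w cs X :
    rep e A K (Node w cs) -> rep e B L X -> [disjoint A & B] ->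
    {in A & B, forall x y, e x y = (x \in K) && (y \in L)} -> S = A :|: B ->
    rep e S K (Node w (X :: cs)).

Section Rep.

Variables (V : finType) (e : rel V).
Hypotheses (sym_e : symmetric e) (irr_e : irreflexive e).
Implicit Types (A B S K L P : {set V}) (X Y : rtree).

Lemma rep_root S K X : rep e S K X ->
  [/\ K \subset S, K != set0, {in K &, forall x y, x != y -> e x y} &
      exists cs, X = Node #|K| cs].
Proof.
elim=> {S K X} [K n K0 cK ->|A B S K L w cs X _ [KA K0 cK [cs' [-> _]]] _ _ _ _ ->].
  by split=> //; exists [::].
by split=> //; [apply: subset_trans KA (subsetUl _ _)|exists (X :: cs)].
Qed.

Lemma rep_wt S K X : rep e S K X -> wt X = #|S|.
Proof.
elim=> {S K X} [K n K0 cK ->|A B S K L w cs X _ /= IHA _ IHB dAB _ ->].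
  by rewrite /= addn0.
rewrite cardsU (disjoint_setI0 dAB) cards0 subn0 -IHA -IHB; lia.
Qed.

Lemma rep_rpos S K X : rep e S K X -> rpos X.
Proof.
elim=> {S K X} [K n K0 cK ->|A B S K L w cs X _ /= IHA _ IHB dAB _ _].
  by rewrite /= andbT card_gt0.
by case/andP: IHA => -> ->; rewrite IHB.
Qed.

(** Connectedness of a blow-up, phrased with sets closed under adjacency so that no paths occur: in
    the induction the closed set passes from [K] to [L] through the join between them. *)
Lemma rep_closure_root S K X P : rep e S K X -> P :&: K != set0 ->
  {in P & S, forall x y, e x y -> y \in P} -> S \subset P.
Proof.
move=> H; elim: H P => {S K X} [K n K0 cK _ P|A B S K L w cs X rA IHA rB IHB dAB cross -> P].
  case/set0Pn=> x /setIP[xP xK] clP; apply/subsetP=> y yK.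
  by have [<-//|nxy] := eqVneq x y; apply: (clP x y) => //; apply: cK.
move=> PK clP.
have AP : A \subset P.
  by apply: IHA => // x y xP yA; apply: clP => //; rewrite inE yA.
rewrite subUset AP /=; apply: IHB.
  have [KA /set0Pn[k kK] _ _] := rep_root rA.
  have [LB /set0Pn[l lL] _ _] := rep_root rB.
  have kA := subsetP KA _ kK; have lB := subsetP LB _ lL.
  apply/set0Pn; exists l; rewrite inE lL andbT.
  apply: (clP k); rewrite ?inE ?lB ?orbT // ?(subsetP AP) //.
  by rewrite cross // kK.
by move=> x y xP yB; apply: clP; rewrite // inE yB orbT.
Qed.

Lemma rep_closure S K X P x : rep e S K X -> x \in S -> x \in P ->
  {in P & S, forall x y, e x y -> y \in P} -> S \subset P.
Proof.
move=> rS xS xP clP.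
have [KS /set0Pn[k kK] _ _] := rep_root rS.
have [kP|kP] := boolP (k \in P).
  by apply: (rep_closure_root rS) => //; apply/set0Pn; exists k; rewrite inE kP.
(* If the root vertex [k] is outside [P], then by symmetry the complement of [P] in [S] is closed
   too; it contains [k], hence is all of [S], against [x \in P]. *)
have /subsetP/(_ x xS) : S \subset S :\: P.
  apply: (rep_closure_root rS).
    by apply/set0Pn; exists k; rewrite !inE kP kK (subsetP KS).
  move=> y z; rewrite !inE => /andP[yP yS] zS eyz; rewrite zS andbT.
  by apply: contra yP => zP; apply: (clP z); rewrite // sym_e.
by rewrite inE xP.
Qed.

Lemma rep_Node0 S K w : rep e S K (Node w [::]) -> S = K.
Proof. by move E : (Node w _) => Z rS; case: S K Z / rS E. Qed.

Lemma rep_ConsP S K w X cs : rep e S K (Node w (X :: cs)) ->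
  exists A B L, [/\ rep e A K (Node w cs), rep e B L X, [disjoint A & B],
    {in A & B, forall x y, e x y = (x \in K) && (y \in L)} & S = A :|: B].
Proof.
move E : (Node w _) => Z rS; case: S K Z / rS E => // A B S K L w1 cs1 X1.
by move=> rA rB dAB cross defS [-> -> ->]; exists A, B, L.
Qed.

(** [rep_join] only adds a branch in front. Its position is immaterial because the branches already
    present avoid [K] and so have no edges to the new one. *)
Lemma rep_insert A B S K L w ds1 ds2 X :
  rep e A K (Node w (ds1 ++ ds2)) -> rep e B L X -> [disjoint A & B] ->
  {in A & B, forall x y, e x y = (x \in K) && (y \in L)} -> S = A :|: B ->
  rep e S K (Node w (ds1 ++ X :: ds2)).
Proof.
elim: ds1 A S => [|Y ds1 IH] A S rA rB dAB cross -> /=.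
  exact: rep_join rA rB dAB cross _.
have [A1 [B1 [L1 [rA1 rB1 d1 cross1 defA]]]] := rep_ConsP rA.
rewrite {S A rA}defA in dAB cross *.
have [KA1 _ _ _] := rep_root rA1.
have [dA1 dB1] : [disjoint A1 & B] /\ [disjoint B1 & B].
  by move: dAB; rewrite -!setI_eq0 setIUl setU_eq0 => /andP.
apply: (@rep_join _ _ (A1 :|: B) B1 _ _ L1).
- apply: (IH A1) => //.
  by move=> x y xA yB; apply: cross; rewrite // inE xA.
- by [].
- by move: d1 dB1; rewrite -!setI_eq0 setIUl setU_eq0 (setIC B) => -> ->.
- move=> x y; rewrite inE => /orP[xA|xB] yB1; first exact: cross1.
  have xK : (x \in K) = false.
    apply: contraTF xB => xK; move/(subsetP KA1): xK.
    by move: dA1; rewrite disjoint_subset => /subsetP H /H.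
  rewrite xK sym_e cross // ?inE ?yB1 ?orbT //.
  suff -> : (y \in K) = false by [].
  apply: contraTF yB1 => /(subsetP KA1).
  by move: d1; rewrite disjoint_subset => /subsetP H /H.
- by rewrite setUAC.
Qed.

Lemma rep_perm S K w cs ds : rep e S K (Node w cs) -> perm_eq cs ds ->
  rep e S K (Node w ds).
Proof.
elim: cs S ds => [|X cs IH] S ds rS.
  by move/perm_size=> /esym/size0nil ->.
move=> pcs; have /path.splitPr defds : X \in ds by rewrite -(perm_mem pcs) mem_head.
move: pcs; case: defds => ds1 ds2; rewrite perm_sym -cat1s perm_catCA /= perm_cons perm_sym => pcs.
have [A [B [L [rA rB dAB cross ->]]]] := rep_ConsP rS.
exact: rep_insert (IH _ _ rA pcs) rB dAB cross _.
Qed.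

Lemma rep_canon S K X : rep e S K X -> rep e S K (rcanon X).
Proof.
elim=> {S K X} [K n K0 cK ->|A B S K L w cs X _ /= IHA _ IHB dAB cross ->].
  exact: rep_one.
apply: rep_perm (rep_join IHA IHB dAB cross erefl) _.
by rewrite perm_sym perm_sort /= perm_cons perm_sym perm_sort.
Qed.

(** Used to argue about a vertex outside the root clique: its branch is split off as if it had been
    joined last. *)
Lemma rep_branch S K w ds y : rep e S K (Node w ds) -> y \in S -> y \notin K ->
  exists ds' Y A B L, [/\ perm_eq ds (Y :: ds'), y \in B &
   [/\ rep e A K (Node w ds'), rep e B L Y, [disjoint A & B],
    {in A & B, forall x y, e x y = (x \in K) && (y \in L)} & S = A :|: B]].
Proof.
move=> rS yS yK; elim: ds S rS yS => [|X ds IH] S rS yS.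
  by rewrite (rep_Node0 rS) (negPf yK) in yS.
have [A [B [L [rA rB dAB cross defS]]]] := rep_ConsP rS.
move: (yS); rewrite defS inE => /orP[yA|yB]; last first.
  by exists ds, X, A, B, L; split.
have [ds' [Y [A' [B' [L' [pds yB' [rA' rB' dAB' cross' defA]]]]]]] := IH _ rA yA.
have [KA' _ _ _] := rep_root rA'.
have dA'B : [disjoint A' & B] /\ [disjoint B' & B].
  by move: dAB; rewrite defA -!setI_eq0 setIUl setU_eq0 => /andP.
case: dA'B => dA'B dB'B.
exists (X :: ds'), Y, (A' :|: B), B', L'; split=> //.
  by rewrite -[Y :: X :: _]/([:: Y] ++ [:: X] ++ _) perm_sym perm_catCA /= perm_cons perm_sym.
split=> //.
- apply: rep_join rA' rB dA'B _ erefl => x z xA zB.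
  by apply: cross; rewrite // defA inE xA.
- by move: dAB' dB'B; rewrite -!setI_eq0 setIUl setU_eq0 (setIC B) => -> ->.
- move=> x z; rewrite inE => /orP[xA|xB] zB'; first exact: cross'.
  have nK t : t \notin A' -> (t \in K) = false.
    by apply: contraNF => /(subsetP KA').
  rewrite (nK x) /=; last by apply: contraTN xB; move: dA'B; rewrite disjoint_subset => /subsetP H /H.
  rewrite sym_e cross // ?defA ?inE ?zB' ?orbT // nK //.
  by apply: contraTN zB'; move: dAB'; rewrite disjoint_subset => /subsetP H /H.
- by rewrite defA setUAC.
Qed.

(* The cut edge K-L determines the branch: leaving it requires passing through K. *)
Lemma rep_side_sub A B A' B' K L L' Z X :
  rep e B L X -> rep e B' L' Z ->
  [disjoint A & B] -> [disjoint A' & B'] ->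
  {in A & B, forall x y, e x y = (x \in K) && (y \in L)} -> K \subset A' ->
  A :|: B = A' :|: B' -> B :&: B' != set0 -> B' \subset B.
Proof.
move=> rB rB' dAB dAB' cross KA' defS /set0Pn[l /setIP[lB lB']].
apply: (rep_closure rB' lB' lB) => x y xB yB' exy.
have : y \in A :|: B by rewrite defS inE yB' orbT.
rewrite inE => /orP[yA|//]; move: exy; rewrite sym_e cross // => /andP[/(subsetP KA') yA' _].
by move: yA' yB'; move: dAB'; rewrite disjoint_subset => /subsetP H /H; rewrite inE => /negPf->.
Qed.

(** By connectedness each of the two branches contains the other, and [L] is recovered as the
    neighbours in [B] of any root vertex. *)
Lemma rep_side_eq A B A' B' K L L' Z X w w' cs cs' :
  rep e A K (Node w cs) -> rep e A' K (Node w' cs') ->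
  rep e B L X -> rep e B' L' Z ->
  [disjoint A & B] -> [disjoint A' & B'] ->
  {in A & B, forall x y, e x y = (x \in K) && (y \in L)} ->
  {in A' & B', forall x y, e x y = (x \in K) && (y \in L')} ->
  A :|: B = A' :|: B' -> B :&: B' != set0 -> [/\ A = A', B = B' & L = L'].
Proof.
move=> rA rA' rB rB' dAB dAB' cross cross' defS BB'.
have [KA /set0Pn[k kK] _ _] := rep_root rA; have [KA' _ _ _] := rep_root rA'.
have eB : B = B'.
  apply/eqP; rewrite eqEsubset; apply/andP; split.
    apply: (rep_side_sub rB' rB dAB' dAB cross') => //; by rewrite setIC.
  exact: (rep_side_sub rB rB' dAB dAB' cross).
have eA : A = A'.
  have eAS (C D : {set V}) : [disjoint C & D] -> C = (C :|: D) :\: D.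
    by move=> dCD; rewrite setDUl setDv setU0; apply/esym/setDidPl.
  by rewrite (eAS _ _ dAB) defS eB -(eAS _ _ dAB').
split=> //; apply/setP=> y.
have [LB _ _ _] := rep_root rB; have [LB' _ _ _] := rep_root rB'.
have kA := subsetP KA _ kK; have kA' := subsetP KA' _ kK.
have [yB|yB] := boolP (y \in B).
  have yB' : y \in B' by rewrite -eB.
  by have := cross _ _ kA yB; rewrite cross' // kK => /= ->.
rewrite (contraNF (subsetP LB y) yB).
by rewrite (contraNF (subsetP LB' y)) // -eB.
Qed.

(** The root clique determines the tree: a vertex of the first branch of [X] lies in some branch of
    [Y], [rep_side_eq] identifies the two branches, and induction applies to the branch and to the
    remainder. *)
Lemma rep_canon_uniq S K X Y : rep e S K X -> rep e S K Y -> rcanon X = rcanon Y.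
Proof.
move=> H; elim: H Y => {S K X} [K n K0 cK ->|A B S K L w cs X rA IHA rB IHB dAB cross ->] Y.
  move=> rY; have [_ _ _ [[//|Z ds] defY]] := rep_root rY; subst Y => //.
  have [A [B [L [rA rB dAB _ defK]]]] := rep_ConsP rY.
  have [KA _ _ _] := rep_root rA; have [LB /set0Pn[l lL] _ _] := rep_root rB.
  have lB := subsetP LB _ lL.
  have : l \in A by apply: (subsetP KA); rewrite defK inE lB orbT.
  by move: dAB; rewrite disjoint_subset => /subsetP H /H; rewrite inE lB.
case: Y => w' ds rY.
have [KA /set0Pn[k kK] _ [cs1 [ew _]]] := rep_root rA.
have [LB /set0Pn[l lL] _ _] := rep_root rB.
have lB := subsetP LB _ lL; have kA := subsetP KA _ kK.
have lS : l \in A :|: B by rewrite inE lB orbT.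
have lK : l \notin K.
  by apply: contraTN lB => /(subsetP KA); move: dAB; rewrite disjoint_subset => /subsetP H /H.
have [ds' [Z [A' [B' [L' [pds lB' [rA' rB' dAB' cross' defS]]]]]]] := rep_branch rY lS lK.
have BB' : B :&: B' != set0 by apply/set0Pn; exists l; rewrite inE lB.
have [eA eB eL] := rep_side_eq rA rA' rB rB' dAB dAB' cross cross' defS BB'.
subst A' B' L'.
have := IHA _ rA'; have eX := IHB _ rB'.
have [_ _ _ [ds1 [ew' _]]] := rep_root rA'; rewrite -ew in ew'; subst w'.
move/canon_Node_perm => p1; apply/canon_Node_perm.
rewrite perm_sym (permPl (perm_map rcanon pds)) /= -eX perm_cons perm_sym //.
Qed.

(** [rep_join] treats its two sides alike except for the choice of the root clique, so exchanging
    [A] and [B] moves the root across one tree edge. *)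
Lemma rep_reroot S K w w' X cs cs' ds : rep e S K (Node w cs) ->
  perm_eq cs (X :: cs') -> X = Node w' ds ->
  exists L, rep e S L (Node w' (Node w cs' :: ds)).
Proof.
move=> rS /(rep_perm rS)/rep_ConsP[A [B [L [rA rB dAB cross defS]]]] eX.
exists L; rewrite eX in rB; apply: rep_join rB rA _ _ _.
- by rewrite disjoint_sym.
- by move=> x y xB yA; rewrite sym_e cross // andbC.
- by rewrite setUC.
Qed.

End Rep.

Lemma rep_transport (V V' : finType) (e : rel V) (e' : rel V') (f : V -> V') S K X :
  injective f -> {mono f : x y / e x y >-> e' x y} ->
  rep e S K X -> rep e' (f @: S) (f @: K) X.
Proof.
move=> inj_f mf; elim=> {S K X} [K n K0 cK ->|A B S K L w cs X rA IHA rB IHB dAB cross ->].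
  apply: rep_one; rewrite ?card_imset //.
    by case/set0Pn: K0 => x xK; apply/set0Pn; exists (f x); rewrite imset_f.
  move=> _ _ /imsetP[x xK ->] /imsetP[y yK ->]; rewrite mf (inj_eq inj_f).
  exact: cK.
apply: rep_join IHA IHB _ _ _.
- by rewrite -setI_eq0 -imsetI ?(disjoint_setI0 dAB) ?imset0 //; apply: in2W.
- move=> _ _ /imsetP[x xK ->] /imsetP[y yK ->].
  by rewrite mf cross // !mem_imset.
- exact: imsetU.
Qed.

Lemma rep_iso (V V' : finType) (e : rel V) (e' : rel V') S S' K K' X :
  symmetric e -> symmetric e' -> irreflexive e -> irreflexive e' ->
  rep e S K X -> rep e' S' K' X ->
  exists f : V -> V', [/\ {in S &, injective f}, f @: S = S', f @: K = K' &
    {in S &, forall x y, e' (f x) (f y) = e x y}].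
Proof.
move=> sym sym' irr irr' H; elim: H S' K' => {S K X}
  [K n K0 cK ->|A B S K L w cs X rA IHA rB IHB dAB cross ->] S' K'.
  move=> r'; have [_ K'0 cK' [_ [cKK' _]]] := rep_root r'; rewrite (rep_Node0 r').
  have [x' x'K'] := set0Pn _ K'0.
  have iK x : x \in K -> index x (enum K) < size (enum K').
    by move=> xK; rewrite -cardE -cKK' cardE index_mem mem_enum.
  (* Vertices of two cliques of equal size are matched by their rank in the enumerations. *)
  pose f x := nth x' (enum K') (index x (enum K)).
  have inj : {in K &, injective f}.
    move=> x y xK yK /eqP; rewrite nth_uniq ?iK ?enum_uniq // => /eqP /index_inj.
    by apply; rewrite ?mem_enum.
  have fK x : x \in K -> f x \in K'.
    by move=> xK; rewrite -mem_enum mem_nth // iK.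
  have imK : f @: K = K'.
    apply/eqP; rewrite eqEcard card_in_imset // cKK' leqnn andbT.
    by apply/subsetP => _ /imsetP[x xK ->]; apply: fK.
  exists f; split=> // x y xK yK; have [<-|nxy] := eqVneq x y; first by rewrite irr irr'.
  by rewrite cK // cK' ?fK //; apply: contra nxy => /eqP /inj ->.
move=> /rep_ConsP[A' [B' [L' [rA' rB' dAB' cross' ->]]]].
have [f [injf imA imK mf]] := IHA _ _ rA'.
have [g [injg imB imL mg]] := IHB _ _ rB'.
have BA x : x \in B -> (x \in A) = false.
  by move=> xB; apply: contraTF xB; move: dAB; rewrite disjoint_subset => /subsetP H /H.
have [KA _ _ _] := rep_root rA; have [LB _ _ _] := rep_root rB.
pose h x := if x \in A then f x else g x.
have hA : {in A, h =1 f} by move=> x xA; rewrite /h xA.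
have hB : {in B, h =1 g} by move=> x xB; rewrite /h BA.
have fA x : x \in A -> f x \in A' by move=> xA; rewrite -imA imset_f.
have gB x : x \in B -> g x \in B' by move=> xB; rewrite -imB imset_f.
have A'B' x y : x \in A' -> y \in B' -> x <> y.
  move=> xA yB exy; rewrite exy in xA.
  by move: yB; move: dAB'; rewrite disjoint_subset => /subsetP/(_ _ xA); rewrite inE => /negPf->.
have fK x : x \in A -> (f x \in K') = (x \in K).
  move=> xA; rewrite -imK; apply/imsetP/idP => [[y yK /injf]|xK]; last by exists x.
  by move=> /(_ xA (subsetP KA _ yK)) ->.
have gL x : x \in B -> (g x \in L') = (x \in L).
  move=> xB; rewrite -imL; apply/imsetP/idP => [[y yK /injg]|xK]; last by exists x.
  by move=> /(_ xB (subsetP LB _ yK)) ->.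
exists h; split.
- move=> x y; rewrite !inE => /orP[xA|xB] /orP[yA|yB].
  + by rewrite !hA //; apply: injf.
  + by rewrite hA // hB // => /A'B'; case; [apply: fA|apply: gB].
  + by rewrite hB // hA // => /esym/A'B'; case; [apply: fA|apply: gB].
  + by rewrite !hB //; apply: injg.
- by rewrite imsetU (eq_in_imset hA) (eq_in_imset hB) imA imB.
- by rewrite -imK; apply: eq_in_imset => x /(subsetP KA) /hA.
- move=> x y; rewrite !inE => /orP[xA|xB] /orP[yA|yB].
  + by rewrite !hA // mf.
  + by rewrite hA // hB // cross // cross' ?fA ?gB // fK // gL.
  + by rewrite hB // hA // sym' (sym x) cross // cross' ?fA ?gB // fK // gL.
  + by rewrite !hB // mg.
Qed.

Lemma rep_realize X : rpos X ->
  exists (V : finType) (e : rel V) K, [/\ symmetric e, irreflexive e & rep e setT K X].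
Proof.
elim/rtree_ind_mem: X => w cs IH /= /andP[w0].
elim: cs IH => [|X cs IHcs] IH /=.
  move=> _; exists 'I_w, (fun x y => x != y), setT; split.
  - by move=> x y; rewrite eq_sym.
  - by move=> x; rewrite eqxx.
  - apply: rep_one => //; last by rewrite cardsT card_ord.
    by apply/set0Pn; exists (Ordinal w0).
case/andP=> pX pcs.
have [|V1 [e1 [K1 [sym1 irr1 r1]]]] := IHcs _ pcs.
  by move=> Y Ycs; apply: IH; rewrite inE Ycs orbT.
have [|V2 [e2 [K2 [sym2 irr2 r2]]]] := IH X _ pX; first by rewrite inE eqxx.
pose e (x y : V1 + V2) := match x, y with
  | inl x, inl y => e1 x y | inr x, inr y => e2 x y
  | inl x, inr y => (x \in K1) && (y \in K2)
  | inr y, inl x => (x \in K1) && (y \in K2) end.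
have injl : injective (@inl V1 V2) by move=> x y [].
have injr : injective (@inr V1 V2) by move=> x y [].
have nlr (x : V1) (S : {set V2}) : (inl x \in [set inr y | y in S]) = false.
  by apply/imsetP => -[y].
have nrl (x : V2) (S : {set V1}) : (inr x \in [set inl y | y in S]) = false.
  by apply/imsetP => -[y].
exists (V1 + V2)%type, e, (inl @: K1); split.
- by move=> [x|x] [y|y] //=.
- by move=> [x|x] //=.
- apply: rep_join (rep_transport (e' := e) injl _ r1) (rep_transport (e' := e) injr _ r2) _ _ _ => //.
  + by rewrite -setI_eq0; apply/eqP/setP => -[x|x]; rewrite !inE ?nlr ?nrl ?andbF.
  + by move=> _ _ /imsetP[x _ ->] /imsetP[y _ ->] /=; rewrite !mem_imset.
  + by apply/setP => -[x|x]; rewrite !inE ?nlr ?nrl ?orbF /= mem_imset ?inE.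
Qed.

(** * Twin classes, centroids, and the code of a graph *)

Fixpoint nnodes (X : rtree) : nat :=
  let: Node _ cs := X in (sumn (map nnodes cs)).+1.

Lemma nnodes_gt0 X : 0 < nnodes X. Proof. by case: X. Qed.

Lemma nnodes_eq1 X : nnodes X = 1 -> exists w, X = Node w [::].
Proof. by case: X => w [|Y cs] //=; [exists w|have := nnodes_gt0 Y; lia]. Qed.

Lemma nnodes_eq2 X : nnodes X = 2 -> exists w v, X = Node w [:: Node v [::]].
Proof.
case: X => w [//|Y [|Z cs]] /=; last by have := nnodes_gt0 Y; have := nnodes_gt0 Z; lia.
by rewrite addn0 => -[] /nnodes_eq1[v ->]; exists w, v.
Qed.

Lemma nnodes_perm w cs ds : perm_eq cs ds -> nnodes (Node w cs) = nnodes (Node w ds).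
Proof. by move=> /= p; rewrite (perm_sumn (perm_map nnodes p)). Qed.

Lemma wt_rem w c cs : c \in cs -> wt (Node w cs) = wt c + wt (Node w (rem c cs)).
Proof.
by move=> ccs; rewrite /= (perm_sumn (perm_map wt (perm_to_rem ccs))) /= addnCA.
Qed.

Lemma nnodes_rem w c cs : c \in cs ->
  nnodes (Node w cs) = nnodes c + nnodes (Node w (rem c cs)).
Proof.
by move=> ccs; rewrite /= (perm_sumn (perm_map nnodes (perm_to_rem ccs))) /= addnS.
Qed.

Lemma nnodes_canon X : nnodes (rcanon X) = nnodes X.
Proof.
elim/rtree_ind_mem: X => w cs IH /=; congr _.+1.
rewrite (perm_sumn (perm_map nnodes (permEl (perm_sort _ _)))) -map_comp.
by congr sumn; apply/eq_in_map => X /IH.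
Qed.

Definition centered (n : nat) (X : rtree) : bool :=
  all (fun c => (wt c).*2 <= n) (children X).

Lemma centered_canon n X : centered n (rcanon X) = centered n X.
Proof.
case: X => w cs; rewrite /centered /= all_sort all_map.
by apply: eq_all => c /=; rewrite wt_canon.
Qed.

Section Twins.

Variables (V : finType) (e : rel V).
Hypotheses (sym_e : symmetric e) (irr_e : irreflexive e).
Implicit Types (A B S K L P : {set V}) (X Y : rtree).

Lemma rep_root_uniform S K X x y z : rep e S K X -> x \in K -> y \in K ->
  z \in S -> z \notin K -> e x z = e y z.
Proof.
move=> rS xK yK; elim: rS xK yK => {S K X} [K n K0 cK _ _ _ ->//|].
move=> A B S K L w cs X rA IHA rB IHB dAB cross -> xK yK; rewrite inE => /orP[zA|zB] zK.
  exact: IHA.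
have [KA _ _ _] := rep_root rA; have sA := subsetP KA.
by rewrite !cross ?sA // xK yK.
Qed.

Definition cN x := [set z | (z == x) || e x z].

(** The root clique is intrinsic. An outside twin [y] of [x] would lie in a clique [L] joined to
    [K]; a further branch at either end of that tree edge contains a vertex adjacent to only one of
    the two, so the tree would have exactly two nodes. *)
Lemma rep_twin S K X x y : rep e S K X -> nnodes X != 2 -> x \in K -> y \in S ->
  reflect {in S, cN x =i cN y} (y \in K).
Proof.
move=> rS nX xK yS; apply: (iffP idP) => [yK z zS|tw].
  have [KS _ cK _] := rep_root rS; rewrite !inE.
  have [zK|zK] := boolP (z \in K); last first.
    rewrite (rep_root_uniform rS xK yK zS zK).
    by congr orb; apply/eqP/eqP => E; move: zK; rewrite E ?xK ?yK.
  have H u : u \in K -> (z == u) || e u z.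
    by move=> uK; case: eqVneq => //= nzu; apply: cK; rewrite // eq_sym.
  by rewrite !H.
apply: contraT => yK.
case: X rS nX => w ds rS nX.
have [ds' [Y [A [B [L [pds yB [rA rB dAB cross defS]]]]]]] := rep_branch sym_e rS yS yK.
have [KA _ _ _] := rep_root rA; have [LB _ _ _] := rep_root rB.
have xA := subsetP KA _ xK.
have nxy : x != y by apply: contraNneq yK => <-.
have exy : e x y.
  have /tw : x \in S by rewrite defS inE xA.
  by rewrite !inE eqxx (negPf nxy) /= sym_e => /esym.
have yL : y \in L by move: exy; rewrite cross // xK.
(* A second branch at the root has a vertex [l] joined to [K]; it is a neighbour of [x] but not of
   [y]. *)
case: ds' pds rA => [|Z ds'] pds rA; last first.
  have [A1 [B1 [L1 [rA1 rB1 dAB1 cross1 defA]]]] := rep_ConsP rA.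
  have [KA1 _ _ _] := rep_root rA1.
  have [LB1 /set0Pn[l lL] _ _] := rep_root rB1; have lB := subsetP LB1 _ lL.
  have lA : l \in A by rewrite defA inE lB orbT.
  have lS : l \in S by rewrite defS inE lA.
  have /esym := tw _ lS; rewrite !inE (cross1 _ _ (subsetP KA1 _ xK) lB) xK lL orbT.
  rewrite sym_e cross // (contraNF (subsetP KA1 l)); last first.
    by rewrite (disjointFl dAB1).
  by rewrite orbF => /eqP ely; move: yB; rewrite -ely (disjointFr dAB).
have defA := rep_Node0 rA.
(* Without a second branch, a child of [Y] supplies a vertex [l] adjacent to [y] but not to [x];
   without such a child there are two nodes. *)
case: Y rB pds => v [|Z es] rB pds.
  by move: nX; rewrite (nnodes_perm _ pds).
have [A1 [B1 [L1 [rA1 rB1 dAB1 cross1 defB]]]] := rep_ConsP rB.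
have [LA1 _ _ _] := rep_root rA1.
have [LB1 /set0Pn[l lL] _ _] := rep_root rB1; have lB1 := subsetP LB1 _ lL.
have lB : l \in B by rewrite defB inE lB1 orbT.
have lS : l \in S by rewrite defS inE lB orbT.
have lNL : (l \in L) = false.
  by apply: (contraNF (subsetP LA1 l)); rewrite (disjointFl dAB1).
have := tw _ lS; rewrite !inE (cross _ _ xA lB) lNL andbF orbF (cross1 _ _ (subsetP LA1 _ yL) lB1) yL lL orbT.
by move/eqP => elx; move: lB; rewrite elx (disjointFr dAB).
Qed.

Lemma rep_complete S K X : rep e S K X -> nnodes X <= 2 ->
  {in S &, forall x y, x != y -> e x y}.
Proof.
move=> rS; have [KS _ cK _] := rep_root rS.
case E : (nnodes X) => [|[|[|//]]] _.
- by have := nnodes_gt0 X; rewrite E.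
- by have [w eX] := nnodes_eq1 E; rewrite eX in rS; rewrite (rep_Node0 rS).
have [w [v eX]] := nnodes_eq2 E; rewrite eX in rS.
have [A [B [L [rA rB dAB cross ->]]]] := rep_ConsP rS.
have eA := rep_Node0 rA; have eB := rep_Node0 rB; subst A B.
have [_ _ cL _] := rep_root rB.
move=> x y; rewrite !inE => /orP[xK|xL] /orP[yK|yL] nxy.
- exact: cK.
- by rewrite cross // xK.
- by rewrite sym_e cross // yK.
- exact: cL.
Qed.

(** Walk towards the heavy child. After the root has crossed to it, the part left behind weighs less
    than half, so any new heavy child lies inside the old one and is lighter by the positive weight
    of the new root. *)
Lemma rep_centered K X : rep e setT K X -> exists K' X',
  [/\ rep e setT K' X', nnodes X' = nnodes X & centered #|V| X'].
Proof.
set n := #|V|.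
have wX K0 X0 : rep e setT K0 X0 -> wt X0 = n by move/rep_wt ->; rewrite cardsT.
(* [m] bounds the weight of a heavy child, if there is one, and drives the induction. *)
suff H m K0 X0 : rep e setT K0 X0 ->
    all (fun c => (n < (wt c).*2) ==> (wt c <= m)) (children X0) ->
    exists K' X', [/\ rep e setT K' X', nnodes X' = nnodes X0 & centered n X'].
  move=> rT; apply: (H n _ _ rT); apply/allP => c cX; apply/implyP => _.
  rewrite -(wX _ _ rT); case: (X) cX => w cs /=.
  by move=> /path.splitPr[cs1 cs2]; rewrite map_cat sumn_cat /=; lia.
elim: m K0 X0 => [|m IH] K0 X0 rT hm.
  exists K0, X0; split=> //; apply/allP => c /(allP hm).
  by rewrite leqNgt; case: ltnP => //=; lia.
have [?|/allPn[c cX hc]] := boolP (centered n X0); first by exists K0, X0.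
rewrite -ltnNge in hc; have := allP hm _ cX; rewrite hc /= => cm.
case: X0 rT cX hm => w cs rT /= cX hm.
have pcs := perm_to_rem cX.
case: c cX hc cm pcs => v ds cX hc cm pcs.
have [L rL] := rep_reroot sym_e rT pcs erefl.
have wcs : wt (Node v ds) + wt (Node w (rem (Node v ds) cs)) = n.
  rewrite -(wX _ _ rT) /=.
  by rewrite (perm_sumn (perm_map wt pcs)) /=; lia.
have [|K' [X' [rT' nX' cX']]] := IH _ _ rL; last first.
  exists K', X'; split=> //; rewrite nX' /= (perm_sumn (perm_map nnodes pcs)) /=; lia.
apply/allP => d; rewrite inE => /predU1P[->|dds]; apply/implyP; first by lia.
have v0 : 0 < v by have := rep_rpos rL; move=> /= /andP[].
move=> _; move: cm; case/path.splitPr: dds => ds1 ds2 /=.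
by rewrite map_cat sumn_cat /=; lia.
Qed.

(** Root cliques are twin classes, so they agree or are disjoint. If disjoint, the side [A] of [K]
    lies in the branch [B'] of the other tree that leads to [K]. As neither [B] nor [B'] exceeds
    half of the vertices, [A = B'] and [B = A']: the centroids are adjacent and each side weighs
    exactly half. *)
Lemma rep_centered_uniq K K' w w' ds ds' :
  rep e setT K (Node w ds) -> rep e setT K' (Node w' ds') ->
  nnodes (Node w ds) != 2 -> nnodes (Node w' ds') != 2 ->
  centered #|V| (Node w ds) -> centered #|V| (Node w' ds') ->
  rcanon (Node w ds) = rcanon (Node w' ds') \/
  exists Y Y' cs cs', [/\ perm_eq ds (Y :: cs), perm_eq ds' (Y' :: cs'),
    rcanon Y = rcanon (Node w' cs'), rcanon Y' = rcanon (Node w cs) &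
    (wt Y).*2 = #|V| /\ (wt Y').*2 = #|V|].
Proof.
move=> rT rT' nX nX' cX cX'.
have [eKK'|nKK'] := eqVneq K K'; first subst K'.
  by left; apply: rep_canon_uniq rT rT'.
right.
have [_ /set0Pn[k kK] _ _] := rep_root rT; have [_ /set0Pn[k' kK'] cK' _] := rep_root rT'.
have KK' x : x \in K -> x \in K' -> False.
  move=> xK xK'; case/eqP: nKK'; apply/setP => y.
  by apply/(rep_twin rT nX xK (in_setT y))/(rep_twin rT' nX' xK' (in_setT y)).
have k'K : k' \notin K by apply/negP => /KK'; apply.
have kNK' : k \notin K' by apply/negP => /(KK' _ kK).
have [cs [Y [A [B [L [pds k'B [rA rB dAB cross defT]]]]]]] :=
  rep_branch sym_e rT (in_setT k') k'K.
have [cs' [Y' [A' [B' [L' [pds' kB' [rA' rB' dAB' cross' defT']]]]]]] :=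
  rep_branch sym_e rT' (in_setT k) kNK'.
have [KA _ _ _] := rep_root rA; have kA := subsetP KA _ kK.
have AK' y : y \in A -> y \in K' -> False.
  move=> yA yK'; have nyk : y != k'.
    by apply: contraTneq k'B => <-; rewrite (disjointFr dAB).
  have := cK' _ _ yK' kK' nyk; rewrite cross // => /andP[yK _].
  exact: KK' yK yK'.
(* [A] is connected and meets [B']; leaving [B'] would mean entering the clique [K'], which [A]
   avoids. *)
have AB' : A \subset B'.
  apply: (rep_closure sym_e rA kA kB') => x y xB' yA exy.
  have := in_setT y; rewrite defT' inE => /orP[yA'|//].
  by move: exy; rewrite sym_e cross' // => /andP[/(AK' _ yA)].
have card_split (C D : {set V}) : [disjoint C & D] -> setT = C :|: D -> #|C| + #|D| = #|V|.
  by move=> dCD E; rewrite -cardsT E cardsU (disjoint_setI0 dCD) cards0 subn0.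
have cAB := card_split _ _ dAB defT; have cAB' := card_split _ _ dAB' defT'.
have hB : #|B|.*2 <= #|V|.
  by rewrite -(rep_wt rB); apply: (allP cX); rewrite (perm_mem pds) mem_head.
have hB' : #|B'|.*2 <= #|V|.
  by rewrite -(rep_wt rB'); apply: (allP cX'); rewrite (perm_mem pds') mem_head.
have leAB' := subset_leq_card AB'.
have leB'A : #|B'| <= #|A|.
  move: cAB hB hB'; move: {+}#|A| {+}#|B| {+}#|B'| {+}#|V| => a b b' n; clear; lia.
have eAB' : A = B' by apply/eqP; rewrite eqEcard AB'.
subst B'.
have eBA' : B = A'.
  apply/setP => x; have := in_setT x; rewrite defT; have := in_setT x; rewrite defT' !inE.
  have [xB|xB] := boolP (x \in B).
    by rewrite (disjointFl dAB xB) orbF => ->.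
  by rewrite orbF => _ xA; rewrite (disjointFl dAB' xA).
subst A'.
have [LB /set0Pn[l lL] _ _] := rep_root rB; have lB := subsetP LB _ lL.
have [LA /set0Pn[l' lL'] _ _] := rep_root rB'; have lA := subsetP LA _ lL'.
have xAB x y : x \in A -> y \in B -> (x \in K) && (y \in L) = (y \in K') && (x \in L').
  by move=> xA yB; rewrite -cross // sym_e cross'.
have eL : L = K'.
  have [KB' _ _ _] := rep_root rA'.
  have kL' : k \in L' by have := xAB _ _ kA lB; rewrite kK lL /= => /esym/andP[].
  apply/setP => y; have [yB|yB] := boolP (y \in B).
    by have := xAB _ _ kA yB; rewrite kK kL' andbT.
  by rewrite (contraNF (subsetP LB y) yB) (contraNF (subsetP KB' y) yB).
have eK : L' = K.
  have lK' : l \in K' by rewrite -eL.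
  apply/setP => y; have [yA|yA] := boolP (y \in A).
    by have := xAB _ _ yA lB; rewrite lK' lL andbT.
  by rewrite (contraNF (subsetP LA y) yA) (contraNF (subsetP KA y) yA).
subst L L'.
exists Y, Y', cs, cs'; split=> //.
- exact: rep_canon_uniq rB rA'.
- exact: rep_canon_uniq rB' rA.
- rewrite (rep_wt rB) (rep_wt rB'); split; move: cAB cAB' hB hB';
  move: {+}#|A| {+}#|B| {+}#|V| => a b n; clear; lia.
Qed.

End Twins.

(* The weighted trees whose blow-ups are the connected 3-leaf powers, rooted at their centroid;
   if there are two centroids, the order on rooted trees selects one of them. *)
Definition centroid_code (n : nat) (X : rtree) : bool :=
  [&& rcanonical X, wt X == n, nnodes X != 2, centered n X &
   let: Node w cs := X in
   all (fun c => ((wt c).*2 == n) ==> rtree_le (Node w (rem c cs)) c) cs].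

Lemma sorted_rem c cs : sorted rtree_le cs -> sorted rtree_le (rem c cs).
Proof. exact/subseq_sorted/rem_subseq/rtree_le_trans. Qed.

Lemma canonical_rem w c cs : rcanonical (Node w cs) -> rcanonical (Node w (rem c cs)).
Proof.
move=> /= /and3P[-> /sorted_rem -> /allP H] /=.
by apply/allP => d /mem_rem /H.
Qed.

Lemma rcanonicalE w cs :
  rcanonical (Node w cs) = [&& 0 < w, sorted rtree_le cs & all rcanonical cs].
Proof. by []. Qed.

Lemma rcanonical_child w c cs : c \in cs -> rcanonical (Node w cs) -> rcanonical c.
Proof. by move=> ccs /and3P[_ _ /allP/(_ _ ccs)]. Qed.

Lemma canon_sorted_rem w c cs : rcanonical (Node w cs) -> 
  rcanon (Node w (rem c cs)) = Node w (rem c cs).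
Proof. by move=> H; apply/canon_id/canonical_rem. Qed.

Section Code.

Variables (V : finType) (e : rel V).
Hypotheses (sym_e : symmetric e) (irr_e : irreflexive e).

Lemma code_exists K X : rep e setT K X ->
  exists2 X', centroid_code #|V| X' & exists K', rep e setT K' X'.
Proof.
(* A two-node tree blows up to a complete graph, which also comes from the one-node tree; the latter
   is kept. *)
move=> rT; wlog nX : K X rT / nnodes X != 2.
  move=> H; have [n2|n2] := eqVneq (nnodes X) 2; last exact: H rT n2.
  have cT := rep_complete sym_e rT (eq_leq n2).
  apply: (H setT (Node #|V| [::])) => //; apply: rep_one; rewrite ?cardsT //.
  by have [KS /set0Pn[k kK] _ _] := rep_root rT; apply/set0Pn; exists k.
have [K1 [X1 [rT1 nX1 cX1]]] := rep_centered sym_e rT.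
have canX := canonical_canon (rep_rpos rT1).
move: nX cX1 canX; rewrite -nX1 -nnodes_canon -centered_canon.
have := rep_canon sym_e rT1; move: (rcanon X1) => {rT X nX1 rT1 X1 K} -[w ds].
move=> rT nX cX canX; have wX : wt (Node w ds) = #|V| by rewrite (rep_wt rT) cardsT.
set P := fun c : rtree => ((wt c).*2 == #|V|) ==> rtree_le (Node w (rem c ds)) c.
have [hP|] := boolP (all P ds).
  by exists (Node w ds); [apply/and5P; split=> //; apply/eqP|exists K1].
(* Here the order prefers the other centroid, the child [c] carrying half of the weight; the tree is
   rerooted there. *)
case/allPn => -[v es] cds; rewrite negb_imply => /andP[/eqP w2 nle].
have pds := perm_to_rem cds.
have [L rL] := rep_reroot sym_e rT pds erefl.
set c := Node v es in cds w2 nle pds; set Y := Node w _ in rL nle.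
have {nle} cY : rtree_le c Y by have := rtree_le_total c Y; rewrite (negPf nle) orbF.
have wY : (wt Y).*2 = #|V|.
  by move: wX w2; rewrite (wt_rem w cds) -/Y; move: (wt c) (wt Y) => a b; lia.
have canY : rcanonical Y by apply: canonical_rem.
have nY : nnodes (Node w ds) = nnodes c + nnodes Y by apply: nnodes_rem.
clearbody Y; have canc : rcanonical c by apply: rcanonical_child cds canX.
have := canc; rewrite rcanonicalE => /and3P[v0 sortes canes].
have cZ : rcanonical (Node v (sort rtree_le (Y :: es))).
  by rewrite rcanonicalE v0 sort_sorted // all_sort /= canY.
have rZ : rep e setT L (Node v (sort rtree_le (Y :: es))).
  by apply: rep_perm rL _; rewrite // perm_sym perm_sort.
(* After rerooting, [Y] is the only child of weight n / 2, so the order condition concerns it alone,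
   where it is [cY]. *)
have light d : d \in es -> (wt d).*2 < #|V|.
  by move=> des; rewrite -w2 /c (wt_rem v des) /=; lia.
exists (Node v (sort rtree_le (Y :: es))); last by exists L.
apply/and5P; split=> //.
- by apply/eqP; rewrite (rep_wt rZ) cardsT.
- rewrite (@nnodes_perm v _ (Y :: es)) ?perm_sort // (_ : nnodes _ = nnodes (Node w ds)) //.
  by rewrite nY /=; lia.
- rewrite /centered /= all_sort /= wY leqnn; by apply/allP => d /light/ltnW.
have -> : all (fun c0 => ((wt c0).*2 == #|V|) ==>
    rtree_le (Node v (rem c0 (sort rtree_le (Y :: es)))) c0) (sort rtree_le (Y :: es)) =
  rtree_le (Node v (rem Y (sort rtree_le (Y :: es)))) Y.
  rewrite all_sort /= wY eqxx /=; case: rtree_le => //=.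
  by apply/allP => d /light; rewrite ltn_neqAle => /andP[/negPf-> _].
have -> // : rem Y (sort rtree_le (Y :: es)) = es.
apply: (sorted_eq rtree_le_trans rtree_le_anti) => //.
  by apply/sorted_rem/sort_sorted.
rewrite -(perm_cons Y) perm_sym -(permPr (perm_to_rem _)) ?mem_sort ?mem_head //.
by rewrite perm_sym perm_sort.
Qed.

(** If the roots differ, the two codes arise from each other by crossing the edge between the two
    centroids. Their order conditions are opposite inequalities between the same two halves, so
    these halves are equal, and then so are the codes. *)
Lemma code_uniq K K' X X' : rep e setT K X -> rep e setT K' X' ->
  centroid_code #|V| X -> centroid_code #|V| X' -> X = X'.
Proof.
case: X X' => [w ds] [w' ds'] rT rT'.
case/and5P=> cX _ nX centX /allP hX /and5P[cX' _ nX' centX' /allP hX'].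
rewrite -(canon_id cX) -(canon_id cX').
have [//|[Y [Y' [cs [cs' [p p' eY eY' [wY wY']]]]]]] :=
  rep_centered_uniq sym_e rT rT' nX nX' centX centX'.
have Yds : Y \in ds by rewrite (perm_mem p) mem_head.
have Yds' : Y' \in ds' by rewrite (perm_mem p') mem_head.
have pcs : perm_eq (rem Y ds) cs.
  by rewrite -(perm_cons Y) -(permPl (perm_to_rem Yds)).
have pcs' : perm_eq (rem Y' ds') cs'.
  by rewrite -(perm_cons Y') -(permPl (perm_to_rem Yds')).
have cY : rcanonical Y by apply: rcanonical_child Yds cX.
have cY' : rcanonical Y' by apply: rcanonical_child Yds' cX'.
have er : rcanon (Node w cs) = Node w (rem Y ds).
  rewrite -(canon_sorted_rem Y cX); apply/canon_Node_perm/perm_map.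
  by rewrite perm_sym.
have er' : rcanon (Node w' cs') = Node w' (rem Y' ds').
  rewrite -(canon_sorted_rem Y' cX'); apply/canon_Node_perm/perm_map.
  by rewrite perm_sym.
rewrite canon_id // er' in eY; rewrite canon_id // er in eY'.
have := hX _ Yds; rewrite wY eqxx /= -eY' => le1.
have := hX' _ Yds'; rewrite wY' eqxx /= -eY => le2.
have eYY : Y = Y' by apply: rtree_le_anti; rewrite /= le1 le2.
have [-> ers] : Node w (rem Y ds) = Node w' (rem Y' ds') by rewrite -eY -eY' eYY.
apply/canon_Node_perm/perm_map; rewrite (permPl (perm_to_rem Yds)) perm_sym.
by rewrite (permPl (perm_to_rem Yds')) -ers eYY.
Qed.

End Code.

(** * From a 3-leaf power to a weighted tree *)

Section Sgraph.

Variable V : finType.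
Implicit Types (G : sgraph V) (e : rel V).

Lemma adj_sym G : symmetric (adj G).
Proof. by move=> x y; rewrite /adj /= setUC. Qed.

Lemma adj_irr G : irreflexive (adj G).
Proof.
move=> x; apply/negP; rewrite /adj /= => xx.
by have := forallP (valP G) [set x; x]; rewrite xx /= setUid cards1.
Qed.

Lemma sgraph_of_subproof e : irreflexive e ->
  [forall s in [set [set p.1; p.2] | p : V * V & e p.1 p.2], #|s| == 2].
Proof.
move=> irr; apply/forallP => s; apply/implyP => /imsetP[[x y]]; rewrite inE /= => exy ->.
by rewrite cards2; case: (eqVneq x y) exy => [->|//]; rewrite irr.
Qed.

Definition sgraph_of e (irr : irreflexive e) : sgraph V :=
  exist (fun E : {set {set V}} => is_true [forall s in E, #|s| == 2]) _ (sgraph_of_subproof irr).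

Lemma adj_sgraph_of e (irr : irreflexive e) : symmetric e ->
  adj (sgraph_of irr) =2 e.
Proof.
move=> sym x y; rewrite /adj /=; apply/imsetP/idP => [[[u v]]|exy]; last first.
  by exists (x, y); rewrite ?inE.
rewrite inE /= => euv /setP E.
have nuv : u != v by apply: contraTneq euv => ->; rewrite irr.
have := E v; have := E u; rewrite !inE !eqxx orbT /=.
case/orP=> /eqP eu /orP[] /eqP ev; rewrite eu ev ?eqxx // in nuv euv *.
by rewrite sym.
Qed.

End Sgraph.

Lemma connect_closed (V : finType) (e : rel V) x y (P : pred V) : connect e x y -> P x ->
  (forall u v, P u -> e u v -> P v) -> P y.
Proof.
move=> /connectP[p + ->] Px cl.
by elim: p x Px => //= z p IH x Px /andP[/(cl _ _ Px) Pz /IH]; apply.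
Qed.

Section Distance.

Variables (W : finType) (T : sgraph W).
Hypothesis connT : connected_graph T.

(** Connectedness rules out that [dist] takes its default value [#|W|] for lack of a walk. *)
Lemma dist_leP x y k : reflect
  (exists2 p, path (adj T) x p && (last x p == y) & size p <= k) (dist T x y <= k).
Proof.
rewrite /dist; set a := (X in find X); apply: (iffP idP) => [le_k|[p hp sp]].
  have [has_a|] := boolP (has a (iota 0 #|W|)).
    have := nth_find 0 has_a; rewrite nth_iota; last by move: has_a; rewrite has_find size_iota.
    rewrite add0n => /existsP[p hp]; exists p => //.
    by rewrite size_tuple.
  have /forallP/(_ x)/forallP/(_ y)/connectP[p pp ey] := (andP connT).2.
  move: ey; have [q pq uq _] := shortenP pp => ey'.
  have sq : size q < #|W| by rewrite -ltnS -[(size q).+1]/(size (x :: q)) -(card_uniqP uq) ltnS max_card.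
  move=> /hasPn/(_ (size q)); rewrite mem_iota /= add0n => /(_ sq)/existsP[].
  by exists (in_tuple q); rewrite /= pq -ey' eqxx.
(* A walk of length at least [#|W|] is outside the range of the search, but [find] never exceeds the
   length of its list. *)
have [sW|sW] := ltnP (size p) #|W|; last first.
  by apply: leq_trans (find_size _ _) _; rewrite size_iota; apply: leq_trans sp.
apply: leq_trans sp; rewrite leqNgt; apply/negP => lt_p.
have := before_find 0 lt_p; rewrite nth_iota // add0n => /negbT/existsP[].
 by exists (in_tuple p).
Qed.

(** A walk between two leaves begins and ends with their pendant edges, so length 3 leaves room for
    at most one edge in between. [a != y] excludes that the two leaves are joined to each other. *)
Lemma dist3_leaves x y a b : x != y ->
  (forall z, adj T x z = (z == a)) -> (forall z, adj T y z = (z == b)) ->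
  a != y -> (dist T x y <= 3) = (a == b) || adj T a b.
Proof.
move=> nxy hx hy nay; apply/dist_leP/idP => [[[|u [|v [|w [|? ?]]]] //=]|].
- by rewrite (negPf nxy).
- by rewrite hx andbT => /andP[/eqP-> /eqP eay]; rewrite eay eqxx in nay.
- by rewrite hx andbT => /andP[/andP[/eqP-> hv] /eqP ev] _; move: hv; rewrite ev adj_sym hy => ->.
- rewrite hx andbT => /andP[/and3P[/eqP-> hv hw] /eqP ew] _; move: hw; rewrite ew adj_sym hy => /eqP <-.
  by rewrite hv orbT.
case/orP=> [/eqP eab|hab].
  by exists [:: a; y] => //=; rewrite hx eqxx adj_sym hy eab !eqxx.
by exists [:: a; b; y] => //=; rewrite hx hab adj_sym hy !eqxx.
Qed.

End Distance.

Section RepOfTree.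

Variables (W V : finType) (T : sgraph W) (e : rel V) (f : V -> W).
Hypothesis acycT : acyclic_graph T.
Hypothesis eE : forall x y, x != y -> e x y = (f x == f y) || adj T (f x) (f y).
Implicit Types (S P : {set W}).

Definition closure_connected a S :=
  forall P, a \in P -> {in P & S, forall x y, adj T x y -> y \in P} -> S \subset P.

(** Here [f] sends a graph vertex to the neighbour of its leaf, so the blow-up of [S] replaces a
    node by the leaves attached to it. The induction cuts off the component [B] of a neighbour [b]
    in [S] without [a]; acyclicity makes the edge from [a] to [b] the only one between the two
    parts. *)
Lemma rep_of_tree S a : a \in S -> S \subset codom f -> closure_connected a S ->
  exists X, rep e (f @^-1: S) (f @^-1: [set a]) X.
Proof.
elim/ltn_ind: {S}#|S| {-2}S (erefl #|S|) a => m IH S cardS a aS Sf connS.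
have [b|noN] := pickP [pred b | (b \in S) && adj T a b]; last first.
  have -> : S = [set a].
    apply/eqP; rewrite eqEsubset sub1set aS andbT; apply: connS; rewrite ?set11 //.
    by move=> x y /set1P-> yS axy; have := noN y; rewrite /= yS axy.
  exists (Node #|f @^-1: [set a]| [::]); apply: rep_one => //.
    have /codomP[v ev] := subsetP Sf _ aS; apply/set0Pn; exists v.
    by rewrite !inE ev.
  by move=> x y; rewrite !inE => /eqP fx /eqP fy nxy; rewrite eE // fx fy eqxx.
case/andP=> bS ab.
have nab : a != b by apply: contraTneq ab => ->; rewrite adj_irr.
pose e' := [rel x y | [&& x \in S :\ a, y \in S :\ a & adj T x y]].
pose B := [set y in S :\ a | connect e' b y]; pose A := S :\: B.
have bSa : b \in S :\ a by rewrite !inE eq_sym nab.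
have bB : b \in B by rewrite inE bSa connect0.
have aB : a \notin B by rewrite !inE eqxx.
have aA : a \in A by rewrite inE aB.
have BS : B \subset S by apply/subsetP => x; rewrite !inE => /andP[/andP[]].
have eAB : A :|: B = S by rewrite /A setUC -[in RHS](setID S B) (setIidPr BS).
have clB x y : x \in B -> y \in S :\ a -> adj T x y -> y \in B.
  rewrite [x \in B]inE [y \in B]inE => /andP[xS cx] yS xy; rewrite yS /=.
  by apply: connect_trans cx _; apply: connect1; rewrite /= xS yS.
have uniqb y : y \in B -> adj T a y -> y = b.
  rewrite inE => /andP[ySa /connectP[p pp ey]] ay; apply: contraTeq ay => nyb.
  move: ey; have [q pq uq _] := shortenP pp => ey.
  (* A simple path from [b] to [y] inside [S :\ a], closed up through [a], would be a cycle. *)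
  apply/negP => ay.
  have pT : path (adj T) b q by apply: sub_path pq => u v /= /and3P[].
  have qS : {subset b :: q <= S :\ a}.
    elim: q (b) bSa pq {uq pT ey} => [|v q IHq] u uS /=; first by move=> _ z; rewrite inE => /eqP->.
    move=> /andP[/and3P[_ vS _] /(IHq _ vS) H] z; rewrite inE => /predU1P[->//|]; exact: H.
  have aq : a \notin b :: q by apply/negP => /qS; rewrite !inE eqxx.
  have cyc : ucycle (adj T) (a :: b :: q).
    rewrite /ucycle cons_uniq aq uq andbT.
    have -> : cycle (adj T) (a :: b :: q) = path (adj T) a (b :: rcons q a) by [].
    have -> : path (adj T) a (b :: rcons q a) = adj T a b && path (adj T) b (rcons q a) by [].
    by rewrite ab rcons_path pT -ey adj_sym ay.
  by move: (acycT cyc); case: (q) ey => //= eyb; rewrite eyb eqxx in nyb.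
have crossAB : {in A & B, forall x y, adj T x y = (x == a) && (y == b)}.
  move=> x y; rewrite inE => /andP[xB xS] yB; apply/idP/andP => [xy|[/eqP-> /eqP->]//].
  have xa : x == a.
    by apply: contraNT xB => xa; apply: (clB y); rewrite 1?adj_sym // inE xS !inE xa.
  by split=> //; apply/eqP/uniqb; rewrite // -(eqP xa).
have cardA : #|A| < m by rewrite -cardS; apply: proper_card; rewrite properE subsetDl; apply/subsetPn; exists b; rewrite // inE bB.
have cardB : #|B| < m by rewrite -cardS; apply: proper_card; rewrite properE BS; apply/subsetPn; exists a.
have [||X rA] := IH _ cardA A erefl a aA.
- exact: subset_trans (subsetDl _ _) Sf.
- move=> P aP clP; have : S \subset P :|: B.
    apply: connS => [|x y]; first by rewrite inE aP.
    rewrite [y \in _ :|: _]inE => xPB yS xy; have [//|yB] := boolP (y \in B); rewrite ?orbT // orbF.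
    have yA : y \in A by rewrite inE yB.
    move: xPB; rewrite inE => /orP[xP|xB]; first exact: (clP x).
    by move: xy; rewrite adj_sym crossAB // => /andP[/eqP->].
  move=> /subsetP SPB; apply/subsetP => x /[dup]; rewrite {1}inE => /andP[xB /SPB].
  by rewrite inE (negPf xB) orbF.
have [||Y rB] := IH _ cardB B erefl b bB.
- exact: subset_trans BS Sf.
- move=> P bP clP; apply/subsetP => y; rewrite inE => /andP[_ cy].
  suff: (y \in P) && (y \in B) by case/andP.
  apply: (connect_closed (P := fun y => (y \in P) && (y \in B)) cy); first by rewrite bP.
  move=> u v /andP[uP uB] /and3P[_ vS uv].
  have vB : v \in B by apply: clB uB vS uv.
  by rewrite vB andbT; apply: (clP u).
have [_ _ _ [cs eX]] := rep_root rA; rewrite eX in rA.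
exists (Node #|f @^-1: [set a]| (Y :: cs)); apply: rep_join rA rB _ _ _.
- by rewrite -setI_eq0 -preimsetI; apply/eqP/setP => x; rewrite !inE; case: (_ && connect _ _ _); rewrite ?andbF.
- move=> x y; rewrite [x \in _]inE [y \in _]inE => xA yB.
  have nf : f x != f y by apply: contraTneq yB => <-; move: xA; rewrite inE => /andP[].
  have nxy : x != y by apply: contraNneq nf => ->.
  by rewrite eE // (negPf nf) crossAB // !inE.
- by rewrite -preimsetU eAB.
Qed.

End RepOfTree.

Lemma rep_of_complete (V : finType) (e : rel V) : 0 < #|V| ->
  (forall x y, x != y -> e x y) -> rep e setT setT (Node #|V| [::]).
Proof.
move=> V0 ce; apply: rep_one; rewrite ?cardsT //; last by move=> x y _ _; apply: ce.
by rewrite -card_gt0 cardsT.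
Qed.

Lemma rep_of_leaf_power (V : finType) (G : sgraph V) :
  connected_graph G -> leaf_power 3 G -> exists K X, rep (adj G) setT K X.
Proof.
move=> cG lG; have [V0 _] := andP cG.
(* With at most two vertices the tree may be a single edge, where leaves are adjacent to leaves;
   such connected graphs are complete and are treated directly. *)
have [V2|V3] := leqP #|V| 2.
  exists setT, (Node #|V| [::]); apply: rep_of_complete => // x y nxy.
  have eVxy z : z = x \/ z = y.
    suff: z \in [set x; y] by rewrite !inE => /orP[] /eqP; [left|right].
    apply: contraT => zxy.
    have := subset_leq_card (subsetT (z |: [set x; y])).
    by rewrite cardsU1 zxy cards2 nxy cardsT; move: V2; case: #|V| => [|[|[|]]].
  have /andP[_ /forallP/(_ x)/forallP/(_ y)/connectP[[|z p] /=]] := cG.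
    by move=> _ exy; rewrite exy eqxx in nxy.
  case/andP=> xz _ _; case: (eVxy z) => [ezx|<-//].
  by rewrite ezx adj_irr in xz.
case: lG => [V1|[W [T [leaf [[cT aT] inj_leaf degT distT]]]]]; first by rewrite V1 in V3.
have par_ex v : exists w, forall z, adj T (leaf v) z = (z == w).
  have : degree T (leaf v) == 1 by rewrite degT codom_f.
  by rewrite /degree => /card1P[w hw]; exists w => z; apply: hw.
have [p hp] := choice par_ex.
(* Two adjacent leaves form a component, hence the whole tree, which would then have only two
   leaves. *)
have noadj v u : p v != leaf u.
  apply/negP => /eqP epv.
  have epu : p u = leaf v.
    by apply/esym/eqP; rewrite -hp adj_sym hp epv.
  have all2 w : w \in [set leaf v; leaf u].
    have /andP[_ /forallP/(_ (leaf v))/forallP/(_ w) cw] := cT.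
    apply: (connect_closed (P := fun w => w \in [set leaf v; leaf u]) cw); first by rewrite !inE eqxx.
    move=> x y; rewrite !inE => /orP[] /eqP->; rewrite hp => /eqP->.
      by rewrite epv eqxx orbT.
    by rewrite epu eqxx.
  have : #|codom leaf| <= #|[set leaf v; leaf u]|.
    by apply/subset_leq_card/subsetP => w _; apply: all2.
  by rewrite card_codom // cards2; move: V3; case: #|V| => [|[|[|]]] // n _; case: (_ != _).
have eE x y : x != y -> adj G x y = (p x == p y) || adj T (p x) (p y).
  by move=> nxy; rewrite distT //; apply: dist3_leaves => //; rewrite (inj_eq inj_leaf).
have [v0] : exists v0 : V, true by case/card_gt0P: V0 => v0; exists v0.
(* The nodes that carry leaves span a subtree: it is connected because [G] is, a step in [G] moving
   the neighbour of the leaf along at most one tree edge. *)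
move=> _; have [|||X rX] := @rep_of_tree _ _ T (adj G) p aT eE [set w in codom p] (p v0).
- by rewrite inE codom_f.
- by apply/subsetP => w; rewrite inE.
- move=> P pP clP; apply/subsetP => w; rewrite inE => /codomP[v ->].
  have /andP[_ /forallP/(_ v0)/forallP/(_ v) cv] := cG.
  apply: (connect_closed (P := fun v => p v \in P) cv) => // x y xP xy.
  have nxy : x != y by apply: contraTneq xy => ->; rewrite adj_irr.
  move: xy; rewrite eE // => /orP[/eqP<-//|].
  by apply: clP => //; rewrite inE codom_f.
exists (p @^-1: [set p v0]), X.
suff <- : p @^-1: [set w in codom p] = setT by [].
by apply/setP => v; rewrite !inE codom_f.
Qed.

(** * Leaf roots of blown-up trees *)

Section ParentTree.

Variables (W : finType) (root : W) (par : W -> W) (lev : W -> nat).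
Hypothesis lev_par : forall x, x != root -> lev (par x) < lev x.

Definition parent_rel : rel W :=
  [rel x y | (x != root) && (par x == y) || (y != root) && (par y == x)].

Lemma parent_rel_irr : irreflexive parent_rel.
Proof.
move=> x; rewrite /parent_rel /= orbb; apply/negP => /andP[/lev_par + /eqP ex].
by rewrite ex ltnn.
Qed.

Lemma parent_rel_sym : symmetric parent_rel.
Proof. by move=> x y; rewrite /parent_rel /= orbC. Qed.

Definition parent_tree : sgraph W := sgraph_of parent_rel_irr.

Lemma adj_parent_tree x y : adj parent_tree x y = parent_rel x y.
Proof. exact: adj_sgraph_of parent_rel_sym _ _. Qed.

(* A vertex of maximal level on a cycle would have two distinct parents. *)
Lemma parent_tree_is_tree : is_tree parent_tree.
Proof.
have toroot x : connect (adj parent_tree) x root.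
  elim/ltn_ind: {x}(lev x) {-2}x (erefl (lev x)) => m IH x lx.
  have [->|nx] := eqVneq x root; first exact: connect0.
  apply: connect_trans (IH _ _ (par x) erefl); last by rewrite -lx lev_par.
  by apply: connect1; rewrite adj_parent_tree /parent_rel /= nx eqxx.
split.
  apply/andP; split; first by apply/card_gt0P; exists root.
  apply/forallP => x; apply/forallP => y; apply: connect_trans (toroot x) _.
  have cs : connect_sym (adj parent_tree) by apply: sym_connect_sym; apply: adj_sym.
  by rewrite cs.
move=> c /andP[cyc uc]; rewrite ltnNge; apply/negP => sc.
have [x0 x0c] : exists x, x \in c by case: (c) sc => // x s _; exists x; apply: mem_head.
have [x xc maxx] := @arg_maxnP _ x0 (mem c) lev x0c.
have step y : y \in c -> adj parent_tree x y -> par x = y.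
  move=> yc; rewrite adj_parent_tree /parent_rel /= => /orP[/andP[_ /eqP//]|/andP[ny /eqP ey]].
  by have := maxx _ yc; have := lev_par ny; rewrite ey /=; lia.
have [i s def_c] := rot_to xc.
have step' y : y \in rot i c -> adj parent_tree x y -> par x = y.
  by rewrite mem_rot; apply: step.
move: cyc uc sc step'; rewrite -(rot_cycle i) -(rot_uniq i) -(size_rot i) def_c.
case: s {def_c} => [|y [|z s]] // + /and3P[_ yzs _] _ step'.
have -> : cycle (adj parent_tree) [:: x, y, z & s] =
    [&& adj parent_tree x y, adj parent_tree y z &
        path (adj parent_tree) z (rcons s x)] by [].
rewrite rcons_path => /and4P[xy _ _ lx].
have lzs := mem_last z s.
have ey : par x = y by apply: step' xy; rewrite !inE eqxx orbT.
have el : par x = last z s.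
  by apply: step'; rewrite 1?adj_sym // 2!inE lzs !orbT.
by move: yzs; rewrite -ey el lzs.
Qed.

End ParentTree.

Section LeafRoot.

Variables (V : finType) (e : rel V).
Hypotheses (sym_e : symmetric e) (irr_e : irreflexive e).

(* f picks a representative in each clique of the blow-up, par is the parent function on
   representatives, and lev bounds the depth from above. *)
Lemma rep_parent S K X : rep e S K X ->
  exists (f par : V -> V) (lev : V -> nat) (k0 : V),
  [/\ k0 \in S /\ f k0 = k0,
      {in S, forall x, f x \in S /\ f (f x) = f x},
      {in S, forall x, (f x == k0) = (x \in K)},
      {in S, forall x, f x != k0 -> [/\ par (f x) \in S, f (par (f x)) = par (f x) &
                                       lev (par (f x)) < lev (f x)]} &
      {in S &, forall x y, x != y -> e x y = (f x == f y) ||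
         ((f x != k0) && (par (f x) == f y) || (f y != k0) && (par (f y) == f x))}].
Proof.
elim=> {S K X} [K n /set0Pn[k kK] cK _|A B S K L w cs X rA
  [fA [pA [lA [kA [[kAA fkA] fAS fAK pAS eA]]]]] rB
  [fB [pB [lB [kB [[kBB fkB] fBS fBL pBS eB]]]]] dAB cross ->].
  exists (fun=> k), id, (fun=> 0), k; split=> //.
  - by move=> x xK; rewrite eqxx xK.
  - by move=> x _; rewrite eqxx.
  - by move=> x y xK yK nxy; rewrite eqxx; apply: cK.
have BA x : x \in B -> (x \in A) = false by move=> xB; rewrite (disjointFl dAB).
have nAB x y : x \in A -> y \in B -> (x == y) = false.
  by move=> xA yB; apply: contraTF yB => /eqP <-; rewrite (disjointFr dAB).
have nBA x y : x \in B -> y \in A -> (x == y) = false.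
  by move=> xB yA; rewrite eq_sym nAB.
pose f x := if x \in A then fA x else fB x.
pose par x := if x \in A then pA x else if x == kB then kA else pB x.
(* Levels in [B] are lifted above that of [kA], below which [kB] is hung. *)
pose lev x := if x \in A then lA x else (lA kA).+1 + lB x.
have f_A : {in A, f =1 fA} by move=> x xA; rewrite /f xA.
have f_B : {in B, f =1 fB} by move=> x xB; rewrite /f BA.
have [KA _ _ _] := rep_root rA; have [LB _ _ _] := rep_root rB.
exists f, par, lev, kA; split.
- by rewrite inE kAA f_A.
- move=> x; rewrite inE => /orP[xA|xB].
    by have [h1 h2] := fAS _ xA; rewrite (f_A _ xA) inE h1 f_A.
  by have [h1 h2] := fBS _ xB; rewrite (f_B _ xB) inE h1 orbT f_B.
- move=> x; rewrite inE => /orP[xA|xB]; first by rewrite f_A // fAK.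
  have [h1 _] := fBS _ xB.
  rewrite f_B // eq_sym (nAB _ _ kAA h1); apply/esym/negbTE/negP => /(subsetP KA).
  by rewrite BA.
- move=> x; rewrite inE => /orP[xA|xB].
    have [h1 h2] := fAS _ xA; rewrite (f_A _ xA) => nk.
    have [h3 h4 h5] := pAS _ xA nk.
    by rewrite /par /lev h1 inE h3 f_A.
  have [h1 h2] := fBS _ xB; rewrite (f_B _ xB) /par /lev (BA _ h1) => _.
  have [ek|nk] := eqVneq (fB x) kB; first by rewrite inE kAA f_A //; split=> //; lia.
  have [h3 h4 h5] := pBS _ xB nk.
  by rewrite inE h3 orbT f_B // BA //; split=> //; lia.
have crossE x y : x \in A -> y \in B -> e x y = (f x == f y) ||
    ((f x != kA) && (par (f x) == f y) || (f y != kA) && (par (f y) == f x)).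
  move=> xA yB; have [h1 h2] := fAS _ xA; have [h3 h4] := fBS _ yB.
  rewrite f_A // f_B // cross // -fAK // -fBL // (nAB _ _ h1 h3) /par h1 (BA _ h3) /=.
  have -> : (fA x != kA) && (pA (fA x) == fB y) = false.
    case: eqVneq => //= nk; have [h5 _ _] := pAS _ xA nk; exact: nAB.
  rewrite (nBA _ _ h3 kAA) /=.
  have [ek|nk] := eqVneq (fB y) kB; first by rewrite andbT eq_sym.
  by have [h5 _ _] := pBS _ yB nk; rewrite andbF nBA.
move=> x y; rewrite !inE => /orP[xA|xB] /orP[yA|yB] nxy.
- have [h1 h2] := fAS _ xA; have [h3 h4] := fAS _ yA.
  by rewrite !f_A // /par h1 h3 eA.
- exact: crossE.
- rewrite sym_e crossE // [in RHS]eq_sym; congr orb; exact: orbC.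
- have [h1 h2] := fBS _ xB; have [h3 h4] := fBS _ yB.
  rewrite !f_B // /par !BA // eB // (nBA _ _ h1 kAA) (nBA _ _ h3 kAA) /=.
  congr orb; congr orb.
    by case: (eqVneq (fB x) kB) => //= _; rewrite nAB.
  by case: (eqVneq (fB y) kB) => //= _; rewrite nAB.
Qed.

Lemma leaf_power_of_rep (G : sgraph V) K X : adj G =2 e -> rep e setT K X ->
  connected_graph G /\ leaf_power 3 G.
Proof.
move=> adjE rT; split.
  have [_ /set0Pn[k kK] _ _] := rep_root rT.
  apply/andP; split; first by apply/card_gt0P; exists k.
  apply/forallP => x; apply/forallP => y.
  suff /subsetP/(_ y) : setT \subset [set y | connect (adj G) x y] by rewrite !inE => ->.
  apply: (rep_closure sym_e rT (in_setT x)); first by rewrite inE connect0.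
  move=> u v; rewrite !inE => xu _ uv; apply: connect_trans xu _; apply: connect1.
  by rewrite adjE.
have [V1|V2] := leqP #|V| 1.
  left; apply/eqP; rewrite eqn_leq V1 /=; have [_ /set0Pn[k _] _ _] := rep_root rT.
  by apply/card_gt0P; exists k.
right.
have [f [par [lev [k0 [[_ fk0] fS fK parS eE]]]]] := rep_parent rT.
pose R := {x : V | f x == x}.
have fR x : f (f x) == f x by have [_ ->] := fS x (in_setT x).
pose r x : R := exist (fun x => f x == x) (f x) (fR x).
(* The graph vertices serve as leaves, and each clique gets one inner node to which its vertices are
   attached. A lone vertex has been set aside, since its inner node would be a second leaf. *)
pose W : finType := (V + R)%type.
pose pW (x : W) : W := match x with inl v => inr (r v) | inr w => inr (r (par (val w))) end.
pose levW (x : W) := match x with inl v => (lev (f v)).+1 | inr w => lev (val w) end.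
pose rootW : W := inr (r k0).
have fval (w : R) : f (val w) = val w by apply/eqP/(valP w).
have lev_pW x : x != rootW -> levW (pW x) < levW x.
  case: x => [v|w] /= nr; first exact: ltnSn.
  have nk : f (val w) != k0.
    apply: contra nr => /eqP ek; apply/eqP; congr inr; apply: val_inj => /=.
    by rewrite fk0 -ek fval.
  have := parS (val w) (in_setT _) nk; rewrite fval => -[_ -> //].
pose T := parent_tree lev_pW.
exists W, T, inl.
have adjl v z : adj T (inl v) z = (z == inr (r v)).
  rewrite adj_parent_tree /parent_rel /= [_ == z]eq_sym.
  by case: z => [u|w] //=; rewrite ?andbF ?orbF.
have treeT : is_tree T by apply: parent_tree_is_tree.
have [connT _] := treeT.
split=> //.
- by move=> x y [].
- case=> [v|w].
    rewrite codom_f /degree; apply/eqP/esym; rewrite -[LHS](card1 (inr (r v) : W)).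
    by apply: eq_card => z; exact: esym (adjl v z).
  have -> : (inr w : W) \in codom inl = false by apply/negP => /codomP[].
  (* An inner node of degree 1 would see nothing but a leaf of its own clique; the tree would be one
     edge and [V] a single vertex. *)
  apply/negP => /card1P[z hz0].
  have hz b : adj T (inr w) b = (b == z) := hz0 b.
  have wl : adj T (inl (val w)) (inr w).
    by rewrite adjl; apply/eqP; congr inr; apply: val_inj; rewrite /= fval.
  have ez : z = inl (val w).
    by apply/esym/eqP; rewrite -hz adj_sym.
  have all2 u : (u == inr w) || (u == inl (val w)).
    have /andP[_ /forallP/(_ (inr w))/forallP/(_ u) cu] := connT.
    apply: (connect_closed (P := fun u => (u == inr w) || (u == inl (val w))) cu).
      by rewrite eqxx.
    move=> a b /orP[] /eqP ->.
      by rewrite hz ez => /eqP->; rewrite eqxx orbT.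
    rewrite adjl => /eqP ->; apply/orP; left; apply/eqP; congr inr.
    by apply: val_inj; rewrite /= fval.
  have : #|V| <= #|[set val w]|.
    by rewrite -cardsT; apply/subset_leq_card/subsetP => v _; have := all2 (inl v); rewrite inE.
  by rewrite cards1 leqNgt V2.
move=> x y nxy; rewrite (dist3_leaves connT (a := inr (r x)) (b := inr (r y))) //.
rewrite adjE eE ?in_setT // adj_parent_tree /parent_rel.
have eqr u v : ((inr u : W) == inr v) = (val u == val v) by [].
have h u v : ((inr (r u) : W) != rootW) && (pW (inr (r u)) == inr (r v)) =
   (f u != k0) && (par (f u) == f v).
  rewrite !eqr /= fk0; case: (eqVneq (f u) k0) => //= nk.
  by have [_ -> _] := parS u (in_setT _) nk.
by congr orb; congr orb; rewrite -h.
Qed.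

End LeafRoot.

(** * Counting isomorphism classes by centroid codes *)

(** A choice of one code per element turns [R] into the kernel of a map onto [Cs]. Keeping [code] a
    relation confines the choice to this place. *)
Lemma card_equivalence_classes (T : finType) (C : eqType) (D : {set T}) (R : rel T)
    (Cs : seq C) (code : T -> C -> Prop) :
  uniq Cs -> {in D & &, equivalence_rel R} ->
  {in D, forall G, exists2 X, X \in Cs & code G X} ->
  {in D &, forall G H, R G H -> forall X, code G X -> code H X} ->
  {in D &, forall G H X, code G X -> code H X -> R G H} ->
  {in D, forall G, {in Cs &, forall X Y, code G X -> code G Y -> X = Y}} ->
  {in Cs, forall X, exists2 G, G \in D & code G X} ->
  #|equivalence_partition R D| = size Cs.
Proof.
move=> uCs eqR ex inv inj uni real.
have [c hc] : exists c : T -> option C, {in D, forall G, exists2 X, X \in Cs & code G X /\ c G = Some X}.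
  have H G : exists o : option C, G \in D -> exists2 X, X \in Cs & code G X /\ o = Some X.
    have [/ex[X XC cX]|nG] := boolP (G \in D); last by exists None.
    by exists (Some X) => _; exists X.
  by have [c hc] := choice H; exists c => G GD; apply: hc.
have Rc : {in D &, forall G H, R G H = (c G == c H)}.
  move=> G H GD HD; have [X XC [cX eX]] := hc _ GD; have [Y YC [cY eY]] := hc _ HD.
  rewrite eX eY; apply/idP/eqP => [RGH|[eXY]].
    by congr Some; apply: (uni H) => //; apply: inv RGH _ cX.
  by apply: (inj G H GD HD X) => //; rewrite eXY.
have -> : equivalence_partition R D = preim_partition c D.
  rewrite /preim_partition /equivalence_partition; apply: eq_in_imset => G GD.
  by apply/setP => H; rewrite !inE; case: (boolP (H \in D)) => //= HD; rewrite Rc.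
have cG G : G \in D -> exists2 X, X \in Cs & c G = Some X.
  by move=> /hc[X XC [_ eX]]; exists X.
pose g (B : {set T}) := if [pick G in B] is Some G then c G else None.
have gE G : G \in D -> g [set H in D | c G == c H] = c G.
  move=> GD; rewrite /g; case: pickP => [H|/(_ G)]; rewrite !inE; last by rewrite GD eqxx.
  by case/andP=> _ /eqP.
have inj_g : {in preim_partition c D &, injective g}.
  by move=> _ _ /imsetP[G GD ->] /imsetP[H HD ->]; rewrite !gE // => ->.
rewrite cardE -(size_map g) -(size_map Some Cs); apply: perm_size.
apply: uniq_perm.
- by rewrite map_inj_in_uniq ?enum_uniq // => A B; rewrite !mem_enum; apply: inj_g.
- by rewrite map_inj_uniq // => x y [].
move=> o; apply/mapP/mapP => [[B]|[X XC ->]].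
  rewrite mem_enum => /imsetP[G GD ->] ->; rewrite gE //.
  by have [X XC eX] := cG _ GD; exists X.
have [G GD cGX] := real _ XC.
exists [set H in D | c G == c H]; first by rewrite mem_enum; apply: imset_f.
rewrite gE //; have [Y YC [cGY ->]] := hc _ GD.
by congr Some; apply: (uni G).
Qed.

Lemma graph_isoP (V : finType) (G H : sgraph V) :
  reflect (exists s : {perm V}, forall x y, adj H (s x) (s y) = adj G x y)
          (graph_iso G H).
Proof.
apply: (iffP existsP) => -[s hs]; exists s.
  by move=> x y; apply/eqP; move/forallP/(_ x)/forallP/(_ y): hs.
by apply/forallP => x; apply/forallP => y; rewrite hs.
Qed.

Lemma graph_iso_equivalence (V : finType) : equivalence_rel (@graph_iso V).
Proof.
have refl : reflexive (@graph_iso V).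
  by move=> G; apply/graph_isoP; exists 1%g => x y; rewrite !perm1.
have sym (G H : sgraph V) : graph_iso G H -> graph_iso H G.
  case/graph_isoP=> s hs; apply/graph_isoP; exists s^-1%g => x y.
  by rewrite -hs !permKV.
have trans (G H K : sgraph V) : graph_iso G H -> graph_iso H K -> graph_iso G K.
  case/graph_isoP=> s hs /graph_isoP[t ht]; apply/graph_isoP; exists (s * t)%g => x y.
  by rewrite !permM ht hs.
move=> G H K; split=> [|GH]; first exact: refl.
by apply/idP/idP; apply: trans; rewrite ?GH //; apply: sym.
Qed.

Theorem num_conn_3leaf_power_codes n (Cs : seq rtree) : uniq Cs ->
  (forall X, (X \in Cs) = centroid_code n X) ->
  num_conn_3leaf_power n = size Cs.
Proof.
move=> uCs CsE; rewrite /num_conn_3leaf_power.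
pose code (G : sgraph 'I_n) X := exists K, rep (adj G) setT K X.
have symG (G : sgraph 'I_n) := adj_sym G; have irrG (G : sgraph 'I_n) := adj_irr G.
apply: (@card_equivalence_classes _ _ _ _ _ code) => //.
- by move=> G H K _ _ _; apply: graph_iso_equivalence.
- move=> G; rewrite inE => /andP[cG /asboolP lG].
  have [K [X rX]] := rep_of_leaf_power cG lG.
  have [Y cY [K' rY]] := code_exists (symG G) rX.
  by exists Y; [rewrite CsE -[n]card_ord|exists K'].
- move=> G H _ _ /graph_isoP[s hs] X [K rX]; exists (s @: K).
  rewrite -(_ : s @: setT = setT); first exact: rep_transport (@perm_inj _ s) hs rX.
  by apply/setP => x; rewrite inE -[x](permKV s) imset_f.
- move=> G H _ _ X [K rK] [K' rK']; apply/graph_isoP.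
  have [f [injf _ _ mf]] := rep_iso (symG G) (symG H) (irrG G) (irrG H) rK rK'.
  have injf' : injective f by move=> x y; apply: injf.
  by exists (perm injf') => x y; rewrite !permE mf.
- move=> G _ X Y; rewrite !CsE -[n]card_ord => cX cY [K rX] [K' rY].
  have H := code_uniq (symG G) rX rY; exact: H cX cY.
- move=> X; rewrite CsE => /and5P[/canonical_rpos pX /eqP wX _ _ _].
  have [V [e [K [sym irr rX]]]] := rep_realize pX.
  have cV : #|V| = n by rewrite -wX (rep_wt rX) cardsT.
  have [f bij_f] : exists f : V -> 'I_n, bijective f.
    exists (fun x => cast_ord cV (enum_rank x)).
    apply: (Bijective (g := fun i => enum_val (cast_ord (esym cV) i))) => x.
      by rewrite cast_ordK enum_rankK.
    by rewrite enum_valK cast_ordKV.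
  have [g fK gK] := bij_f.
  pose e' (x y : 'I_n) := e (g x) (g y).
  have sym' : symmetric e' by move=> x y; apply: sym.
  have irr' : irreflexive e' by move=> x; apply: irr.
  have rX' : rep e' setT (f @: K) X.
    rewrite -(_ : f @: setT = setT).
      by apply: rep_transport rX; [apply: can_inj fK|move=> x y; rewrite /e' !fK].
    by apply/setP => x; rewrite inE -[x]gK imset_f.
  have adjE := adj_sgraph_of irr' sym'.
  have [cG lG] := leaf_power_of_rep sym' adjE rX'.
  exists (sgraph_of irr'); first by rewrite inE cG; apply/asboolP.
  exists (f @: K); have <- // : e' = adj (sgraph_of irr').
  by apply/funext => x; apply/funext => y; rewrite adjE.
Qed.

(** * Enumerating canonical trees and forests *)

Definition fwt (s : seq rtree) : nat := sumn (map wt s).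

Definition forest_of (n : nat) (s : seq rtree) : bool :=
  [&& sorted rtree_le s, all rcanonical s & fwt s == n].

Lemma rcanonical_wt_gt0 X : rcanonical X -> 0 < wt X.
Proof. by move/canonical_rpos/wt_gt0. Qed.

Lemma wt_Node w s : wt (Node w s) = w + fwt s. Proof. by []. Qed.

Lemma forest_of_cons n x s : forest_of n (x :: s) ->
  [/\ rcanonical x, 0 < wt x <= n & forest_of (n - wt x) s].
Proof.
case/and3P=> so /= /andP[cx cs] /eqP <-; rewrite /fwt /= rcanonical_wt_gt0 // leq_addr.
by split=> //; rewrite /forest_of (path_sorted so) cs addKn eqxx.
Qed.

(** The first tree of a nonempty forest has a root of positive weight, so both the forest of its
    children and the remaining trees have smaller total weight. *)
Lemma forests_ex n : exists L : seq (seq rtree),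
  uniq L /\ forall s, (s \in L) = forest_of n s.
Proof.
elim/ltn_ind: n => n IH.
have {IH} [F hF] : exists F : nat -> seq (seq rtree),
    forall k, k < n -> forall s, (s \in F k) = forest_of k s.
  have H k : exists L : seq (seq rtree), k < n -> forall s, (s \in L) = forest_of k s.
    have [/IH[L [_ hL]]|_] := ltnP k n; last by exists [::].
    by exists L => _.
  by have [F hF] := choice H; exists F.
pose Tr k := [seq Node (k - j) s | j <- iota 0 k, s <- F j].
pose L := [::] :: [seq x :: s | x <- flatten [seq Tr k | k <- iota 1 n], s <- F (n - wt x)].
(* The candidates in [L] only have to cover all forests; filtering removes those that are not
   sorted. *)
exists (undup [seq s <- L | forest_of n s]); split; first exact: undup_uniq.
move=> s; rewrite mem_undup mem_filter andb_idr // => fs.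
case: s fs => [|x s] fs; first exact: mem_head.
have [cx /andP[x0 xn] fs'] := forest_of_cons fs.
rewrite inE /=; apply/allpairsPdep; exists x, s; split=> //; last by rewrite hF //; lia.
apply/flatten_mapP; exists (wt x); first by rewrite mem_iota; lia.
case: x cx x0 xn {fs fs'} => w t; rewrite rcanonicalE => /and3P[w0 st ct] x0 xn.
rewrite wt_Node in x0 xn *.
apply/allpairsPdep; exists (fwt t), t; split; first by rewrite mem_iota; lia.
  by rewrite hF; [rewrite /forest_of st ct eqxx|lia].
by congr Node; lia.
Qed.

Definition forests n := projT1 (cid (forests_ex n)).

Lemma uniq_forests n : uniq (forests n).
Proof. by rewrite /forests; case: cid => L []. Qed.

Lemma mem_forests n s : (s \in forests n) = forest_of n s.
Proof. by rewrite /forests; case: cid => L []. Qed.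

Definition trees n := [seq Node (n - k) s | k <- iota 0 n, s <- forests k].

Lemma mem_trees n X : (X \in trees n) = rcanonical X && (wt X == n).
Proof.
case: X => w t; rewrite rcanonicalE wt_Node; apply/allpairsPdep/idP.
  case=> k [s []]; rewrite mem_iota mem_forests /= => kn /and3P[ss cs /eqP fs] [-> ->].
  by rewrite ss cs /= fs; lia.
case/andP=> /and3P[w0 st ct] /eqP wn.
exists (fwt t), t; split; first by rewrite mem_iota; lia.
  by rewrite mem_forests /forest_of st ct eqxx.
by congr Node; lia.
Qed.

Lemma uniq_trees n : uniq (trees n).
Proof.
apply: allpairs_uniq_dep; first exact: iota_uniq.
  by move=> k _; apply: uniq_forests.
move=> _ _ /allpairsPdep[k [s [kn sk ->]]] /allpairsPdep[l [t [ln tl ->]]] /= [_ est].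
move: sk tl; rewrite est !mem_forests => /and3P[_ _ /eqP <-] /and3P[_ _ /eqP <-].
by [].
Qed.

Definition nforest n := size (forests n).
Definition ntree n := size (trees n).

Lemma ntreeE n : ntree n = \sum_(k < n) nforest k.
Proof.
rewrite /ntree size_allpairs_dep sumnE big_map -(big_mkord xpredT (fun k => nforest k)).
by rewrite /index_iota subn0.
Qed.

Lemma ntree0 : ntree 0 = 0. Proof. by rewrite ntreeE big_ord0. Qed.

Lemma nforest0 : nforest 0 = 1.
Proof.
rewrite /nforest; suff -> : size (forests 0) = size [:: ([::] : seq rtree)] by [].
apply: perm_size; apply: uniq_perm => // [|s]; first exact: uniq_forests.
rewrite mem_forests inE; case: s => [|x s] //=.
by apply/negP => /forest_of_cons[_ + _]; lia.
Qed.

Lemma fwt_perm s t : perm_eq s t -> fwt s = fwt t.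
Proof. by move=> p; apply/perm_sumn/perm_map. Qed.

Lemma forest_of_sort n s : forest_of n (sort rtree_le s) = all rcanonical s && (fwt s == n).
Proof.
by rewrite /forest_of sort_sorted // all_sort (fwt_perm (permEl (perm_sort _ _))).
Qed.

Lemma sorted_perm_eq s t : sorted rtree_le s -> sorted rtree_le t -> perm_eq s t -> s = t.
Proof. exact: sorted_eq. Qed.

Lemma fwt_cat s t : fwt (s ++ t) = fwt s + fwt t.
Proof. by rewrite /fwt map_cat sumn_cat. Qed.

Lemma fwt_nseq i x : fwt (nseq i x) = i * wt x.
Proof. by rewrite /fwt map_nseq sumn_nseq mulnC. Qed.

(** Removing [i] copies of [x] is a bijection onto the forests of the remaining weight; adding them
    back and sorting is its inverse. *)
Lemma count_forests n i x : rcanonical x ->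
  count (fun s => i <= count_mem x s) (forests n) =
  if i * wt x <= n then nforest (n - i * wt x) else 0.
Proof.
move=> cx; case: leqP => [le_n|lt_n]; last first.
  apply/eqP; rewrite -leqn0 leqNgt -has_count; apply/hasPn => s.
  rewrite mem_forests => /and3P[_ _ /eqP fs]; rewrite -ltnNge ltnNge; apply/negP => ci.
  have := permEl (perm_filterC (pred1 x) s) => /fwt_perm.
  rewrite fwt_cat fs (_ : filter _ _ = nseq (count_mem x s) x) ?fwt_nseq; last first.
    rewrite -size_filter; apply/all_pred1P; exact: filter_all.
  have := leq_mul ci (leqnn (wt x)); lia.
rewrite /nforest -size_filter -(size_map (fun s => sort rtree_le (nseq i x ++ s)) (forests _)).
apply: perm_size; apply: uniq_perm.
- exact/filter_uniq/uniq_forests.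
- rewrite map_inj_in_uniq ?uniq_forests // => s t; rewrite !mem_forests.
  move=> /and3P[ss _ _] /and3P[st _ _] /perm_sortP; rewrite perm_cat2l => p.
  exact: sorted_perm_eq (p _ _ _).
move=> s; rewrite mem_filter; apply/andP/mapP => [[ci]|[t]]; rewrite !mem_forests.
  move=> /and3P[ss cs /eqP fs].
  pose t := sort rtree_le (nseq (count_mem x s - i) x ++ filter (predC1 x) s).
  have p : perm_eq s (nseq i x ++ t).
    rewrite perm_sym (permPl (perm_cat (perm_refl _) (permEl (perm_sort _ _)))).
    rewrite catA -nseqD subnKC // -(permPr (permEl (perm_filterC (pred1 x) s))).
    rewrite (_ : filter (pred1 x) s = nseq (count_mem x s) x) //.
    rewrite -size_filter; apply/all_pred1P; exact: filter_all.
  exists t; rewrite ?mem_forests; last first.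
    by apply: sorted_perm_eq; rewrite ?sort_sorted // perm_sym perm_sort perm_sym.
  have ft : fwt t = n - i * wt x by rewrite -fs (fwt_perm p) fwt_cat fwt_nseq addKn.
  rewrite /forest_of ft eqxx sort_sorted // andbT.
  by move: cs; rewrite (perm_all _ p) all_cat => /andP[].
move=> /and3P[st ct /eqP ft] ->; split.
  rewrite (seq.permP (permEl (perm_sort _ _))) count_cat count_nseq /= eqxx mul1n; lia.
rewrite forest_of_sort all_cat ct andbT fwt_cat fwt_nseq ft subnKC // eqxx andbT.
by apply/allP => y /nseqP[->].
Qed.

Lemma fwtE s : fwt s = \sum_(x <- s) wt x.
Proof. by rewrite /fwt sumnE big_map. Qed.

Lemma fwt_count (L s : seq rtree) : uniq L -> {subset s <= L} ->
  fwt s = \sum_(x <- L) wt x * count_mem x s.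
Proof.
move=> uL; elim: s => [|y s IH] sL /=.
  by rewrite big1 // => x _; rewrite muln0.
have -> : fwt (y :: s) = wt y + fwt s by [].
have /IH -> : {subset s <= L} by move=> x xs; apply: sL; rewrite inE xs orbT.
under [RHS]eq_bigr do rewrite mulnDr.
rewrite big_split /=; congr addn.
rewrite (bigD1_seq y) ?sL ?mem_head //= eqxx muln1 big1 ?addn0 // => x nxy.
by rewrite eq_sym (negPf nxy) muln0.
Qed.

Lemma sum_leq_nat c n : c <= n -> \sum_(1 <= i < n.+1) (i <= c) = c.
Proof.
move=> cn; rewrite (big_cat_nat _ (n := c.+1)) //= big_nat_cond (eq_bigr (fun=> 1)).
  rewrite -big_nat_cond sum_nat_const_nat subn1 muln1 /= big_nat_cond big1 ?addn0 // => i.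
  by rewrite andbT => /andP[+ _]; rewrite ltnNge => /negPf->.
by move=> i; rewrite andbT ltnS => /andP[_ ->].
Qed.

Lemma sum_multiples (F : nat -> nat) d n : 0 < d ->
  \sum_(1 <= i < n.+1) (if i * d <= n then F (i * d) else 0) =
  \sum_(1 <= j < n.+1 | d %| j) F j.
Proof.
move=> d0; rewrite -big_mkcond /= -[LHS]big_filter -[RHS]big_filter.
rewrite -(big_map (fun i => i * d) xpredT F); apply: perm_big; apply: uniq_perm.
- rewrite map_inj_in_uniq ?filter_uniq ?iota_uniq // => i j _ _ /eqP.
  by rewrite eqn_pmul2r // => /eqP.
- exact/filter_uniq/iota_uniq.
move=> j; rewrite mem_filter mem_index_iota; apply/mapP/andP => [[i]|].
  rewrite mem_filter mem_index_iota => /andP[idn /andP[i0 _]] ->.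
  by rewrite dvdn_mull // muln_gt0 i0 d0 ltnS.
case=> /dvdnP[i ->] /andP[id0 idn]; exists i => //.
rewrite mem_filter mem_index_iota -ltnS idn /=; move: id0; rewrite muln_gt0 => /andP[-> _].
by apply: leq_ltn_trans idn; rewrite leq_pmulr.
Qed.

(** The coefficients of z d/dz of sum_(k >= 1) r(z^k) / k, the exponent in the Euler transform that
    produces forests from trees. *)
Definition treepow j := \sum_(1 <= d < j.+1 | d %| j) d * ntree d.

Lemma big_trees (F : nat -> nat) d : \sum_(x <- trees d) F (wt x) = ntree d * F d.
Proof.
rewrite (eq_big_seq (fun=> F d)) => [|x]; first by rewrite big_const_seq count_predT iter_addn_0 mulnC.
by rewrite mem_trees => /andP[_ /eqP->].
Qed.

Lemma sum_nat_count (T : Type) (a : pred T) s : \sum_(x <- s) (a x : nat) = count a s.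
Proof. by rewrite -sum1_count [RHS]big_mkcond /=; apply: eq_bigr => x _; case: (a x). Qed.

(** The Euler transform in differentiated form. The total weight of all forests is the sum of [wt x]
    over trees [x] and over [i] up to the multiplicity of [x]; the forests with at least [i] copies
    of [x] number [nforest (n - i * wt x)], and the terms are collected by j = i * wt x. *)
Lemma mul_nforest n : n * nforest n =
  \sum_(1 <= j < n.+1) treepow j * nforest (n - j).
Proof.
pose L := flatten [seq trees d | d <- index_iota 1 n.+1].
have uL : uniq L.
  have : uniq (index_iota 1 n.+1) by apply: iota_uniq.
  rewrite /L; elim: (index_iota _ _) => //= d l IH /andP[dl ul].
  rewrite cat_uniq uniq_trees IH // andbT; apply/hasPn => x /flatten_mapP[k kl].
  rewrite !mem_trees => /andP[_ /eqP wx]; rewrite wx negb_and; apply/orP; right.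
  by apply: contraNneq dl => <-.
have mL s : s \in forests n -> {subset s <= L}.
  rewrite mem_forests => /and3P[_ cs /eqP fs] x xs; have cx := allP cs _ xs.
  have xn : wt x <= n.
    by rewrite -fs fwtE (big_rem x) //= leq_addr.
  apply/flatten_mapP; exists (wt x); rewrite ?mem_trees ?cx ?eqxx //.
  by rewrite mem_index_iota rcanonical_wt_gt0.
have cn s x : s \in forests n -> x \in s -> count_mem x s <= n.
  rewrite mem_forests => /and3P[_ cs /eqP fs] xs.
  rewrite -fs; apply: leq_trans (count_size _ _) _.
  rewrite fwtE -sum1_size; rewrite big_seq [leqRHS]big_seq; apply: leq_sum => y ys.
  exact/rcanonical_wt_gt0/(allP cs).
have -> : n * nforest n = \sum_(s <- forests n) fwt s.
  rewrite (eq_big_seq (fun=> n)) => [|s]; first by rewrite big_const_seq count_predT iter_addn_0.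
  by rewrite mem_forests => /and3P[_ _ /eqP].
have -> : \sum_(s <- forests n) fwt s =
    \sum_(s <- forests n) \sum_(x <- L) \sum_(1 <= i < n.+1) wt x * (i <= count_mem x s).
  apply: eq_big_seq => s sF; rewrite (fwt_count uL (mL _ sF)); apply: eq_bigr => x _.
  rewrite -big_distrr /= sum_leq_nat //.
  have [xs|/count_memPn-> //] := boolP (x \in s); exact: cn.
rewrite exchange_big /=; under eq_bigr do rewrite exchange_big /=.
have -> : \sum_(x <- L) \sum_(1 <= i < n.+1) \sum_(s <- forests n) wt x * (i <= count_mem x s) =
  \sum_(x <- L) \sum_(1 <= i < n.+1) (if i * wt x <= n then wt x * nforest (n - i * wt x) else 0).
  apply: eq_big_seq => x /flatten_mapP[d _]; rewrite mem_trees => /andP[cx _].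
  apply: eq_bigr => i _; rewrite -big_distrr /= sum_nat_count count_forests //.
  by case: ifP; rewrite ?muln0.
rewrite big_flatten /= big_map.
have -> : \sum_(1 <= j < n.+1) treepow j * nforest (n - j) =
   \sum_(1 <= d < n.+1) \sum_(1 <= j < n.+1 | d %| j) d * ntree d * nforest (n - j).
  rewrite [RHS](exchange_big_dep xpredT) //=; apply: eq_big_nat => j /andP[j0 jn].
  rewrite /treepow big_distrl /= [RHS](big_cat_nat _ (n := j.+1)) //=.
  rewrite [X in _ + X]big1_seq ?addn0 // => d /andP[dj]; rewrite mem_index_iota => /andP[jd _].
  by have := dvdn_leq j0 dj; lia.
apply: eq_big_nat => d /andP[d0 dn].
rewrite (big_trees (fun w => \sum_(1 <= i < n.+1) (if i * w <= n then w * nforest (n - i * w) else 0))).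
rewrite (sum_multiples (fun j => d * nforest (n - j))) // big_distrr /=.
by apply: eq_bigr => j _; rewrite mulnCA mulnA.
Qed.

(** * Counting codes by cutting off the heavy child *)

Definition attach (c Y : rtree) : rtree :=
  let: Node w cs := Y in Node w (sort rtree_le (c :: cs)).

Lemma wt_attach c Y : wt (attach c Y) = wt c + wt Y.
Proof.
case: Y => w cs; rewrite [attach _ _]/= !wt_Node (fwt_perm (permEl (perm_sort _ _))).
by rewrite /fwt /= addnCA.
Qed.

Lemma rcanonical_attach c Y : rcanonical c -> rcanonical Y -> rcanonical (attach c Y).
Proof.
case: Y => w cs; rewrite [attach _ _]/= !rcanonicalE => cc /and3P[-> sc ccs].
by rewrite sort_sorted // all_sort /= cc.
Qed.

Lemma perm_children_attach c w cs : perm_eq (children (attach c (Node w cs))) (c :: cs).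
Proof. by rewrite /= perm_sort. Qed.

Definition prune (c X : rtree) : rtree :=
  let: Node w cs := X in Node w (rem c cs).

Lemma prune_attach c Y : rcanonical Y -> prune c (attach c Y) = Y.
Proof.
case: Y => w cs cY; congr Node.
have /and3P[_ sc _] := cY; have p := perm_children_attach c w cs.
apply: sorted_perm_eq => //; first exact/sorted_rem/sort_sorted.
rewrite -(perm_cons c) -(permPr p) perm_sym perm_to_rem //.
by rewrite (perm_mem p) mem_head.
Qed.

Lemma attach_rem c w cs : rcanonical (Node w cs) -> c \in cs ->
  attach c (Node w (rem c cs)) = Node w cs.
Proof.
rewrite rcanonicalE => /and3P[_ sc _] ccs; rewrite /=; congr Node.
by apply: sorted_perm_eq; rewrite ?sort_sorted // perm_sort perm_sym perm_to_rem.
Qed.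

Lemma heavy_child n c w cs d : 0 < w -> wt (attach c (Node w cs)) = n ->
  n <= (wt c).*2 -> d \in cs -> (wt d).*2 < n.
Proof.
move=> w0; rewrite wt_attach => <- cn dcs.
by move: cn; rewrite (wt_rem w dcs) /=; lia.
Qed.

(** Two children of at least half the weight would leave nothing for the root, so the heavy child
    can be read off the tree. *)
Lemma attach_inj n c c' Y Y' : rcanonical Y -> rcanonical Y' ->
  wt (attach c Y) = n -> n <= (wt c).*2 -> n <= (wt c').*2 ->
  attach c Y = attach c' Y' -> c = c' /\ Y = Y'.
Proof.
case: Y Y' => [w cs] [w' cs'] cY cY' wn cn cn' eA.
have w0 : 0 < w by case/and3P: cY.
have p' := perm_children_attach c' w' cs'; have p := perm_children_attach c w cs.
have : c' \in children (attach c (Node w cs)) by rewrite eA (perm_mem p') mem_head.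
rewrite (perm_mem p) inE => /predU1P[ec|/(heavy_child w0 wn cn)]; last by lia.
split=> //; move: eA; rewrite ec => /(congr1 (prune c)).
by rewrite !prune_attach.
Qed.

Definition light n X := all (fun c => (wt c).*2 < n) (children X).

Definition half_code n X := centered n X &&
  all (fun c => ((wt c).*2 == n) ==> rtree_le (prune c X) c) (children X).

Lemma light_half_code n X : light n X -> half_code n X.
Proof.
case: X => w cs /allP lX; apply/andP; split; apply/allP => c ccs.
  exact: ltnW (lX _ ccs).
by have := lX _ ccs; rewrite ltn_neqAle => /andP[/negPf-> _].
Qed.

Lemma not_lightP n X : rcanonical X -> wt X = n -> ~~ light n X ->
  exists c Y, [/\ rcanonical c, rcanonical Y, X = attach c Y,
    wt c + wt Y = n & wt c < n <= (wt c).*2].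
Proof.
case: X => w cs cX wX /allPn[c ccs]; rewrite -leqNgt => cn.
have wY := wt_rem w ccs; have cY := canonical_rem c cX.
exists c, (Node w (rem c cs)); split=> //.
- exact: rcanonical_child ccs cX.
- by rewrite attach_rem.
- by rewrite -wY.
- by rewrite cn andbT -wX wY -[X in X < _]addn0 ltn_add2l rcanonical_wt_gt0.
Qed.

Lemma attach_not_light n c Y : n <= (wt c).*2 -> ~~ light n (attach c Y).
Proof.
case: Y => w cs cn; apply/allPn; exists c; last by rewrite -leqNgt.
by rewrite (perm_mem (perm_children_attach _ _ _)) mem_head.
Qed.

Lemma half_code_attach n c Y : rcanonical Y -> wt (attach c Y) = n -> n <= (wt c).*2 ->
  half_code n (attach c Y) = ((wt c).*2 == n) && rtree_le Y c.
Proof.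
case: Y => w cs cY wn cn; have w0 : 0 < w by case/and3P: cY.
have p := perm_children_attach c w cs.
have lt_d := heavy_child w0 wn cn.
rewrite /half_code /centered !(perm_all _ p) /= -[Node w (rem _ _)]/(prune c (attach c (Node w cs))).
rewrite prune_attach //.
have -> : all (fun d => (wt d).*2 <= n) cs by apply/allP => d /lt_d/ltnW.
rewrite [all _ _](_ : _ = true) ?andbT.
  by rewrite eqn_leq cn andbT; case: leqP.
by apply/allP => d /lt_d; rewrite ltn_neqAle => /andP[/negPf-> _].
Qed.

Definition codes n := [seq X <- trees n | centroid_code n X].

Lemma uniq_codes n : uniq (codes n). Proof. exact/filter_uniq/uniq_trees. Qed.

Lemma mem_codes n X : (X \in codes n) = centroid_code n X.
Proof.
rewrite mem_filter mem_trees andb_idr // => /and5P[-> -> //].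
Qed.

Lemma uniq_flatten_trees (s : seq nat) : uniq s -> uniq (flatten [seq trees d | d <- s]).
Proof.
elim: s => //= d l IH /andP[dl ul].
rewrite cat_uniq uniq_trees IH // andbT; apply/hasPn => x /flatten_mapP[k kl].
rewrite !mem_trees => /andP[_ /eqP wx]; rewrite wx negb_and; apply/orP; right.
by apply: contraNneq dl => <-.
Qed.

Lemma count_attach n (T1 : seq rtree) (T2 : rtree -> seq rtree) (a : pred rtree) :
  uniq T1 -> (forall c, uniq (T2 c)) ->
  (forall c Y, c \in T1 -> Y \in T2 c ->
     [&& rcanonical c, rcanonical Y, wt c + wt Y == n & n <= (wt c).*2]) ->
  (forall c Y, rcanonical c -> rcanonical Y -> wt c + wt Y = n -> wt c < n <= (wt c).*2 ->
     a (attach c Y) = (c \in T1) && (Y \in T2 c)) ->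
  count (fun X => a X && ~~ light n X) (trees n) = \sum_(c <- T1) size (T2 c).
Proof.
move=> uT1 uT2 hT ha.
have -> : \sum_(c <- T1) size (T2 c) = size [seq attach c Y | c <- T1, Y <- T2 c].
  by rewrite size_allpairs_dep sumnE big_map.
rewrite -size_filter; apply: perm_size; apply: uniq_perm.
- exact/filter_uniq/uniq_trees.
- apply: allpairs_uniq_dep; [by []|by move=> c _; exact: uT2|].
  move=> _ _ /allpairsPdep[c [Y [cT YT ->]]] /allpairsPdep[c' [Y' [cT' YT' ->]]] /= eA.
  have /and4P[cc cY /eqP wn cn] := hT _ _ cT YT.
  have /and4P[cc' cY' _ cn'] := hT _ _ cT' YT'.
  have [|-> -> //] := attach_inj cY cY' _ cn cn' eA.
  by rewrite wt_attach.
move=> X; rewrite mem_filter mem_trees; apply/idP/allpairsPdep.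
  case/andP=> /andP[aX nl] /andP[cX /eqP wX].
  have [c [Y [cc cY eX wn cn]]] := not_lightP cX wX nl.
  by move: aX; rewrite eX (ha c Y) // => /andP[cT YT]; exists c, Y.
case=> c [Y [cT YT ->]]; have /and4P[cc cY /eqP wn cn] := hT _ _ cT YT.
have lt_n : wt c < n by rewrite -wn -[X in X < _]addn0 ltn_add2l rcanonical_wt_gt0.
by rewrite ha ?lt_n // cT YT attach_not_light // rcanonical_attach // wt_attach wn eqxx.
Qed.

Lemma count_heavy n : count (fun X => ~~ light n X) (trees n) =
  \sum_(0 <= k < n | n <= k.*2) ntree k * ntree (n - k).
Proof.
pose T1 := flatten [seq trees k | k <- [seq k <- index_iota 0 n | n <= k.*2]].
have inT1 c : (c \in T1) = rcanonical c && (wt c < n <= (wt c).*2).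
  apply/flatten_mapP/idP => [[k]|/and3P[cc wn nw]].
    by rewrite mem_filter mem_index_iota mem_trees => /andP[nk /= kn] /andP[-> /eqP->]; rewrite kn.
  by exists (wt c); rewrite ?mem_trees ?cc ?eqxx // mem_filter mem_index_iota nw wn.
rewrite (@count_attach n T1 (fun c => trees (n - wt c)) xpredT).
- rewrite big_flatten /= big_map big_filter; apply: eq_bigr => k _.
  exact: (big_trees (fun w => ntree (n - w))).
- by apply: uniq_flatten_trees; apply/filter_uniq/iota_uniq.
- by move=> c; apply: uniq_trees.
- move=> c Y; rewrite inT1 mem_trees => /and3P[-> wn ->] /andP[-> /eqP ->].
  by rewrite subnKC ?eqxx // ltnW.
- move=> c Y cc cY wn cn; rewrite inT1 cc cn mem_trees cY -wn addKn eqxx //.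
Qed.

(** Adding the same count with the order reversed covers each pair once and the diagonal twice. *)
Lemma count_ordered_pairs (s : seq rtree) : uniq s ->
  (\sum_(c <- s) count (rtree_le^~ c) s).*2 = size s * size s + size s.
Proof.
move=> us; rewrite -addnn.
have E : \sum_(c <- s) count (rtree_le^~ c) s = \sum_(c <- s) \sum_(Y <- s) rtree_le Y c.
  by apply: eq_bigr => c _; rewrite sum_nat_count.
rewrite E {2}exchange_big /= -big_split /=.
rewrite (eq_big_seq (fun=> size s + 1)) => [|c cs].
  by rewrite big_const_seq count_predT iter_addn_0 mulnC mulnDr muln1.
rewrite -big_split /= (eq_bigr (fun Y => 1 + (Y == c))) => [|Y _].
  by rewrite big_split /= sum1_size sum_nat_count (count_uniq_mem _ us) cs.
have := rtree_le_total Y c; case: eqVneq => [->|nYc]; first by rewrite rtree_le_refl.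
case: (boolP (rtree_le Y c)) => h1; case: (boolP (rtree_le c Y)) => h2 //=.
by case/eqP: nYc; apply: rtree_le_anti; rewrite /= h1 h2.
Qed.

(** Among trees with a heavy child, only those whose child has exactly half the weight qualify. They
    are unordered pairs of trees of weight n / 2, the order deciding which one is the child. *)
Lemma count_half_code n : 0 < n ->
  (count (fun X => half_code n X && ~~ light n X) (trees n)).*2 =
  if odd n then 0 else ntree n./2 * ntree n./2 + ntree n./2.
Proof.
move=> n0; case: ifP => on.
  rewrite (@count_attach n [::] (fun=> [::]) (half_code n)) ?big_nil //.
  move=> c Y cc cY wn /andP[_ nc]; rewrite half_code_attach ?wt_attach //.
  by case: eqP on => // <-; rewrite odd_double.
have en : n = (n./2).*2 by have := odd_double_half n; rewrite on.
set h := n./2 in en *.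
rewrite (@count_attach n (trees h) (fun c => [seq Y <- trees h | rtree_le Y c]) (half_code n)).
- under eq_bigr do rewrite size_filter; exact/count_ordered_pairs/uniq_trees.
- exact: uniq_trees.
- by move=> c; apply/filter_uniq/uniq_trees.
- move=> c Y; rewrite mem_filter !mem_trees => /andP[-> /eqP->] /and3P[_ -> /eqP->].
  by rewrite addnn -en leqnn eqxx.
- move=> c Y cc cY wn /andP[_ nc]; rewrite half_code_attach ?wt_attach //.
  rewrite mem_filter !mem_trees cc cY /= en (inj_eq double_inj).
  have [ec|//] := eqVneq (wt c) h; have -> : wt Y == h by apply/eqP; lia.
  by rewrite andbT.
Qed.

(** A child of weight v with 1 <= v and 2 v <= n determines the tree; for 2 v = n the two halves
    coincide, so the order condition holds. *)
Lemma count_two_nodes n :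
  count (fun X => half_code n X && (nnodes X == 2)) (trees n) = n./2.
Proof.
rewrite -[RHS](size_iota 1) -(size_map (fun v => Node (n - v) [:: Node v [::]])) -size_filter.
apply: perm_size; apply: uniq_perm.
- exact/filter_uniq/uniq_trees.
- by rewrite map_inj_uniq ?iota_uniq // => v v' [].
move=> X; rewrite mem_filter mem_trees; apply/idP/mapP.
  case/andP=> /andP[hX /eqP/nnodes_eq2[w [v eX]]]; move: hX; rewrite eX /half_code /centered /=.
  rewrite !addn0 !andbT => /andP[vn _] /andP[/andP[w0 v0] /eqP wn].
  exists v; last by rewrite -wn addnK.
  by rewrite mem_iota; lia.
case=> v; rewrite mem_iota => vn ->; rewrite /half_code /centered /= !addn0 !eqxx !andbT.
have -> : (n - v + v == n) by apply/eqP; lia.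
have -> : v.*2 <= n by lia.
have -> : 0 < n - v by lia.
have -> : 0 < v by lia.
rewrite /= andbT; apply/implyP => /eqP en; have -> : n - v = v by lia.
exact: rtree_le_refl.
Qed.

Lemma count_split (T : Type) (a b : pred T) s :
  count a s = count (fun x => a x && b x) s + count (fun x => a x && ~~ b x) s.
Proof. by elim: s => //= x s ->; case: (a x); case: (b x) => //=; lia. Qed.

(** Codes are half codes minus two-node trees; half codes are all trees, minus those with a heavy
    child, plus the ties counted by [count_half_code]. Everything is doubled and written additively
    to stay within natural numbers. *)
Lemma size_codes n : 0 < n ->
  (size (codes n)).*2 + (n./2).*2 +
    (\sum_(0 <= k < n | n <= k.*2) ntree k * ntree (n - k)).*2 =
  (ntree n).*2 + if odd n then 0 else ntree n./2 * ntree n./2 + ntree n./2.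
Proof.
move=> n0; rewrite -count_heavy -count_half_code // -(count_two_nodes n) /codes size_filter.
have -> : count (centroid_code n) (trees n) =
    count (fun X => half_code n X && ~~ (nnodes X == 2)) (trees n).
  apply: eq_in_count => X; rewrite mem_trees => /andP[cX wX].
  rewrite /centroid_code cX wX /half_code; case: (X) => w cs /=.
  exact: andbC.
have e1 := count_split (half_code n) (fun X => nnodes X == 2) (trees n).
have e2 := count_split (half_code n) (light n) (trees n).
have e3 := count_predC (light n) (trees n).
have e4 : count (fun X => half_code n X && light n X) (trees n) = count (light n) (trees n).
  by apply: eq_count => X; rewrite /= andb_idl //; apply: light_half_code.
rewrite e4 in e2; rewrite -/(ntree n) in e3; rewrite /predC /= in e3.
move: e1 e2 e3; move: (count _ _) (count _ _) (count _ _) (count _ _) (count _ _) (count _ _).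
lia.
Qed.

(** Reflecting k to n - k completes the convolution, the middle term being met twice; [F 0 = 0]
    removes the term k = n. *)
Lemma sum_heavy (F : nat -> nat) n : F 0 = 0 ->
  (\sum_(0 <= k < n | n <= k.*2) F k * F (n - k)).*2 =
  \sum_(k < n.+1) F k * F (n - k) + if odd n then 0 else F n./2 * F n./2.
Proof.
move=> F0.
have -> : \sum_(0 <= k < n | n <= k.*2) F k * F (n - k) =
    \sum_(k < n.+1 | n <= k.*2) F k * F (n - k).
  rewrite big_mkord [RHS]big_mkcond big_ord_recr /= subnn F0 muln0 if_same addn0.
  by rewrite -big_mkcond.
have flip : \sum_(k < n.+1 | k.*2 <= n) F k * F (n - k) =
    \sum_(k < n.+1 | n <= k.*2) F k * F (n - k).
  rewrite (reindex_inj rev_ord_inj) /=; apply: eq_big => k.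
    by have := ltn_ord k; rewrite subSS; lia.
  have kn : k <= n by rewrite -ltnS ltn_ord.
  by move=> _; rewrite subSS (subKn kn) [LHS]mulnC.
rewrite -addnn -{1}flip.
rewrite !(big_mkcond (fun k : 'I_n.+1 => _ <= _)) -big_split /=.
have -> : (if odd n then 0 else F n./2 * F n./2) =
    \sum_(k < n.+1) (if k == n./2 :> nat then (if odd n then 0 else F k * F (n - k)) else 0).
  have h : n./2 < n.+1 by lia.
  rewrite (bigD1 (Ordinal h)) //= eqxx big1 ?addn0 => [|k nk].
    case: ifP => // on; congr (_ * F _); have := odd_double_half n; rewrite on; lia.
  by rewrite -[_ == _]/(k == Ordinal h) (negPf nk).
rewrite -big_split /=; apply: eq_bigr => k _.
have := odd_double_half n; case: (odd n) => /= e.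
  rewrite if_same addn0; move: (F k * F (n - k)) => p.
  by case: (leqP k.*2 n) => h1; case: (leqP n k.*2) => h2; move: e h1 h2; clear; lia.
move: (F k * F (n - k)) => p; case: eqP => nk;
  case: (leqP k.*2 n) => h1; case: (leqP n k.*2) => h2; move: e nk h1 h2; clear; lia.
Qed.

Theorem num_conn_3leaf_power_ntree n : 0 < n ->
  (num_conn_3leaf_power n).*2 + (n./2).*2 + \sum_(k < n.+1) ntree k * ntree (n - k) =
  (ntree n).*2 + if odd n then 0 else ntree n./2.
Proof.
move=> n0; rewrite (num_conn_3leaf_power_codes (uniq_codes n) (mem_codes n)).
have := size_codes n0; rewrite (sum_heavy n ntree0).
by case: (odd n); lia.
Qed.

From mathcomp Require Import ring lra.

Import Order.TTheory GRing.Theory Num.Theory.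

Local Open Scope ring_scope.

(** * Formal power series, represented by their coefficient sequences *)

Section Conv.

Variable R : comNzRingType.
Implicit Types f g h F G : nat -> R.

Definition cprod f g (n : nat) : R := \sum_(i < n.+1) f i * g (n - i)%N.

Definition theta f (n : nat) : R := n%:R * f n.

Definition one_seq (n : nat) : R := (n == 0%N)%:R.

Fixpoint cpow f k : nat -> R :=
  if k is k'.+1 then cprod f (cpow f k') else one_seq.

(** Formal composition of F with f. If f has no constant term, f^k starts in degree k, so the sum
    may stop at k = n. *)
Definition compo F f (n : nat) : R := \sum_(k < n.+1) F k * cpow f k n.

Lemma eq_cprod f g f' g' : f =1 f' -> g =1 g' -> cprod f g =1 cprod f' g'.
Proof. by move=> ef eg n; apply: eq_bigr => i _; rewrite ef eg. Qed.

(** Ring identities for Cauchy products are inherited from polynomials by truncation. *)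
Lemma cprod_poly f g N n : (n < N)%N ->
  cprod f g n = (\poly_(i < N) f i * \poly_(i < N) g i)`_n.
Proof.
move=> nN; rewrite coefM; apply: eq_bigr => i _; rewrite !coef_poly.
by rewrite (leq_ltn_trans _ nN) ?(leq_ltn_trans _ nN) ?leq_subr // -ltnS.
Qed.

Lemma cprodC f g : cprod f g =1 cprod g f.
Proof. by move=> n; rewrite !(cprod_poly _ _ (ltnSn n)) mulrC. Qed.

Lemma cprodA f g h : cprod f (cprod g h) =1 cprod (cprod f g) h.
Proof.
move=> n; rewrite /cprod.
transitivity ((\poly_(i < n.+1) f i * (\poly_(i < n.+1) g i * \poly_(i < n.+1) h i))`_n).
  rewrite coefM; apply: eq_bigr => i _; rewrite coef_poly ltn_ord; congr (_ * _).
  by apply: cprod_poly; rewrite ltnS leq_subr.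
rewrite mulrA coefM; apply: eq_bigr => i _; rewrite [in X in _ * X]coef_poly ltnS leq_subr.
by congr (_ * _); apply/esym/cprod_poly.
Qed.

Lemma cprod1r f : cprod f one_seq =1 f.
Proof.
move=> n; rewrite /cprod big_ord_recr /= subnn mulr1 big1 ?add0r // => i _.
by rewrite /one_seq subn_eq0 leqNgt ltn_ord mulr0.
Qed.

Lemma cprod1l f : cprod one_seq f =1 f.
Proof. by move=> n; rewrite cprodC cprod1r. Qed.

Lemma cprodDl f g h n : cprod (fun i => f i + g i) h n = cprod f h n + cprod g h n.
Proof. by rewrite /cprod -big_split; apply: eq_bigr => i _; rewrite mulrDl. Qed.

Lemma cprodDr f g h n : cprod h (fun i => f i + g i) n = cprod h f n + cprod h g n.
Proof. by rewrite /cprod -big_split; apply: eq_bigr => i _; rewrite mulrDr. Qed.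

Lemma cprodZr (a : R) f h n : cprod h (fun i => a * f i) n = a * cprod h f n.
Proof. by rewrite /cprod big_distrr; apply: eq_bigr => i _; rewrite mulrCA. Qed.

Lemma theta_cprod f g n : theta (cprod f g) n = cprod (theta f) g n + cprod f (theta g) n.
Proof.
rewrite /theta /cprod big_distrr -big_split; apply: eq_bigr => i _ /=.
have {1}-> : n = (i + (n - i))%N by rewrite subnKC // -ltnS.
by rewrite natrD; ring.
Qed.

Lemma cpow_theta f k n :
  theta (cpow f k.+1) n = k.+1%:R * cprod (cpow f k) (theta f) n.
Proof.
elim: k n => [|k IH] n.
  rewrite theta_cprod mul1r cprodC -[RHS]addr0; congr (_ + _).
  by rewrite /cprod big1 // => i _; rewrite /theta /one_seq; case: (_ - _)%N => [|m]; rewrite ?mul0r ?mulr0 // mulr0.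
rewrite [LHS]theta_cprod (eq_cprod (frefl f) IH) cprodZr cprodC cprodA.
by rewrite -[cprod f (cpow f k)]/(cpow f k.+1) -[k.+2]addn1 natrD addrC; ring.
Qed.

Lemma cpow_small f k n : f 0%N = 0 -> (n < k)%N -> cpow f k n = 0.
Proof.
move=> f0; elim: k n => // k IH n nk /=; rewrite /cprod big1 // => -[[|i] /= lt_i] _.
  by rewrite f0 mul0r.
by rewrite IH ?mulr0 //; lia.
Qed.

Lemma cpowD f i j : cprod (cpow f i) (cpow f j) =1 cpow f (i + j).
Proof.
elim: i => [|i IH] n /=; first exact: cprod1l.
by rewrite -cprodA; apply: eq_cprod.
Qed.

Lemma compoE F f N n : f 0%N = 0 -> (n < N)%N ->
  compo F f n = \sum_(k < N) F k * cpow f k n.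
Proof.
move=> f0 nN; rewrite /compo (big_ord_widen N (fun k => F k * cpow f k n)) //.
rewrite big_mkcond; apply: eq_bigr => k _; case: ifP => //.
by rewrite ltnS => /negbT; rewrite -ltnNge => nk; rewrite cpow_small ?mulr0.
Qed.

Lemma sum_triangle (H : nat -> nat -> R) N :
  (forall i j, (N <= i + j)%N -> H i j = 0) ->
  \sum_(i < N) \sum_(j < N) H i j = \sum_(k < N) \sum_(i < k.+1) H i (k - i)%N.
Proof.
move=> H0.
have -> : \sum_(k < N) \sum_(i < k.+1) H i (k - i)%N =
    \sum_(k < N) \sum_(i < N | (i <= k)%N) H i (k - i)%N.
  by apply: eq_bigr => k _; rewrite (big_ord_widen N (fun i => H i (k - i)%N)).
rewrite [RHS](exchange_big_dep xpredT) //=; apply: eq_bigr => i _.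
rewrite -(big_mkord xpredT (H i)) -(big_mkord (fun k => i <= k)%N (fun k => H i (k - i)%N)).
rewrite (big_cat_nat _ (n := (N - i)%N)) ?leq_subr //= [X in _ + X]big_nat_cond [X in _ + X]big1 ?addr0; last first.
  by move=> j; rewrite andbT => /andP[ij _]; apply: H0; lia.
rewrite [RHS](big_cat_nat _ (n := i)) ?(ltnW (ltn_ord i)) //= [X in _ = X + _]big_nat_cond.
rewrite [X in _ = X + _]big1 ?add0r; last by move=> k /andP[/andP[_ ki]]; lia.
have -> : \sum_(i <= k < N | (i <= k)%N) H i (k - i)%N =
    \sum_(0 + i <= k < N | (i <= k)%N) H i (k - i)%N by [].
by rewrite big_addn; apply: eq_big => [j|j _]; rewrite ?addnK ?leq_addl.
Qed.

Lemma compo_cprod F G f : f 0%N = 0 -> compo (cprod F G) f =1 cprod (compo F f) (compo G f).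
Proof.
move=> f0 n; rewrite /compo.
transitivity (\sum_(i < n.+1) \sum_(j < n.+1) F i * G j * cpow f (i + j) n).
  rewrite (sum_triangle (H := fun i j => F i * G j * cpow f (i + j) n)); last first.
    by move=> i j nij; rewrite cpow_small ?mulr0.
  apply: eq_bigr => k _; rewrite /cprod big_distrl; apply: eq_bigr => i _ /=.
  by rewrite subnKC // -ltnS.
rewrite /cprod; under [RHS]eq_bigr => l _.
  rewrite -!/(compo _ _ _) (compoE F (N := n.+1)) // (compoE G (N := n.+1)) ?ltnS ?leq_subr //.
  rewrite big_distrlr; over.
rewrite [RHS]exchange_big; apply: eq_bigr => i _; rewrite [RHS]exchange_big; apply: eq_bigr => j _ /=.
by rewrite -cpowD /cprod big_distrr; apply: eq_bigr => l _ /=; ring.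
Qed.

Lemma cprod_compo G f h N n : f 0%N = 0 -> (n < N)%N ->
  cprod (compo G f) h n = \sum_(k < N) G k * cprod (cpow f k) h n.
Proof.
move=> f0 nN; rewrite /cprod.
under eq_bigr => l _.
  rewrite (compoE G (N := N)) //; last by rewrite (leq_ltn_trans _ nN) // -ltnS.
  rewrite big_distrl; over.
rewrite exchange_big; apply: eq_bigr => k _ /=.
by rewrite big_distrr; apply: eq_bigr => l _ /=; rewrite mulrA.
Qed.

Lemma theta_compo F f : f 0%N = 0 ->
  theta (compo F f) =1 cprod (compo (fun k => k.+1%:R * F k.+1) f) (theta f).
Proof.
move=> f0 n; rewrite /theta (compoE F (N := n.+2)) // big_ord_recl mulrDr big_distrr /=.
rewrite (cprod_compo _ _ f0 (ltnSn n)) (_ : n%:R * _ = 0) ?add0r.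
  apply: eq_bigr => k _; rewrite /bump /= add1n mulrCA -[n%:R * _]/(theta (cpow f k.+1) n).
  by rewrite cpow_theta; ring.
by case: n => [|n]; rewrite ?mul0r // mulr0 mulr0.
Qed.

(** If [p] is the logarithmic derivative of [f], then theta (f^k) = k f^k p, so the operator passes
    through the composition. *)
Lemma theta_compo_log F f p : f 0%N = 0 -> theta f =1 cprod f p ->
  theta (compo F f) =1 cprod (compo (theta F) f) p.
Proof.
move=> f0 fp n; rewrite /theta (compoE F (N := n.+1)) // (cprod_compo _ _ f0 (ltnSn n)).
rewrite big_distrr /=; apply: eq_bigr => -[[|k] lt_k] _ /=.
  by rewrite mul0r mul0r; case: (n) => [|m]; rewrite ?mul0r // mulr0 mulr0.
rewrite mulrCA -[n%:R * _]/(theta (cpow f k.+1) n) cpow_theta.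
rewrite (eq_cprod (frefl _) fp) cprodA; rewrite (eq_cprod (cprodC _ _) (frefl p)) /=; ring.
Qed.

(** In degree n + 2 the top coefficient occurs on the right once, with factor p_0 = 1, so n + 1
    times this coefficient is expressed by lower ones. In degree 1 the equation is void, hence the
    separate condition there. *)
Lemma theta_log_uniq f g p : f 0%N = g 0%N -> f 0%N = 0 -> f 1%N = g 1%N -> p 0%N = 1 ->
  (forall n, GRing.lreg (n.+1%:R : R)) ->
  theta f =1 (fun n => cprod f p n + cprod f (theta f) n) ->
  theta g =1 (fun n => cprod g p n + cprod g (theta g) n) -> f =1 g.
Proof.
move=> fg0 f0 fg1 p0 reg hf hg n.
elim/ltn_ind: n => -[_//|[_//|n]] IH.
pose lower (h : nat -> R) := \sum_(i < n.+2) h i * p (n.+2 - i)%N +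
  \sum_(i < n.+1) h i.+1 * theta h (n.+1 - i)%N.
have E h : h 0%N = 0 -> theta h =1 (fun n => cprod h p n + cprod h (theta h) n) ->
    n.+1%:R * h n.+2 = lower h.
  move=> h0 /(_ n.+2).
  have -> : cprod h p n.+2 = \sum_(i < n.+2) h i * p (n.+2 - i)%N + h n.+2.
    by rewrite /cprod big_ord_recr /= subnn p0 mulr1.
  have -> : cprod h (theta h) n.+2 = \sum_(i < n.+1) h i.+1 * theta h (n.+1 - i)%N.
    rewrite /cprod big_ord_recr /= subnn [theta h 0]/theta mul0r mulr0 addr0.
    rewrite big_ord_recl h0 mul0r add0r; apply: eq_bigr => i _.
    by rewrite lift0 subSS.
  rewrite {1}/theta /lower => H; apply: (addIr (h n.+2)); rewrite addrAC -H -[n.+2]addn1 natrD; ring.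
apply: (reg n); rewrite !E -?fg0 // /lower; congr (_ + _).
  by apply: eq_bigr => i _; rewrite IH.
by apply: eq_bigr => i _; rewrite /theta !IH //; have := ltn_ord i; lia.
Qed.

End Conv.

(** * Abel's identity and the Cayley tree series *)

Section Abel.

Variable R : numFieldType.

(** An n-th difference of a power of degree m < n: apply (X d/dX)^m to (X - 1)^n and set X = 1. Each
    application of [D] costs only one factor X - 1. *)
Lemma alternating_power_sum (n m : nat) : (m < n)%N ->
  \sum_(i < n.+1) 'C(n, i)%:R * (-1) ^+ i * (n - i)%:R ^+ m = 0 :> R.
Proof.
move=> mn; pose D (p : {poly R}) := 'X * p^`().
have D_add p q : D (p + q) = D p + D q by rewrite /D derivD mulrDr.
have DZ a p : D (a *: p) = a *: D p by rewrite /D derivZ -scalerAr.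
have DX a j k : iter k D (a *: 'X^j) = (a * j%:R ^+ k) *: 'X^j.
  elim: k => [|k IH]; first by rewrite expr0 mulr1.
  rewrite iterS IH DZ /D derivXn mulrnAr; case: j {IH} => [|j].
    by rewrite mulr0n scaler0 [_ ^+ k.+1]exprS mul0r mulr0 scale0r.
  have -> : 'X * 'X^(j.+1.-1) = 'X^(j.+1) :> {poly R} by rewrite exprS.
  by rewrite -scaler_nat scalerA -mulrA -exprSr.
have Dsum k (F : nat -> {poly R}) N : iter k D (\sum_(i < N) F i) = \sum_(i < N) iter k D (F i).
  elim: k => // k IH; rewrite iterS IH; elim: N {IH} => [|N IH].
    by rewrite !big_ord0 /D linear0 mulr0.
  by rewrite !big_ord_recr /= D_add IH.
have Ddiv k (q : {poly R}) : exists q', D (('X - 1) ^+ k.+1 * q) = ('X - 1) ^+ k * q'.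
  exists ('X * (k.+1%:R * q + ('X - 1) * q^`())).
  rewrite /D derivM deriv_exp derivB derivX -[1]/(1%:P) derivC subr0 mul1r exprS -mulr_natl; ring.
have Diter k : (k < n)%N -> exists q, iter k D (('X - 1) ^+ n) = ('X - 1) ^+ (n - k) * q.
  elim: k => [|k IH] kn; first by exists 1; rewrite mulr1 subn0.
  have [q eq] := IH (ltnW kn); have [q' eq'] := Ddiv (n - k.+1)%N q.
  by exists q'; rewrite iterS eq -eq'; congr (D (_ ^+ _ * q)); lia.
have [q eq] := Diter _ mn.
have e0 : (iter m D (('X - 1) ^+ n)).[1] = 0.
  by rewrite eq hornerM horner_exp !hornerE subrr expr0n subn_eq0 leqNgt mn mul0r.
rewrite -[RHS]e0 exprBn.
rewrite (Dsum m (fun i => ((-1) ^+ i * 'X ^+ (n - i) * 1 ^+ i) *+ 'C(n, i))) horner_sum.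
apply: eq_bigr => i _; rewrite expr1n mulr1.
have -> : ((-1) ^+ i * 'X ^+ (n - i)) *+ 'C(n, i) = ('C(n, i)%:R * (-1) ^+ i) *: 'X^(n - i) :> {poly R}.
  by rewrite -scalerA scaler_nat; congr (_ *+ _); rewrite -mul_polyC rmorphXn rmorphN1.
by rewrite DX hornerZ hornerXn expr1n mulr1.
Qed.

Lemma eq_deriv_poly (p q : {poly R}) x : p^`() = q^`() -> p.[x] = q.[x] -> p = q.
Proof.
move=> dpq pq; apply/eqP; rewrite -subr_eq0; set r := p - q.
have dr : r^`() = 0 by rewrite /r derivB dpq subrr.
have rC : r = (r`_0)%:P.
  apply/polyP => -[|i]; rewrite coefC //=.
  have /eqP : r^`()`_i = 0 by rewrite dr coef0.
  by rewrite coef_deriv -mulr_natl mulf_eq0 pnatr_eq0 /= => /eqP.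
have : r.[x] = 0 by rewrite /r hornerD hornerN pq subrr.
by rewrite rC hornerC => ->.
Qed.

(** The number i^(i-1) of rooted labelled trees, with value 0 at i = 0 because the tree series has
    no constant term. *)
Definition cayley_num (i : nat) : R := if i is i'.+1 then i%:R ^+ i' else 0.

(** Abel's identity between polynomials, by induction on n: the derivative of each side is a
    multiple of the previous case translated by 1, so one evaluation point remains to be checked. *)
Lemma abel_poly n :
  \sum_(i < n.+1) ('C(n, i)%:R * cayley_num i) *: ('X + (n - i)%:R%:P) ^+ (n - i) =
  n%:R *: ('X + n%:R%:P) ^+ n.-1 :> {poly R}.
Proof.
elim: n => [|[|n] IH].
- by rewrite big_ord_recl big_ord0 mulr0 !scale0r addr0.
- by rewrite !big_ord_recl big_ord0 /= mulr0 scale0r add0r addr0 expr0 !mulr1 binn.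
set m := n.+1 in IH *.
(* At X = -n, with n = [m.+1], the i-th summand contains (-i)^(n-i), which merges with i^(i-1) to
   i^(n-1) up to sign; the sum is then an n-th difference. *)
apply: (@eq_deriv_poly _ _ (- m.+1%:R)).
  rewrite linear_sum /=.
  transitivity (m.+1%:R *: ((\sum_(i < m.+1) ('C(m, i)%:R * cayley_num i) *:
      ('X + (m - i)%:R%:P) ^+ (m - i)) \Po ('X + 1%:P)) : {poly R}).
    rewrite linear_sum big_ord_recr /= subnn expr0 derivZ derivC scaler0 addr0 scaler_sumr.
    apply: eq_bigr => i _; rewrite derivZ deriv_exp derivD derivX derivC addr0 mul1r.
    rewrite comp_polyZ rmorphXn /= comp_polyD comp_polyX comp_polyC -addrA -polyCD.
    have im : (i <= m)%N by rewrite -ltnS.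
    have -> : 1 + (m - i)%:R = (m - i).+1%:R :> R by rewrite -[in RHS]add1n natrD.
    rewrite subSn // -scaler_nat !scalerA; congr (_ *: _).
    have := mul_bin_down m.+1 i; rewrite subSn // => /(congr1 (fun k => k%:R : R)).
    by rewrite !natrM => E; rewrite mulrA E; ring.
  rewrite IH comp_polyZ rmorphXn /= comp_polyD comp_polyX comp_polyC -addrA -polyCD.
  rewrite derivZ deriv_exp derivD derivX derivC addr0 mul1r -scaler_nat scalerA.
  by rewrite -[1 + _](natrD _ 1) add1n.
rewrite [RHS]hornerZ horner_exp hornerD hornerX hornerC addNr expr0n mulr0 horner_sum.
rewrite -[RHS](@alternating_power_sum m.+1 m) // [RHS](reindex_inj rev_ord_inj) /=.
apply: eq_bigr => i _; rewrite subSS hornerZ horner_exp hornerD hornerX hornerC.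
have im : (i <= m.+1)%N by rewrite -ltnS.
have -> : - m.+1%:R + (m.+1 - i)%:R = - i%:R :> R by rewrite natrB //; ring.
rewrite subKn // bin_sub // -!mulrA; congr (_ * _); case: i im => -[|i] /= lt_i im.
  by rewrite mul0r expr0n mulr0.
rewrite [X in _ * X = _]exprNn mulrCA -exprD; congr (_ * _ ^+ _); lia.
Qed.

Lemma abel_sum n : (0 < n)%N ->
  \sum_(i < n.+1) 'C(n, i)%:R * cayley_num i * (n - i)%:R ^+ (n - i) = n%:R ^+ n.
Proof.
move=> n0; have /(congr1 (horner^~ 0)) /= := abel_poly n.
rewrite horner_sum hornerZ horner_exp hornerD hornerX hornerC add0r -exprS prednK // => <-.
by apply: eq_bigr => i _; rewrite hornerZ horner_exp hornerD hornerX hornerC add0r.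
Qed.

Definition cayley (i : nat) : R := cayley_num i / i`!%:R.

(** Abel's identity at X = 0, divided by n!; it is the functional equation T = x exp T after
    logarithmic differentiation. *)
Lemma theta_cayley :
  theta cayley =1 (fun n => cayley n + cprod cayley (theta cayley) n).
Proof.
case=> [|n]; first by rewrite /theta /cprod /cayley big_ord_recl big_ord0 /= !mul0r !addr0.
have f0 k : (k`!%:R : R) != 0 by rewrite pnatr_eq0 -lt0n fact_gt0.
have thE k : (0 < k)%N -> theta cayley k = k%:R ^+ k / k`!%:R.
  by case: k => // k _; rewrite /theta /cayley /= mulrA -exprS.
have := abel_sum (ltn0Sn n); rewrite thE // => <-.
rewrite big_ord_recr /= subnn expr0 mulr1 binn mul1r mulrDl addrC; congr (_ + _).
rewrite /cprod [RHS]big_ord_recr /= subnn [theta _ 0]/theta mul0r mulr0 addr0 big_distrl.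
apply: eq_bigr => i _ /=; have lt_i := ltn_ord i.
rewrite thE ?subn_gt0 // /cayley -(bin_fact (ltnW lt_i)) !natrM !invfM.
have c0 : ('C(n.+1, i)%:R : R) != 0 by rewrite pnatr_eq0 -lt0n bin_gt0 ltnW.
by field; rewrite c0 !f0.
Qed.

End Abel.

(** * The equations satisfied by r and phi *)

(** Proper divisors only: the divisor d = j belongs to the term k = 1 of the Euler transform, that
    is to r itself, which phi leaves out. The summand 1 comes from z / (1 - z). *)
Definition psin (j : nat) : nat := 1 + \sum_(1 <= d < j | (d %| j)%N) d * ntree d.

Section TreeSeries.

Variable R : numFieldType.

Definition rseq (n : nat) : R := (ntree n)%:R.
Definition mseq (n : nat) : R := (nforest n)%:R.
Definition psi (j : nat) : R := (psin j)%:R.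

(* The generating functions satisfy phi = z/(1-z) * exp(aseq), psi = z phi'/phi. *)
Definition aseq (j : nat) : R := (psi j - 1) / j%:R.
Definition expseq (k : nat) : R := (k`!%:R)^-1.
Definition pos_seq (j : nat) : R := (0 < j)%N%:R.
Definition phi : nat -> R := cprod pos_seq (compo expseq aseq).
Definition cayley_unrooted (k : nat) : R := cayley R k / k%:R.

Lemma psin_ge1 j : (1 <= psin j)%N. Proof. by rewrite leq_addr. Qed.

Lemma aseq0 : aseq 0 = 0. Proof. by rewrite /aseq invr0 mulr0. Qed.

Lemma aseq_ge0 j : 0 <= aseq j.
Proof. by rewrite mulr_ge0 ?invr_ge0 // subr_ge0 /psi ler1n psin_ge1. Qed.

Lemma theta_aseq j : theta aseq j = psi j - 1.
Proof.
case: j => [|j]; rewrite /theta ?mul0r; first by rewrite /psi /psin big_geq // subrr.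
by rewrite /aseq mulrC divfK // pnatr_eq0.
Qed.

Lemma theta_pos_seq : theta pos_seq =1 cprod pos_seq (fun=> 1).
Proof.
move=> n; rewrite /theta /cprod /pos_seq; under eq_bigr do rewrite mulr1.
rewrite big_ord_recl add0r; case: n => [|n]; first by rewrite big_ord0 mul0r.
by rewrite mulr1 (eq_bigr (fun=> 1)) // big_const_ord iter_addr_0.
Qed.

Lemma theta_phi : theta phi =1 cprod phi psi.
Proof.
move=> n; rewrite /phi theta_cprod.
have thE : theta (compo expseq aseq) =1 cprod (compo expseq aseq) (theta aseq).
  move=> k; rewrite theta_compo ?aseq0 //; apply: eq_cprod => // i.
  apply: eq_bigr => j _; congr (_ * _); rewrite /expseq factS natrM invfM mulrA mulfV ?mul1r //.
  by rewrite pnatr_eq0.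
rewrite (eq_cprod (frefl _) thE) cprodA.
rewrite (eq_cprod theta_pos_seq (frefl _)) -cprodA (eq_cprod (frefl _) (cprodC _ _)) cprodA.
by rewrite -cprodDr; apply: eq_cprod => // i; rewrite theta_aseq addrC subrK.
Qed.

Lemma phi0 : phi 0 = 0.
Proof. by rewrite /phi /cprod big_ord_recl big_ord0 /pos_seq mul0r addr0. Qed.

Lemma phi1 : phi 1 = 1.
Proof.
rewrite /phi /cprod !big_ord_recl big_ord0 /pos_seq /= mul0r add0r addr0 mul1r.
by rewrite /compo subnn big_ord_recl big_ord0 addr0 /= /expseq fact0 invr1 /one_seq mulr1.
Qed.

Lemma cprod_ge0 (f g : nat -> R) n :
  (forall i, 0 <= f i) -> (forall i, 0 <= g i) -> 0 <= cprod f g n.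
Proof. by move=> hf hg; apply: sumr_ge0 => i _; apply: mulr_ge0. Qed.

Lemma cpow_ge0 (f : nat -> R) k n : (forall i, 0 <= f i) -> 0 <= cpow f k n.
Proof.
move=> hf; elim: k n => [|k IH] n /=; first by rewrite /one_seq ler0n.
exact: cprod_ge0.
Qed.

Lemma compo_ge0 (F f : nat -> R) n :
  (forall i, 0 <= F i) -> (forall i, 0 <= f i) -> 0 <= compo F f n.
Proof.
by move=> hF hf; apply: sumr_ge0 => k _; apply: mulr_ge0 => //; apply: cpow_ge0.
Qed.

Lemma phi_ge0 n : 0 <= phi n.
Proof.
apply: cprod_ge0 => i; first exact: ler0n.
by apply: compo_ge0 => k; rewrite ?aseq_ge0 // /expseq invr_ge0 ler0n.
Qed.

Lemma cayley_ge0 k : 0 <= cayley R k.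
Proof. by case: k => [|k]; rewrite /cayley ?mul0r // divr_ge0 // exprn_ge0. Qed.

Lemma rseqE : rseq =1 cprod pos_seq mseq.
Proof.
move=> n; rewrite cprodC /rseq ntreeE natr_sum /cprod big_ord_recr /= subnn mulr0 addr0.
by apply: eq_bigr => i _; rewrite /pos_seq subn_gt0 ltn_ord mulr1.
Qed.

Lemma theta_mseq : theta mseq =1 cprod mseq (fun j => (treepow j)%:R).
Proof.
move=> n; rewrite cprodC /theta /mseq -natrM mul_nforest natr_sum /cprod big_ord_recl.
rewrite [X in _ = X * _ + _](_ : _ = 0) ?mul0r ?add0r; last by rewrite /treepow big_geq.
rewrite big_add1 big_mkord.
by apply: eq_bigr => i _; rewrite natrM.
Qed.

Lemma psi_treepow j : psi j + theta rseq j = 1 + (treepow j)%:R.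
Proof.
rewrite /psi /theta /rseq -natrM -natrD -[RHS](natrD _ 1); congr (_%:R); rewrite /psin -addnA; congr addn.
case: j => [|j]; first by rewrite /treepow !big_geq.
rewrite /treepow [RHS]big_mkcond big_nat_recr //= dvdnn; congr addn.
by rewrite [LHS]big_mkcond.
Qed.

(** r is z / (1 - z) times the forest series. The logarithmic derivatives of the factors contribute
    1 and [treepow], from which [psi_treepow] splits off the part due to r itself. *)
Lemma theta_rseq : theta rseq =1 (fun n => cprod rseq psi n + cprod rseq (theta rseq) n).
Proof.
move=> n; rewrite -cprodDr.
rewrite [RHS](eq_cprod (frefl rseq) (psi_treepow)) cprodDr.
have -> : theta rseq n = theta (cprod pos_seq mseq) n by rewrite /theta rseqE.
rewrite theta_cprod (eq_cprod theta_pos_seq (frefl _)) (eq_cprod (frefl _) theta_mseq).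
rewrite cprodA -(cprodA pos_seq) (eq_cprod (frefl _) (cprodC (fun=> 1) _)) cprodA.
by congr (_ + _); apply: eq_cprod => // i; rewrite rseqE.
Qed.

Lemma natr_lreg n : GRing.lreg (n.+1%:R : R).
Proof. by apply/lregP; rewrite pnatr_eq0. Qed.

Lemma rseq1 : rseq 1 = 1.
Proof. by rewrite /rseq ntreeE big_ord_recl big_ord0 /= nforest0. Qed.

(** Both sides satisfy theta f = f (psi + theta f) and begin with z. *)
Theorem rseq_compo : rseq =1 compo (cayley R) phi.
Proof.
have compo_phi F n : theta (compo F phi) n = cprod (compo (theta F) phi) psi n.
  by apply: theta_compo_log; [apply: phi0|apply: theta_phi].
apply: (theta_log_uniq (p := psi)).
- by rewrite /rseq ntree0 /compo big_ord_recl big_ord0 /cayley !mul0r addr0.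
- by rewrite /rseq ntree0.
- rewrite rseq1 /compo !big_ord_recl big_ord0 /= /cayley /= mul0r mul0r add0r addr0.
  by rewrite cprod1r phi1 divr1 mulr1.
- by rewrite /psi /psin big_geq.
- exact: natr_lreg.
- exact: theta_rseq.
move=> n; rewrite compo_phi.
have thE : compo (theta (cayley R)) phi =1
    (fun i => compo (cayley R) phi i + cprod (compo (cayley R) phi) (compo (theta (cayley R)) phi) i).
  move=> i; rewrite -compo_cprod ?phi0 // /compo -big_split; apply: eq_bigr => k _ /=.
  by rewrite theta_cayley mulrDl.
rewrite (eq_cprod thE (frefl _)) cprodDl; congr (_ + _).
by rewrite -cprodA; apply: eq_cprod => // i; rewrite -compo_phi.
Qed.

(** Applying theta to either side gives r psi: on the left because theta turns U into T, on the
    right because theta r - r theta r = r psi. *)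
Theorem cayley_unrooted_compo n : compo cayley_unrooted phi n = rseq n - cprod rseq rseq n / 2.
Proof.
case: n => [|n].
  rewrite /compo /cprod !big_ord_recl !big_ord0 /cayley_unrooted /cayley !mul0r /rseq ntree0.
  by rewrite !addr0 mul0r subr0.
have n0 : (n.+1%:R : R) != 0 by rewrite pnatr_eq0.
apply: (mulfI n0); rewrite -[LHS]/(theta (compo cayley_unrooted phi) n.+1).
rewrite (theta_compo_log _ phi0 theta_phi).
have -> : cprod (compo (theta cayley_unrooted) phi) psi n.+1 = cprod rseq psi n.+1.
  apply: eq_cprod => // i; rewrite rseq_compo; apply: eq_bigr => k _; congr (_ * _).
  case: (nat_of_ord k) => [|j]; rewrite /theta /cayley_unrooted; last by rewrite mulrC divfK // pnatr_eq0.
  by rewrite /cayley mul0r mul0r.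
have E2 : n.+1%:R * cprod rseq rseq n.+1 = cprod rseq (theta rseq) n.+1 *+ 2.
  by rewrite -[LHS]/(theta (cprod rseq rseq) n.+1) theta_cprod cprodC mulr2n.
rewrite mulrBr mulrA E2 -[n.+1%:R * rseq _]/(theta rseq n.+1) theta_rseq.
by rewrite -[_ *+ 2]mulr_natr mulfK ?pnatr_eq0 // addrK.
Qed.

Theorem num_conn_3leaf_power_compo n : (0 < n)%N ->
  (num_conn_3leaf_power n)%:R =
  compo cayley_unrooted phi n + (if odd n then 0 else rseq n./2 / 2) - (n./2)%:R.
Proof.
move=> n0; have := num_conn_3leaf_power_ntree n0 => /(congr1 (fun k => k%:R : R)).
rewrite cayley_unrooted_compo !natrD natr_sum.
have -> : \sum_(k < n.+1) (ntree k * ntree (n - k))%:R = cprod rseq rseq n.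
  by apply: eq_bigr => i _; rewrite natrM.
rewrite -!mul2n !natrM -/(rseq n).
have -> : (if odd n then 0 else ntree n./2)%:R = (if odd n then 0 else rseq n./2) by case: ifP.
have -> : (if odd n then 0 else rseq n./2 / 2) = (if odd n then 0 else rseq n./2) / 2.
  by case: ifP => // _; rewrite mul0r.
move: (num_conn_3leaf_power n)%:R (n./2)%:R (cprod _ _ n) (rseq n) (if _ then _ else _) => u h c r e E.
have two : (2 : R) != 0 by rewrite pnatr_eq0.
apply: (mulfI two); have -> : 2 * u = 2 * r + e - 2 * h - c by rewrite -E; ring.
by field.
Qed.

End TreeSeries.

Local Open Scope nat_scope.

(** * Tables in binary arithmetic *)

Lemma nat_of_bin_add (a b : N) : N.add a b = a + b :> nat.
Proof. by case: a b => [|p] [|q] //=; rewrite ?addn0 //; exact: nat_of_add_pos. Qed.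

Lemma nat_of_bin_mul (a b : N) : N.mul a b = a * b :> nat.
Proof. by case: a b => [|p] [|q] //=; rewrite ?muln0 //; exact: nat_of_mul_pos. Qed.

Lemma nat_of_bin_succ (a : N) : N.succ a = a.+1 :> nat.
Proof. by case: a => //= p; exact: nat_of_succ_pos. Qed.

Section Tables.

Implicit Types (l : seq N) (n : nat).

Definition Nsum (f : nat -> N) (s : seq nat) : N := foldr (fun i => N.add (f i)) 0%num s.

Lemma nat_of_Nsum f s : nat_of_bin (Nsum f s) = \sum_(i <- s) nat_of_bin (f i).
Proof. by elim: s => [|i s IH] /=; rewrite ?big_nil // big_cons -IH nat_of_bin_add. Qed.

(** The lists tabulate r, psi and the forest numbers up to the current index. The new forest number
    comes from [mul_nforest] by an exact division, [treepow j] being psi_j - 1 + j r_j. *)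
Definition table_step (st : nat * seq N * seq N * seq N) :=
  let: (n, ts, ps, fs) := st in
  let ts' := rcons ts (Nsum (nth 0%num fs) (iota 0 n.+1)) in
  let ps' := rcons ps (N.succ (Nsum (fun d =>
    if d %| n.+1 then N.mul (bin_of_nat d) (nth 0%num ts d) else 0%num) (iota 1 n))) in
  let fs' := rcons fs (N.div (Nsum (fun j =>
    N.mul (N.add (N.pred (nth 0%num ps' j)) (N.mul (bin_of_nat j) (nth 0%num ts' j)))
      (nth 0%num fs (n.+1 - j))) (iota 1 n.+1)) (bin_of_nat n.+1)) in
  (n.+1, ts', ps', fs').

Definition table n := iter n table_step (0, [:: 0%num], [:: 1%num], [:: 1%num]).

Definition tabulates (f : nat -> nat) l n :=
  size l = n.+1 /\ forall i, i <= n -> nat_of_bin (nth 0%num l i) = f i.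

Lemma tabulates_rcons f l n a : tabulates f l n -> nat_of_bin a = f n.+1 ->
  tabulates f (rcons l a) n.+1.
Proof.
move=> [sl hl] ha; split=> [|i]; first by rewrite size_rcons sl.
rewrite nth_rcons sl ltnS leq_eqVlt => /predU1P[->|lt_in]; first by rewrite ltnn eqxx.
by rewrite -ltnS lt_in hl.
Qed.

Lemma treepow_psin j : 0 < j -> treepow j = (psin j).-1 + j * ntree j.
Proof.
move=> j0; rewrite /treepow /psin add1n /= (big_cat_nat _ (n := j)) //=.
congr (_ + _); rewrite big_mkcond big_nat1 dvdnn //.
Qed.

Lemma tableP n : let: (m, ts, ps, fs) := table n in
  [/\ m = n, tabulates ntree ts n, tabulates psin ps n & tabulates nforest fs n].
Proof.
elim: n => [|n]; rewrite /table.
  by split=> //; split=> // -[|i] //= _; rewrite ?ntree0 ?nforest0 // /psin big_geq.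
rewrite iterS -/(table n); case: (table n) => [[[m ts] ps] fs] [-> tst tsp tsf]; rewrite /table_step.
have tst' : tabulates ntree (rcons ts (Nsum (nth 0%num fs) (iota 0 n.+1))) n.+1.
  apply: tabulates_rcons => //; rewrite nat_of_Nsum ntreeE -(big_mkord xpredT nforest) /index_iota subn0.
  by rewrite !big_seq; apply: eq_bigr => i; rewrite mem_iota add0n ltnS => /tsf.2.
set ps' := rcons ps _.
have tsp' : tabulates psin ps' n.+1.
  apply: tabulates_rcons => //; rewrite nat_of_bin_succ nat_of_Nsum /psin add1n; congr _.+1.
  rewrite /index_iota subSS subn0 [RHS]big_mkcond !big_seq; apply: eq_bigr => d.
  rewrite mem_iota => /andP[d1 dn]; case: ifP => // _.
  by rewrite nat_of_bin_mul bin_of_natK tst.2 //; lia.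
split=> //; apply: tabulates_rcons => //.
set S := (X in N.div X _).
have S_eq : nat_of_bin S = n.+1 * nforest n.+1.
  rewrite nat_of_Nsum mul_nforest /index_iota subSS subn0 !big_seq; apply: eq_bigr => j.
  rewrite mem_iota => /andP[j1 jn]; rewrite nat_of_bin_mul nat_of_bin_add nat_of_bin_mul bin_of_natK.
  rewrite treepow_psin // tst'.2 ?tsf.2; try lia.
  by congr ((_ + _) * _); rewrite -tsp'.2; lia.
have -> : S = N.mul (bin_of_nat n.+1) (bin_of_nat (nforest n.+1)).
  by apply: (can_inj nat_of_binK); rewrite S_eq nat_of_bin_mul !bin_of_natK.
rewrite N.mul_comm N.div_mul ?bin_of_natK //.
Qed.

Definition ntree_table n : seq N := (table n).1.1.2.
Definition psin_table n : seq N := (table n).1.2.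

Lemma ntree_tableP n : tabulates ntree (ntree_table n) n.
Proof. by have := tableP n; rewrite /ntree_table; case: (table n) => [[[m ts] ps] fs] []. Qed.

Lemma psin_tableP n : tabulates psin (psin_table n) n.
Proof. by have := tableP n; rewrite /psin_table; case: (table n) => [[[m ts] ps] fs] []. Qed.

Definition first_values : seq N :=
  [:: 1; 1; 2; 5; 12; 32; 82; 227; 629; 1840; 5456; 16701; 51939; 164688;
      529070; 1722271; 5664786; 18813360; 62996841; 212533216]%num.

(** The identity [num_conn_3leaf_power_ntree] with the claimed value in place of the count, written
    without subtraction. *)
Definition first_values_check (ts : seq N) : bool :=
  all (fun n => let t := nth 0%num ts in
    N.eqb (N.add (N.mul 2 (N.add (nth 0%num first_values n.-1) (bin_of_nat n./2)))
                 (Nsum (fun k => N.mul (t k) (t (n - k))) (iota 0 n.+1)))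
          (N.add (N.mul 2 (t n)) (if odd n then 0%num else t n./2))) (iota 1 20).

Lemma first_values_checked : first_values_check (ntree_table 20).
Proof. by vm_compute. Qed.

Theorem num_conn_3leaf_power_first_values :
  [seq bin_of_nat (num_conn_3leaf_power n) | n <- iota 1 20] = first_values.
Proof.
apply: (@eq_from_nth _ 0%num) => // i; rewrite size_map size_iota => i20.
rewrite (nth_map 0) ?size_iota // nth_iota // add1n -[RHS]nat_of_binK; congr bin_of_nat.
have [_] := ntree_tableP 20; move: first_values_checked; move: (ntree_table 20) => ts.
have im : i.+1 \in iota 1 20 by rewrite mem_iota.
move=> /allP /(_ _ im) {im} /N.eqb_eq /(congr1 nat_of_bin).
move=> + tst; move: i20; set i' := i.+1 => i20.
have -> : i = i'.-1 by [].
set v := nth _ first_values _; have i'0 : 0 < i' by []; move: (i') i'0 i20 @v => {i'} n n0 n20 v.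
rewrite nat_of_bin_add nat_of_Nsum !(nat_of_bin_add, nat_of_bin_mul) bin_of_natK.
have -> : \sum_(k <- iota 0 n.+1) nat_of_bin (N.mul (nth 0%num ts k) (nth 0%num ts (n - k))) =
    \sum_(k < n.+1) ntree k * ntree (n - k).
  rewrite -(big_mkord xpredT (fun k => ntree k * ntree (n - k))) /index_iota subn0 !big_seq.
  by apply: eq_bigr => k; rewrite mem_iota => kn; rewrite nat_of_bin_mul !tst //; lia.
have -> : nat_of_bin (if odd n then 0%num else nth 0%num ts n./2) = if odd n then 0 else ntree n./2.
  by case: ifP => // _; rewrite tst //; lia.
rewrite tst; last by lia.
have := num_conn_3leaf_power_ntree n0; rewrite -!muln2.
rewrite [nat_of_bin 2]/=.
by move: (\sum_(_ < _) _) (num_conn_3leaf_power n) => a b; lia.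
Qed.

(* Horner's scheme for (n-1)! b^n sum_(i < n) g i, where t i = i! b^(i+1) g i. *)
Definition horner_sum (b : N) (t : nat -> N) n : N :=
  foldl (fun acc i => N.add (N.mul acc (N.mul (bin_of_nat i) b)) (t i)) 0%num (iota 0 n).

Lemma horner_sumS b t n : horner_sum b t n.+1 =
  N.add (N.mul (horner_sum b t n) (N.mul (bin_of_nat n) b)) (t n).
Proof. by rewrite /horner_sum -addn1 iotaD foldl_cat. Qed.

Lemma horner_sumE (R : comNzRingType) (b : N) t (g : nat -> R) n :
  (forall i : nat, (i <= n)%N -> (nat_of_bin (t i))%:R = i`!%:R * (nat_of_bin b)%:R ^+ i.+1 * g i)%R ->
  ((nat_of_bin (horner_sum b t n.+1))%:R =
    n`!%:R * (nat_of_bin b)%:R ^+ n.+1 * \sum_(i < n.+1) g i)%R.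
Proof.
elim: n => [|n IH] ht; first by rewrite big_ord_recl big_ord0 addr0 /= ht.
rewrite horner_sumS nat_of_bin_add !nat_of_bin_mul natrD !natrM bin_of_natK.
rewrite IH; last by move=> i i_le; apply: ht; lia.
by rewrite ht // [in RHS]big_ord_recr /= factS natrM [(_ ^+ n.+2)%R]exprS; ring.
Qed.

(** The entries i! phi_(i+1) are natural numbers: theta phi = phi psi with psi_0 = 1 gives (m + 1)
    phi_(m+2) as a convolution of earlier coefficients with psi, and Horner's scheme with b = 1
    supplies the factorials. *)
Definition phi_step (ps : seq N) (F : seq N) : seq N :=
  rcons F (horner_sum 1 (fun i => N.mul (nth 0%num F i) (nth 0%num ps (size F - i))) (size F)).

Definition phi_table (ps : seq N) n : seq N := iter n (phi_step ps) [:: 1%num].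

Lemma phi_tableP (R : numFieldType) ps n m : m <= n -> tabulates psin ps n ->
  size (phi_table ps m) = m.+1 /\
  forall i, i <= m -> ((nat_of_bin (nth 0%num (phi_table ps m) i))%:R = i`!%:R * phi R i.+1)%R.
Proof.
move=> + [_ hp]; elim: m => [|m IH] mn.
  by split=> // -[|i] // _; rewrite /= phi1 mulr1.
have [sF hF] := IH (ltnW mn); rewrite /phi_table iterS -/(phi_table ps m).
move: (phi_table ps m) sF hF => F sF hF; rewrite /phi_step sF; split=> [|i]; first by rewrite size_rcons sF.
rewrite nth_rcons sF ltnS leq_eqVlt => /predU1P[->|lt_im]; last by rewrite -ltnS lt_im hF.
rewrite ltnn eqxx (horner_sumE (g := fun k => (phi R k.+1 * psi R (m.+1 - k))%R)); last first.
  move=> l lm; rewrite nat_of_bin_mul natrM hF // hp; last by lia.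
  by rewrite expr1n mulr1 mulrA.
rewrite expr1n mulr1 factS natrM [(m.+1%:R * _)%R]mulrC -mulrA; congr (_ * _)%R.
have := theta_phi R m.+2; rewrite /theta /cprod big_ord_recl big_ord_recr /= phi0 mul0r add0r.
rewrite subnn [psi R 0]/psi /psin big_geq // addn0 mulr1 -[m.+2]addn1 natrD mulrDl mul1r addn1.
by move=> /addIr ->; apply: eq_bigr => l _; rewrite /bump /= add1n subSS.
Qed.

End Tables.

From mathcomp Require Import all_classical all_reals all_analysis.

Import Order.TTheory GRing.Theory Num.Theory.
Import numFieldNormedType.Exports.

Local Open Scope classical_set_scope.
Local Open Scope ring_scope.

(** * The renewal theorem *)

Section Renewal.

Variable R : realType.
Variables (p : nat -> R) (mu : R).
Hypotheses (p_ge0 : forall i, 0 <= p i) (p0 : p 0%N = 0) (p1 : 0 < p 1%N).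
Hypothesis sum_p : \sum_(i < n) p i @[n --> \oo] --> (1 : R).

Definition tail (j : nat) : R := 1 - \sum_(i < j.+1) p i.

Hypothesis sum_tail : \sum_(i < n) tail i @[n --> \oo] --> mu.

Lemma psum_le1 n : \sum_(i < n) p i <= 1.
Proof.
rewrite -(cvg_lim (@Rhausdorff R) sum_p).
apply: (nondecreasing_cvgn_le (u_ := fun n => \sum_(i < n) p i)); last by apply/cvg_ex; exists 1.
by apply/nondecreasing_seqP => k; rewrite big_ord_recr lerDl.
Qed.

Lemma tail_ge0 j : 0 <= tail j.
Proof. by rewrite subr_ge0 psum_le1. Qed.

Lemma tailsum_le n : \sum_(i < n) tail i <= mu.
Proof.
rewrite -(cvg_lim (@Rhausdorff R) sum_tail).
apply: (nondecreasing_cvgn_le (u_ := fun n => \sum_(i < n) tail i)); last by apply/cvg_ex; exists mu.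
by apply/nondecreasing_seqP => k; rewrite big_ord_recr lerDl tail_ge0.
Qed.

Lemma mu_ge1 : 1 <= mu.
Proof.
by have := tailsum_le 1; rewrite big_ord_recl big_ord0 addr0 /tail big_ord_recl big_ord0 p0 addr0 subr0.
Qed.

Lemma psum_near e : 0 < e -> exists N, forall n, (N <= n)%N -> 1 - e <= \sum_(i < n) p i.
Proof.
move=> e0; have /cvgrPdist_le/(_ e e0) := sum_p; case=> N _ H; exists N => n Nn.
by have := H n Nn; rewrite ler_distl => /andP[]; rewrite lerBlDr; lra.
Qed.

Lemma tailsum_near e : 0 < e -> exists N, forall n, (N <= n)%N -> mu - e <= \sum_(i < n) tail i.
Proof.
move=> e0; have /cvgrPdist_le/(_ e e0) := sum_tail; case=> N _ H; exists N => n Nn.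
by have := H n Nn; rewrite ler_distl => /andP[]; rewrite lerBlDr; lra.
Qed.

(* M is the upper limit of u. *)
Variables (u : nat -> R) (s M : R).
Hypothesis u_le1 : forall n, `|u n| <= 1.
Hypothesis u_renewal : forall n, u n.+1 = cprod p u n.+1.
Hypothesis u_tail : forall n, cprod tail u n = s.
Hypothesis M_ub : forall e, 0 < e -> exists N, forall n, (N <= n)%N -> u n <= M + e.
Hypothesis M_freq : forall e N, 0 < e -> exists2 n, (N <= n)%N & M - e <= u n.

(** The step back in the classical argument of Erdos, Feller and Pollard: u_(n+1) is an average of
    earlier values, which eventually hardly exceed [M], and u_n enters with the positive weight
    [p 1]. If the average is close to [M], then so is u_n. *)
Lemma renewal_step d : 0 < d -> exists2 d', 0 < d' &
  exists N, forall n, (N <= n)%N -> M - d' <= u n.+1 -> M - d <= u n.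
Proof.
(* In units of d', the bounds on the average allow a gap of 3 + |M|, and the far terms, where only
   |u| <= 1 is known, cost another 1 + |M|. *)
move=> d0; have C0 : 0 < 4 + 2 * `|M| by have := normr_ge0 M; lra.
have [d' d'0 [d'1 d'C]] : exists2 d', 0 < d' & d' <= 1 /\ d' * (4 + 2 * `|M|) <= p 1%N * d.
  exists (Num.min 1 (p 1%N * d / (4 + 2 * `|M|))).
    by rewrite lt_min ltr01 divr_gt0 // mulr_gt0.
  by rewrite ge_min lexx; split=> //; rewrite -ler_pdivlMr // ge_min lexx orbT.
exists d' => //.
have [J' hJ'] := psum_near d'0; have [N1 hN1] := M_ub d'0.
set J := J'.+2.
have hJ n : (J <= n)%N -> 1 - d' <= \sum_(i < n) p i by move=> Jn; apply: hJ'; lia.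
exists (N1 + J)%N => n Nn Mu.
pose w i := M + d' - u i.
have wJ i : (i < J)%N -> 0 <= w (n.+1 - i)%N by move=> iJ; rewrite /w subr_ge0; apply: hN1; lia.
have M_le := ler_norm M; have M_ge := ler_norm (- M); rewrite normrN in M_ge.
have w_ge i : - (1 + `|M|) <= w i.
  by have := u_le1 i; rewrite ler_norml /w => /andP[_]; lra.
have E : cprod p u n.+1 = (M + d') * \sum_(i < n.+2) p i - \sum_(i < n.+2) p i * w (n.+1 - i)%N.
  by rewrite big_distrr -sumrB; apply: eq_bigr => i _ /=; rewrite /w; ring.
have sumw : p 1%N * w n - (1 + `|M|) * d' <= \sum_(i < n.+2) p i * w (n.+1 - i)%N.
  rewrite -(big_mkord xpredT (fun i => p i * w (n.+1 - i)%N)) (big_cat_nat _ (n := J)) //=; last by lia.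
  apply: lerD.
    rewrite /J big_mkord big_ord_recl p0 mul0r add0r big_ord_recl lift0 subSS subn0 lerDl.
    by apply: sumr_ge0 => i _; rewrite mulr_ge0 // wJ //= /bump; have := ltn_ord i; lia.
  have -> : - ((1 + `|M|) * d') = d' * - (1 + `|M|) by ring.
  apply: (@le_trans _ _ (\sum_(J <= i < n.+2) p i * - (1 + `|M|))); last first.
    by apply: ler_sum => i _; apply: ler_wpM2l.
  rewrite -big_distrl /=; apply: ler_wnM2r; first by have := normr_ge0 M; lra.
  have := psum_le1 n.+2; rewrite -(big_mkord xpredT p) (big_cat_nat _ (n := J)) //=; last by lia.
  by rewrite big_mkord; have := hJ J (leqnn _); lra.
have sp1 := psum_le1 n.+2; have sp2 : 1 - d' <= \sum_(i < n.+2) p i by apply: hJ; lia.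
move: Mu; rewrite u_renewal E; move: (\sum_(i < _) _) (\sum_(i < _) _) sumw sp1 sp2 => S W sumw sp1 sp2 Mu.
have : (M + d') * S <= M + d' + (`|M| + 1) * d'.
  have -> : (M + d') * S = M + d' - (M + d') * (1 - S) by ring.
  suff : - (M + d') * (1 - S) <= (`|M| + 1) * d' by lra.
  apply: (@le_trans _ _ ((`|M| + 1) * (1 - S))); first by apply: ler_wpM2r; lra.
  by apply: ler_wpM2l; have := normr_ge0 M; lra.
rewrite /w in sumw => h; rewrite -(ler_pM2l p1); nra.
Qed.

Lemma renewal_steps L d : 0 < d -> exists2 d', 0 < d' &
  exists N, forall n, (N <= n)%N -> M - d' <= u (n + L)%N ->
    forall j, (j <= L)%N -> M - d <= u (n + j)%N.
Proof.
move=> d0; elim: L => [|L [d1 d10 [N1 h1]]].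
  by exists d => //; exists 0%N => n _ Mu j; rewrite leqn0 => /eqP->.
have d20 : 0 < Num.min d d1 by rewrite lt_min d0.
have [d' d'0 [N h]] := renewal_step d20.
exists (Num.min d' d); first by rewrite lt_min d'0.
exists (N + N1)%N => n Nn Mu j; rewrite leq_eqVlt => /predU1P[->|jL].
  by apply: le_trans Mu; rewrite lerD2l lerN2 ge_min lexx orbT.
have H : M - Num.min d d1 <= u (n + L)%N.
  apply: h; first by lia.
  by rewrite -addnS; apply: le_trans Mu; rewrite lerD2l lerN2 ge_min lexx.
apply: h1 => //; first by lia.
by apply: le_trans H; rewrite lerD2l lerN2 ge_min lexx orbT.
Qed.

(** Choose an index m such that the last L + 1 values up to m are all close to [M]. In the identity
    [u_tail] at m they may be replaced by [M], while the tails beyond L add up to little. *)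
Lemma renewal_limit : M * mu = s.
Proof.
apply/eqP; rewrite -subr_eq0 -normr_eq0; apply/eqP/le_anti; rewrite normr_ge0 andbT.
apply/ler_addgt0Pl => e e0; rewrite addr0.
have mu1 := mu_ge1; have mu0 : 0 < mu by lra.
have C0 : 0 < mu + 1 + `|M| by have := normr_ge0 M; lra.
(* Three errors are shared out: |M| d for truncating mu, mu d for replacing u by [M], and d for the
   far terms. *)
set d := e / (mu + 1 + `|M|); have d0 : 0 < d by rewrite divr_gt0.
have [L hL] := tailsum_near d0.
have [d' d'0 [N1 h1]] := renewal_steps L.+1 d0; have [N2 h2] := M_ub d0.
have [m mN Mu] := M_freq (N1 + N2 + L.+1) d'0.
have [n em] : exists n, m = (n + L.+1)%N by exists (m - L.+1)%N; rewrite subnK //; lia.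
have close j : (j < L.+1)%N -> `|u (m - j)%N - M| <= d.
  move=> jL; rewrite ler_distl; apply/andP; split; last by apply: h2; lia.
  have -> : (m - j = n + (L.+1 - j))%N by lia.
  by apply: h1; rewrite -?em //; lia.
have tm : cprod tail u m = \sum_(0 <= j < L.+1) tail j * u (m - j)%N + \sum_(L.+1 <= j < m.+1) tail j * u (m - j)%N.
  by rewrite /cprod -(big_mkord xpredT (fun j => tail j * u (m - j)%N)) (big_cat_nat _ (n := L.+1)) //=; lia.
have := u_tail m; rewrite tm => <-.
have -> : M * mu - (\sum_(0 <= j < L.+1) tail j * u (m - j)%N + \sum_(L.+1 <= j < m.+1) tail j * u (m - j)%N)
  = M * (mu - \sum_(j < L.+1) tail j) - \sum_(0 <= j < L.+1) tail j * (u (m - j)%N - M)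
    - \sum_(L.+1 <= j < m.+1) tail j * u (m - j)%N.
  have -> : \sum_(0 <= j < L.+1) tail j * (u (m - j)%N - M) =
     \sum_(0 <= j < L.+1) tail j * u (m - j)%N - M * \sum_(j < L.+1) tail j.
    by rewrite big_distrr /= -(big_mkord xpredT (fun j => M * tail j)) -sumrB; apply: eq_bigr => j _; ring.
  ring.
have t1 := tailsum_le L.+1; have t2 : mu - d <= \sum_(i < L.+1) tail i by apply: hL; lia.
have b1 : `|M * (mu - \sum_(j < L.+1) tail j)| <= `|M| * d.
  by rewrite normrM ler_wpM2l // ger0_norm; lra.
have b2 : `|\sum_(0 <= j < L.+1) tail j * (u (m - j)%N - M)| <= mu * d.
  apply: le_trans (ler_norm_sum _ _ _) _; apply: (@le_trans _ _ (\sum_(0 <= j < L.+1) tail j * d)).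
    apply: ler_sum_nat => j /andP[_ jL]; rewrite normrM ger0_norm ?tail_ge0 //.
    by apply: ler_wpM2l; rewrite ?tail_ge0 // close.
  by rewrite -big_distrl /= big_mkord ler_wpM2r // ltW.
have b3 : `|\sum_(L.+1 <= j < m.+1) tail j * u (m - j)%N| <= d.
  apply: le_trans (ler_norm_sum _ _ _) _; apply: (@le_trans _ _ (\sum_(L.+1 <= j < m.+1) tail j)).
    apply: ler_sum => j _; rewrite normrM ger0_norm ?tail_ge0 // ler_piMr ?tail_ge0 //.
  have := tailsum_le m.+1; rewrite -(big_mkord xpredT tail) (big_cat_nat _ (n := L.+1)) //=; last by lia.
  by rewrite big_mkord; lra.
apply: le_trans (ler_normB _ _) _; apply: le_trans (lerD (ler_normB _ _) (lexx _)) _.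
apply: le_trans (lerD (lerD b1 b2) b3) _.
have -> : `|M| * d + mu * d + d = d * (mu + 1 + `|M|) by ring.
by rewrite /d divfK // gt_eqF.
Qed.

End Renewal.

Lemma limsup_seq (R : realType) (u : nat -> R) : (forall n, `|u n| <= 1) ->
  exists M, (forall e, 0 < e -> exists N, forall n, (N <= n)%N -> u n <= M + e) /\
            (forall e N, 0 < e -> exists2 n, (N <= n)%N & M - e <= u n).
Proof.
move=> u1; pose S := [set s : R | exists N, forall n, (N <= n)%N -> u n <= s].
have S_lb : lbound S (-1).
  by move=> s [N /(_ N (leqnn N))]; apply: le_trans; have := u1 N; rewrite ler_norml => /andP[].
have hasS : has_inf S.
  split; last by exists (-1).
  by exists 1, 0%N => n _; apply: le_trans (ler_norm _) (u1 n).
exists (inf S); split=> [e e0|e N e0].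
  have [s [N hN] sM] := inf_adherent e0 hasS.
  by exists N => n /hN /le_trans; apply; apply: ltW.
apply: contrapT => H; have : inf S <= inf S - e.
  apply: ge_inf; first by exists (-1).
  exists N => n Nn; rewrite leNgt; apply/negP => lt_u; apply: H; exists n => //; exact: ltW.
lra.
Qed.

Section RenewalTheorem.

Variable R : realType.
Variables (p : nat -> R) (mu : R).
Hypotheses (p_ge0 : forall i, 0 <= p i) (p0 : p 0%N = 0) (p1 : 0 < p 1%N).
Hypothesis sum_p : \sum_(i < n) p i @[n --> \oo] --> (1 : R).
Hypothesis sum_tail : \sum_(i < n) tail p i @[n --> \oo] --> mu.

Definition renewal := compo (fun=> 1) p.

Lemma renewalE n : renewal n = one_seq R n + cprod p renewal n.
Proof.
rewrite /renewal (compoE _ (N := n.+2)) // big_ord_recl mul1r; congr (_ + _).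
rewrite cprodC (cprod_compo _ _ p0 (ltnSn n)); apply: eq_bigr => k _.
by rewrite lift0 !mul1r /= cprodC.
Qed.

Lemma renewal_ge0 n : 0 <= renewal n.
Proof. exact: compo_ge0. Qed.

Lemma renewal_le1 n : renewal n <= 1.
Proof.
elim/ltn_ind: n => n IH; rewrite renewalE; case: n IH => [|n] IH.
  by rewrite /cprod big_ord_recl big_ord0 p0 mul0r !addr0.
rewrite add0r; apply: le_trans (psum_le1 p_ge0 sum_p n.+2).
apply: ler_sum => -[[|i] lt_i] _ /=; first by rewrite p0 mul0r.
by rewrite ler_piMr // IH // ltnS subSS leq_subr.
Qed.

(** In generating functions, [tail p] is (1 - p(z)) / (1 - z) and [renewal] is 1 / (1 - p(z)); their
    product is 1 / (1 - z). *)
Lemma renewal_tail n : cprod (tail p) renewal n = 1.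
Proof.
have tE : tail p =1 cprod (fun=> 1) (fun i => one_seq R i + -1 * p i).
  move=> j; rewrite cprodDr cprodZr cprod1r /tail; congr (1 + _).
  by rewrite mulN1r cprodC /cprod; congr (- _); apply: eq_bigr => i _; rewrite mulr1.
rewrite (eq_cprod tE (frefl _)) -cprodA.
have E : cprod (fun i => one_seq R i + -1 * p i) renewal =1 one_seq R.
  move=> i; rewrite cprodDl cprod1l cprodC cprodZr cprodC mulN1r.
  by rewrite {1}renewalE addrK.
by rewrite (eq_cprod (frefl _) E) cprod1r.
Qed.

Theorem renewal_cvg : renewal n @[n --> \oo] --> mu^-1.
Proof.
(* With s = 1 and s = -1 the argument on upper limits yields both halves of the convergence. *)
have key s : `|s| = 1 -> forall e, 0 < e -> exists N, forall n, (N <= n)%N -> s * renewal n <= s / mu + e.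
  move=> s1; have u1 n : `|s * renewal n| <= 1.
    by rewrite normrM s1 mul1r ger0_norm ?renewal_ge0 ?renewal_le1.
  have [M [Mub Mfr]] := limsup_seq u1.
  have mu1 := mu_ge1 p_ge0 p0 sum_p sum_tail; have mu0 : mu != 0 by rewrite gt_eqF //; lra.
  have <- : M = s / mu; last exact: Mub.
  apply: (mulIf mu0); rewrite divfK //.
  apply: (renewal_limit p_ge0 p0 p1 sum_p sum_tail u1 _ _ Mub Mfr) => n.
    by rewrite {1}renewalE add0r cprodZr.
  by rewrite cprodZr renewal_tail mulr1.
apply/cvgrPdist_le => e e0.
have [|N1 h1] := key 1 _ _ e0; first by rewrite normr1.
have [|N2 h2] := key (-1) _ _ e0; first by rewrite normrN1.
exists (N1 + N2)%N => // n /= Nn; rewrite ler_distl.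
have /h1 : (N1 <= n)%N by lia.
have /h2 : (N2 <= n)%N by lia.
by rewrite !mulN1r !mul1r => a b; apply/andP; split; lra.
Qed.

End RenewalTheorem.

(** * Evaluation of series at nonnegative points *)

Section Evaluation.

Variable R : realFieldType.
Implicit Types (f g F : nat -> R) (x : R).

(** Bounds uniform in N replace statements about sums of series; for products and compositions of
    nonnegative series, truncation only discards nonnegative terms. *)
Definition peval f N x : R := \sum_(i < N) f i * x ^+ i.

Lemma peval_ge0 f N x : (forall i, 0 <= f i) -> 0 <= x -> 0 <= peval f N x.
Proof. by move=> hf x0; apply: sumr_ge0 => i _; rewrite mulr_ge0 // exprn_ge0. Qed.

Lemma peval_le f N M x : (forall i, 0 <= f i) -> 0 <= x -> (N <= M)%N ->
  peval f N x <= peval f M x.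
Proof.
move=> hf x0 /subnK <-; elim: (M - N)%N => // k IH.
by rewrite addSn /peval big_ord_recr /= ler_wpDr // mulr_ge0 // exprn_ge0.
Qed.

Lemma cprod_eval_le f g N x : (forall i, 0 <= f i) -> (forall i, 0 <= g i) -> 0 <= x ->
  peval (cprod f g) N x <= peval f N x * peval g N x.
Proof.
move=> hf hg x0.
pose H i j := if (i + j < N)%N then f i * g j * x ^+ (i + j) else 0.
have -> : peval (cprod f g) N x = \sum_(i < N) \sum_(j < N) H i j.
  rewrite sum_triangle => [|i j]; last by rewrite /H ltnNge => ->.
  apply: eq_bigr => k _; rewrite big_distrl; apply: eq_bigr => i _ /=.
  by rewrite /H subnKC ?ltn_ord // -ltnS.
rewrite big_distrlr; apply: ler_sum => i _; apply: ler_sum => j _ /=.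
rewrite /H; case: ifP => _; last by rewrite !mulr_ge0 ?exprn_ge0.
by rewrite exprD mulrACA.
Qed.

Lemma cpow_eval_le f k N x : (forall i, 0 <= f i) -> 0 <= x ->
  peval (cpow f k) N x <= peval f N x ^+ k.
Proof.
move=> hf x0; elim: k => [|k IH].
  case: N => [|N]; first by rewrite /peval big_ord0 expr0.
  by rewrite /peval big_ord_recl big1 ?addr0 ?mulr1 ?expr0 // => i _; rewrite /one_seq lift0 mul0r.
apply: le_trans (cprod_eval_le _ hf _ x0) _; first by move=> i; apply: cpow_ge0.
by rewrite exprS ler_wpM2l // peval_ge0.
Qed.

Lemma compo_eval_le F f N x : f 0%N = 0 -> (forall i, 0 <= F i) -> (forall i, 0 <= f i) -> 0 <= x ->
  peval (compo F f) N x <= peval F N (peval f N x).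
Proof.
move=> f0 hF hf x0.
have -> : peval (compo F f) N x = \sum_(k < N) F k * peval (cpow f k) N x.
  rewrite /peval; under [RHS]eq_bigr do rewrite big_distrr.
  rewrite exchange_big /=; apply: eq_bigr => n _; rewrite (compoE F (N := N)) // big_distrl /=.
  by apply: eq_bigr => k _; rewrite mulrA.
by apply: ler_sum => k _; apply: ler_wpM2l => //; apply: cpow_eval_le.
Qed.

End Evaluation.

(** * Large deviations and the weighted renewal theorem *)

Section Chernoff.

Variable R : realType.
Variables (p : nat -> R) (mu y B : R).
Hypotheses (p_ge0 : forall i, 0 <= p i) (p0 : p 0%N = 0) (p1 : 0 < p 1%N).
Hypothesis sum_p : \sum_(i < n) p i @[n --> \oo] --> (1 : R).
Hypothesis sum_ip : \sum_(i < n) i%:R * p i @[n --> \oo] --> mu.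
Hypotheses (y1 : 1 < y) (p_exp : forall N, peval p N y <= B).

Lemma sum_ip_le n : \sum_(i < n) i%:R * p i <= mu.
Proof.
rewrite -(cvg_lim (@Rhausdorff R) sum_ip).
apply: (nondecreasing_cvgn_le (u_ := fun n => \sum_(i < n) i%:R * p i)); last by apply/cvg_ex; exists mu.
by apply/nondecreasing_seqP => k; rewrite big_ord_recr lerDl mulr_ge0.
Qed.

(** Summation by parts. The boundary term n P(X >= n) is at most the part of the mean carried by the
    values from n on, which tends to 0. *)
Lemma sum_tail_cvg : \sum_(i < n) tail p i @[n --> \oo] --> mu.
Proof.
have tE n : \sum_(i < n) tail p i = n%:R * (1 - \sum_(i < n) p i) + \sum_(i < n) i%:R * p i.
  elim: n => [|n IH]; first by rewrite !big_ord0 mul0r addr0.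
  by rewrite big_ord_recr /= IH /tail !big_ord_recr /= -[n.+1]addn1 natrD; ring.
have t0 n : 0 <= n%:R * (1 - \sum_(i < n) p i) <= mu - \sum_(i < n) i%:R * p i.
  have s1 := psum_le1 p_ge0 sum_p n.
  rewrite mulr_ge0 ?subr_ge0 //=.
  have H m : n%:R * (\sum_(i < n + m) p i - \sum_(i < n) p i) <= mu - \sum_(i < n) i%:R * p i.
    apply: (@le_trans _ _ (\sum_(i < n + m) i%:R * p i - \sum_(i < n) i%:R * p i)); last first.
      by rewrite lerD2r sum_ip_le.
    elim: m => [|m IH]; first by rewrite addn0 !subrr mulr0.
    rewrite addnS !big_ord_recr /= -!addrA ![p _ - _]addrC ![_ * p _ - _]addrC !addrA mulrDr lerD //.
    by rewrite ler_wpM2r // ler_nat leq_addr.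
  have c : n%:R * (\sum_(i < n + m) p i - \sum_(i < n) p i) @[m --> \oo] --> n%:R * (1 - \sum_(i < n) p i).
    apply: cvgMr; apply: cvgB; last exact: cvg_cst.
    have := sum_p; rewrite -(cvg_shiftn n); apply: cvg_trans; apply: near_eq_cvg.
    by near=> m; rewrite addnC.
  rewrite -(cvg_lim (@Rhausdorff R) c); apply: limr_le; first by apply/cvg_ex; eexists; exact: c.
  by near=> m; apply: H.
have c0 : n%:R * (1 - \sum_(i < n) p i) @[n --> \oo] --> (0 : R).
  apply: (@squeeze_cvgr _ _ _ _ (fun=> 0) (fun n => mu - \sum_(i < n) i%:R * p i)).
  - by near=> n; apply: t0.
  - exact: cvg_cst.
  - by rewrite -[X in _ --> X](subrr mu); apply: cvgB => //; apply: cvg_cst.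
rewrite -[X in _ --> X](add0r mu).
have -> : (fun n => \sum_(i < n) tail p i) =
   (fun n => n%:R * (1 - \sum_(i < n) p i) + \sum_(i < n) i%:R * p i) by apply/funext.
exact: cvgD.
Unshelve. all: by end_near.
Qed.

Lemma mean_ge1 : 1 <= mu.
Proof. exact: mu_ge1 p_ge0 p0 sum_p sum_tail_cvg. Qed.

Lemma expr1D_le (h : R) i : -1 <= h ->
  (1 + h) ^+ i <= 1 + i%:R * h + i%:R ^+ 2 * h ^+ 2 * (1 + `|h|) ^+ i.
Proof.
move=> h1; elim: i => [|i IH]; first by rewrite !expr0 mul0r expr0n /= !mul0r !addr0.
have hn := ler_norm h; have g1 : 1 <= 1 + `|h| by rewrite lerDl.
have g_ge1 : 1 <= (1 + `|h|) ^+ i.+1 by rewrite exprn_ege1.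
rewrite exprS; apply: le_trans (ler_wpM2l _ IH) _; first by lra.
have e1 : (1 + h) * (i%:R ^+ 2 * h ^+ 2 * (1 + `|h|) ^+ i) <= i%:R ^+ 2 * h ^+ 2 * (1 + `|h|) ^+ i.+1.
  rewrite [(1 + `|h|) ^+ i.+1]exprS [X in _ <= X]mulrCA ler_wpM2r //; last by lra.
  by apply: mulr_ge0; [rewrite mulr_ge0 ?sqr_ge0|rewrite exprn_ge0 //; lra].
have h20 := sqr_ge0 h.
have i0 : 0 <= i%:R :> R by [].
have : i%:R * h ^+ 2 <= (2 * i%:R + 1) * h ^+ 2 * (1 + `|h|) ^+ i.+1.
  apply: (@le_trans _ _ ((2 * i%:R + 1) * h ^+ 2)); first by apply: ler_wpM2r => //; lra.
  by rewrite ler_peMr // mulr_ge0 //; lra.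
rewrite -(natr1 i); move: e1.
move: ((1 + `|h|) ^+ i) ((1 + `|h|) ^+ i.+1) => g g' e1 e2.
have -> : (1 + h) * (1 + i%:R * h + i%:R ^+ 2 * h ^+ 2 * g) =
  (1 + (i%:R + 1) * h) + i%:R * h ^+ 2 + (1 + h) * (i%:R ^+ 2 * h ^+ 2 * g) by ring.
have -> : 1 + (i%:R + 1) * h + (i%:R + 1) ^+ 2 * h ^+ 2 * g' =
  (1 + (i%:R + 1) * h) + (2 * i%:R + 1) * h ^+ 2 * g' + i%:R ^+ 2 * h ^+ 2 * g' by ring.
by rewrite lerD // lerD.
Qed.

Lemma second_moment : exists2 C, 0 <= C & exists2 h0, 0 < h0 <= 2^-1 &
  forall (h : R) N, `|h| <= h0 -> \sum_(i < N) p i * (i%:R ^+ 2 * (1 + `|h|) ^+ i) <= C.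
Proof.
(* [g] lies strictly between 1 and [y], and (1 + s)^2 = y / g. The factor (1 + |h|)^i is at most
   g^i, and i s <= (1 + s)^i, so the summand is bounded by p_i y^i / s^2. *)
have y1' := y1; pose g := Num.min (3 / 2) ((1 + y) / 2).
have g1 : 1 < g by rewrite /g lt_min; apply/andP; split; lra.
have gy : g < y by rewrite /g gt_min; apply/orP; right; lra.
have g0 : 0 < g by lra.
pose t := y / g; have t1 : 1 < t by rewrite /t ltr_pdivlMr // mul1r.
pose s := Num.sqrt t - 1.
have s0 : 0 < s by rewrite /s subr_gt0 -[X in X < _]sqrtr1 ltr_sqrt //; lra.
have B0 : 0 <= B by apply: le_trans (p_exp 0); rewrite /peval big_ord0.
exists (B / s ^+ 2); first by rewrite divr_ge0 // sqr_ge0.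
exists (g - 1).
  by rewrite subr_gt0 g1 lerBlDr ge_min; apply/orP; left; lra.
move=> h N hh; rewrite ler_pdivlMr ?exprn_gt0 //.
apply: le_trans (p_exp N); rewrite big_distrl; apply: ler_sum => i _ /=.
rewrite -mulrA; apply: ler_wpM2l => //.
have y_eq : y ^+ i = (Num.sqrt t ^+ i) ^+ 2 * g ^+ i.
  by rewrite exprAC sqr_sqrtr; [rewrite -exprMn /t divfK // gt_eqF|lra].
rewrite y_eq mulrAC -exprMn; apply: ler_pM.
- exact: sqr_ge0.
- by rewrite exprn_ge0 // addr_ge0.
- rewrite ler_sqr ?nnegrE ?exprn_ge0 ?sqrtr_ge0 ?mulr_ge0 ?(ltW s0) //.
  have -> : Num.sqrt t = 1 + s by rewrite /s; ring.
  elim: (nat_of_ord i) => [|j IH]; first by rewrite mul0r expr0.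
  rewrite exprS -(natr1 j); have : 1 <= (1 + s) ^+ j by rewrite exprn_ege1 //; lra.
  move: ((1 + s) ^+ j) IH => z IH z1; nra.
- by have := normr_ge0 h; move=> hn; apply: lerXn2r; rewrite ?nnegrE; lra.
Qed.

Lemma mgf_bound : exists2 C, 0 <= C & exists2 h0, 0 < h0 <= 2^-1 &
  forall (h : R) N, `|h| <= h0 -> peval p N (1 + h) <= 1 + mu * h + C * h ^+ 2.
Proof.
have [C C0 [h0 /andP[h00 h02] HC]] := second_moment.
exists C => //; exists h0; first by rewrite h00.
move=> h N hh; have h1 : -1 <= h.
  by move: hh; rewrite ler_norml => /andP[+ _]; lra.
have H M : (N <= M)%N -> peval p N (1 + h) <= \sum_(i < M) p i + h * \sum_(i < M) i%:R * p i + C * h ^+ 2.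
  move=> NM; apply: le_trans (peval_le _ _ NM) _ => //; first by lra.
  apply: (@le_trans _ _ (\sum_(i < M) p i * (1 + i%:R * h + i%:R ^+ 2 * h ^+ 2 * (1 + `|h|) ^+ i))).
    by apply: ler_sum => i _; apply: ler_wpM2l => //; apply: expr1D_le.
  have -> : \sum_(i < M) p i * (1 + i%:R * h + i%:R ^+ 2 * h ^+ 2 * (1 + `|h|) ^+ i) =
    \sum_(i < M) p i + h * \sum_(i < M) i%:R * p i +
    (\sum_(i < M) p i * (i%:R ^+ 2 * (1 + `|h|) ^+ i)) * h ^+ 2.
    by rewrite big_distrl big_distrr -!big_split; apply: eq_bigr => i _ /=; ring.
  by rewrite lerD2l ler_wpM2r ?sqr_ge0 // HC.
have c : \sum_(i < M) p i + h * \sum_(i < M) i%:R * p i + C * h ^+ 2 @[M --> \oo] --> 1 + h * mu + C * h ^+ 2.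
  by apply: cvgD; [apply: cvgD => //; apply: cvgMr|apply: cvg_cst].
rewrite [mu * h]mulrC -(cvg_lim (@Rhausdorff R) c).
apply: limr_ge; first by apply/cvg_ex; eexists; exact: c.
by exists N => // M /= NM; apply: H.
Qed.

Lemma expR_le1D (h : R) : `|h| <= 2^-1 -> expR (h - 2 * h ^+ 2) <= 1 + h.
Proof.
rewrite ler_norml => /andP[h1 h2].
have e := expR_ge1Dx (- (h - 2 * h ^+ 2)); rewrite expRN in e.
have E := expR_gt0 (h - 2 * h ^+ 2); move: e; set x := expR _ in E * => e.
have := ler_wpM2r (ltW E) e; rewrite mulVf ?gt_eqF // => {}e.
have : 1 <= (1 + h) * (1 + - (h - 2 * h ^+ 2)).
  by have := sqr_ge0 h; nra.
move=> e3; have d0 : 0 < 1 + - (h - 2 * h ^+ 2) by nra.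
rewrite -(ler_pM2l d0); apply: le_trans e _; by rewrite mulrC.
Qed.

(** P(S_k = n) (1 + g)^n is at most the k-th power of the generating function at 1 + g. The sign of
    g is taken opposite to that of k mu - n. *)
Theorem cpow_chernoff e : 0 < e -> exists2 s, 0 < s & forall n k : nat,
  e * n%:R < `|k%:R * mu - n%:R| -> cpow p k n <= expR (- (s * n%:R)).
Proof.
move=> e0; have [C C0 [h0 /andP[h00 h02] HC]] := mgf_bound.
(* Then the quadratic error (C + 2) h^2 n is at most half of the linear gain e h n; C comes from
   [mgf_bound] and 2 from [expR_le1D]. *)
pose h := Num.min h0 (e / (2 * (C + 2))).
have C2 : 0 < 2 * (C + 2) by lra.
have hp : 0 < h by rewrite lt_min h00 divr_gt0.
have hh0 : h <= h0 by rewrite ge_min lexx.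
have hC : h * (2 * (C + 2)) <= e by rewrite -ler_pdivlMr // ge_min lexx orbT.
exists (e * h / 2); first by rewrite divr_gt0 // mulr_gt0.
move=> n k dev; have [nk|kn] := ltnP n k; first by rewrite cpow_small // expR_ge0.
have knR : k%:R <= n%:R :> R by rewrite ler_nat.
have key g : `|g| = h -> cpow p k n <= expR (g * (k%:R * mu - n%:R) + (C + 2) * h ^+ 2 * n%:R).
  move=> gh; have g2 : g ^+ 2 = h ^+ 2 by rewrite -gh real_normK // num_real.
  have gle : `|g| <= 2^-1 by rewrite gh; lra.
  have g1 : 0 <= 1 + g by move: gle; rewrite ler_norml => /andP[+ _]; lra.
  have b1 : cpow p k n * (1 + g) ^+ n <= expR (k%:R * (mu * g + C * g ^+ 2)).
    apply: (@le_trans _ _ (peval (cpow p k) n.+1 (1 + g))).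
      rewrite /peval big_ord_recr /= lerDr; apply: sumr_ge0 => i _.
      by rewrite mulr_ge0 ?exprn_ge0 // cpow_ge0.
    apply: le_trans (cpow_eval_le _ _ p_ge0 g1) _.
    rewrite expRM_natl; apply: lerXn2r; rewrite ?nnegrE ?expR_ge0 ?peval_ge0 //.
    by apply: le_trans (HC _ _ _) _; rewrite ?gh // -addrA; apply: expR_ge1Dx.
  have b2 : expR (n%:R * (g - 2 * g ^+ 2)) <= (1 + g) ^+ n.
    by rewrite expRM_natl; apply: lerXn2r; rewrite ?nnegrE ?expR_ge0 // expR_le1D.
  have b3 : cpow p k n * expR (n%:R * (g - 2 * g ^+ 2)) <= expR (k%:R * (mu * g + C * g ^+ 2)).
    by apply: le_trans b1; apply: ler_wpM2l => //; apply: cpow_ge0.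
  rewrite -ler_pdivlMr ?expR_gt0 // -expRN -expRD in b3; apply: le_trans b3 _.
  rewrite ler_expR g2; have := ler_wpM2l (mulr_ge0 C0 (sqr_ge0 h)) knR; nra.
have fin g : `|g| = h -> g * (k%:R * mu - n%:R) <= - (e * h * n%:R) ->
    cpow p k n <= expR (- (e * h / 2 * n%:R)).
  move=> gh gd; apply: le_trans (key _ gh) _; rewrite ler_expR.
  have n0 : 0 <= n%:R :> R by [].
  have : (C + 2) * h ^+ 2 * n%:R <= e * h / 2 * n%:R by apply: ler_wpM2r => //; nra.
  lra.
have [d0|d0] := ltP 0 (k%:R * mu - n%:R).
  apply: (fin (- h)); first by rewrite normrN gtr0_norm.
  by move: dev; rewrite gtr0_norm // => dev; nra.
apply: (fin h); first by rewrite gtr0_norm.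
by move: dev; rewrite ler0_norm // => dev; nra.
Qed.

End Chernoff.

(** * The power 5/2 *)

Section Pow52.

Variable R : realType.
Implicit Types x z e : R.

(** x^(5/2), kept algebraic so that it can be bounded by integer powers. *)
Definition pow52 x : R := x ^+ 2 * Num.sqrt x.

Lemma pow52M x z : 0 <= x -> pow52 (x * z) = pow52 x * pow52 z.
Proof. by move=> x0; rewrite /pow52 sqrtrM // exprMn mulrACA. Qed.

Lemma pow52_ge0 x : 0 <= pow52 x.
Proof. by rewrite mulr_ge0 ?sqr_ge0 ?sqrtr_ge0. Qed.

Lemma pow52_gt0 x : 0 < x -> 0 < pow52 x.
Proof. by move=> x0; rewrite mulr_gt0 ?exprn_gt0 // sqrtr_gt0. Qed.

Lemma sqrt_le_ge1 x : 1 <= x -> 1 <= Num.sqrt x <= x.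
Proof.
move=> x1; have x0 : 0 <= x by lra.
have := sqrtr_ge0 x; have := sqr_sqrtr x0; move: (Num.sqrt x) => s s2 s0.
by apply/andP; split; nra.
Qed.

Lemma sqrt_ge_le1 x : 0 <= x <= 1 -> x <= Num.sqrt x <= 1.
Proof.
move=> /andP[x0 x1].
have := sqrtr_ge0 x; have := sqr_sqrtr x0; move: (Num.sqrt x) => s s2 s0.
by apply/andP; split; nra.
Qed.

Lemma pow52_near1 e x : 0 <= e <= 2^-1 -> 0 <= x -> 1 <= x * (1 + e) -> x * (1 - e) <= 1 ->
  `|pow52 x - 1| <= 14 * e.
Proof.
move=> /andP[e0 e2] x0 xl xu; rewrite /pow52.
have [x1|x1] := leP 1 x.
  have /andP[s1 sx] := sqrt_le_ge1 x1; have xu2 : x <= 1 + 2 * e by nra.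
  have h1 : 1 <= x ^+ 2 * Num.sqrt x by nra.
  have h2 : x ^+ 2 * Num.sqrt x <= x ^+ 3.
    by rewrite [x ^+ 3]exprSr; apply: ler_wpM2l => //; apply: sqr_ge0.
  have h3 : x ^+ 3 <= (1 + 2 * e) ^+ 3 by apply: lerXn2r; rewrite ?nnegrE //; lra.
  (* For e <= 1/2, 12 e^2 <= 6 e and 8 e^3 <= 2 e; with the linear term 6 e this gives the constant
     14. *)
  rewrite ger0_norm ?subr_ge0 //; have : (1 + 2 * e) ^+ 3 <= 1 + 14 * e; last by lra.
  have -> : (1 + 2 * e) ^+ 3 = 1 + 6 * e + 12 * e ^+ 2 + 8 * e ^+ 3 by ring.
  have : e ^+ 2 <= e / 2 by nra.
  have : e ^+ 3 <= e / 4 by rewrite [e ^+ 3]exprSr; nra.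
  lra.
have /andP[s1 sx] : x <= Num.sqrt x <= 1 by apply: sqrt_ge_le1; rewrite x0 ltW.
have xl2 : 1 - e <= x by nra.
have h1 : x ^+ 2 * Num.sqrt x <= 1 by have := sqrtr_ge0 x; nra.
have h2 : x ^+ 3 <= x ^+ 2 * Num.sqrt x.
  by rewrite [x ^+ 3]exprSr; apply: ler_wpM2l => //; apply: sqr_ge0.
have h3 : (1 - e) ^+ 3 <= x ^+ 3 by apply: lerXn2r; rewrite ?nnegrE //; lra.
rewrite ler0_norm ?subr_le0 //; have : 1 - 3 * e <= (1 - e) ^+ 3; last by lra.
have -> : (1 - e) ^+ 3 = 1 - 3 * e + e ^+ 2 * (3 - e) by ring.
by rewrite lerDl mulr_ge0 ?sqr_ge0 //; lra.
Qed.

End Pow52.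

Section WeightedRenewal.

Variable R : realType.
Variables (p : nat -> R) (mu y B : R).
Hypotheses (p_ge0 : forall i, 0 <= p i) (p0 : p 0%N = 0) (p1 : 0 < p 1%N).
Hypothesis sum_p : \sum_(i < n) p i @[n --> \oo] --> (1 : R).
Hypothesis sum_ip : \sum_(i < n) i%:R * p i @[n --> \oo] --> mu.
Hypotheses (y1 : 1 < y) (p_exp : forall N, peval p N y <= B).

Variables (a : nat -> R) (kappa : R).
Hypotheses (a_ge0 : forall k, 0 <= a k) (a_le1 : forall k, a k <= 1).
Hypothesis a_asymp : pow52 k%:R * a k @[k --> \oo] --> kappa.

Lemma kappa_ge0 : 0 <= kappa.
Proof.
rewrite -(cvg_lim (@Rhausdorff R) a_asymp); apply: limr_ge.
  by apply/cvg_ex; eexists; exact: a_asymp.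
by near=> k; rewrite mulr_ge0 ?pow52_ge0.
Unshelve. all: by end_near.
Qed.

(** With q = n / (k mu) close to 1, n^(5/2) a_k is q^(5/2) mu^(5/2) times k^(5/2) a_k, and the last
    factor is close to [kappa]. *)
Lemma weight_window e1 : 0 < e1 -> exists2 e, 0 < e & exists N, forall n k : nat, (N <= n)%N ->
  `|k%:R * mu - n%:R| <= e * n%:R -> `|pow52 n%:R * a k - kappa * pow52 mu| <= e1.
Proof.
move=> e10; have mu1 : 1 <= mu by apply: (mean_ge1 p_ge0 p0 sum_p sum_ip).
have k0 := kappa_ge0; set Lam := pow52 mu; have L0 : 0 < Lam by apply: pow52_gt0; lra.
pose d := Num.min 1 (e1 / (2 * Lam)).
have d0 : 0 < d by rewrite lt_min ltr01 divr_gt0 // mulr_gt0.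
have d1 : d <= 1 by rewrite ge_min lexx.
have dL : d * (2 * Lam) <= e1 by rewrite -ler_pdivlMr ?/d ?ge_min ?lexx ?orbT // mulr_gt0.
have C0 : 0 < 28 * Lam * (kappa + 1) by apply: mulr_gt0; lra.
pose e := Num.min 2^-1 (e1 / (28 * Lam * (kappa + 1))).
have e0 : 0 < e by rewrite lt_min divr_gt0 // andbT; lra.
have e2 : e <= 2^-1 by rewrite ge_min lexx.
have eC : e * (28 * Lam * (kappa + 1)) <= e1 by rewrite -ler_pdivlMr // ge_min lexx orbT.
have /cvgrPdist_le/(_ d d0) [K _ HK] := a_asymp.
exists e => //; have [N HN] : exists N : nat, 2 * mu * K.+1%:R <= N%:R.
  exists (Num.truncn (2 * mu * K.+1%:R)).+1; apply/ltW/truncnS_gt.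
exists N => n k Nn; rewrite ler_norml => /andP[lo up].
have nR : 2 * mu * K.+1%:R <= n%:R by apply: le_trans HN _; rewrite ler_nat.
have K1 : 1 <= K.+1%:R :> R by rewrite ler1n.
have n0 : 0 < n%:R :> R by nra.
have kK : K.+1%:R <= k%:R :> R.
  have : n%:R / 2 <= k%:R * mu by nra.
  have mu0 : 0 < mu by lra.
  move=> h; rewrite -(ler_pM2r mu0); nra.
have Kk : (K <= k)%N by move: kK; rewrite ler_nat; apply: ltnW.
have kR : 0 < k%:R :> R by lra.
have km0 : 0 < k%:R * mu by rewrite mulr_gt0 //; lra.
pose q := n%:R / (k%:R * mu).
have q0 : 0 <= q by rewrite divr_ge0 ?ltW.
have nq : n%:R = q * (k%:R * mu) by rewrite /q divfK // gt_eqF.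
have /= := HK k Kk; rewrite distrC => ak.
have hq : `|pow52 q - 1| <= 14 * e.
  apply: pow52_near1 => //; first by rewrite e2 ltW.
    by rewrite -(ler_pM2r km0) mul1r mulrAC -nq; nra.
  by rewrite -(ler_pM2r km0) mul1r mulrAC -nq; nra.
have -> : pow52 n%:R * a k - kappa * Lam =
    Lam * ((pow52 q - 1) * (pow52 k%:R * a k) + (pow52 k%:R * a k - kappa)).
  by rewrite nq pow52M // pow52M ?ltW // -/Lam; ring.
set al := pow52 k%:R * a k in ak *.
have al0 : 0 <= al by rewrite mulr_ge0 ?pow52_ge0.
have alk : al <= kappa + 1 by move: ak; rewrite ler_norml => /andP[_]; lra.
rewrite normrM gtr0_norm //.
have h1 : `|(pow52 q - 1) * al| <= 14 * e * (kappa + 1).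
  by rewrite normrM (ger0_norm al0); apply: ler_pM.
have h2 := ler_normD ((pow52 q - 1) * al) (al - kappa).
have h3 : `|(pow52 q - 1) * al + (al - kappa)| <= 14 * e * (kappa + 1) + d by lra.
have := ler_wpM2l (ltW L0) h3; lra.
Qed.

Lemma poly_exp_small (s C e : R) : 0 < s -> 0 <= C -> 0 < e ->
  exists N, forall n : nat, (N <= n)%N -> n.+1%:R * (n.+1%:R ^+ 3 + C) * expR (- (s * n%:R)) <= e.
Proof.
move=> s0 C0 e0.
have D0 : 0 < 16 * (1 + C) * (6 / s) ^+ 6.
  by apply: mulr_gt0; [lra|rewrite exprn_gt0 // divr_gt0].
exists (Num.truncn (16 * (1 + C) * (6 / s) ^+ 6 / e)).+1 => n Nn.
have n0 : (0 < n)%N by apply: leq_trans Nn.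
have nR : 1 <= n%:R :> R by rewrite ler1n.
have nD : 16 * (1 + C) * (6 / s) ^+ 6 / e <= n%:R.
  by apply: le_trans (ltW (truncnS_gt _)) _; rewrite ler_nat.
rewrite ler_pdivrMr // in nD.
(* The bound exp x >= (x / 6)^6 beats the polynomial factor, which has degree 4 in n. *)
have ex : (s * n%:R / 6) ^+ 6 <= expR (s * n%:R).
  have -> : expR (s * n%:R) = expR (s * n%:R / 6) ^+ 6.
    by rewrite -expRM_natl; congr expR; field.
  have sn : 0 <= s * n%:R / 6 by apply: divr_ge0 => //; apply: mulr_ge0; lra.
  apply: lerXn2r; rewrite ?nnegrE ?expR_ge0 //.
  by have := expR_ge1Dx (s * n%:R / 6); lra.
rewrite expRN ler_pdivrMr ?expR_gt0 //.
apply: (@le_trans _ _ (16 * (1 + C) * n%:R ^+ 4)).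
  rewrite -natr1; have -> : 16 * (1 + C) * n%:R ^+ 4 = (2 * n%:R) * ((2 * n%:R) ^+ 3 * (1 + C)) :> R by ring.
  apply: ler_pM; rewrite ?addr_ge0 ?exprn_ge0 //; first by lra.
  have : (n%:R + 1) ^+ 3 <= (2 * n%:R) ^+ 3 :> R by apply: lerXn2r; rewrite ?nnegrE; lra.
  have : 1 <= (2 * n%:R) ^+ 3 :> R by apply: exprn_ege1; lra.
  move: ((2 * n%:R) ^+ 3) => z z1 z2; rewrite mulrDr mulr1 lerD // ler_peMl //.
apply: le_trans (_ : e * (s * n%:R / 6) ^+ 6 <= _); last by rewrite ler_wpM2l // ltW.
have -> : e * (s * n%:R / 6) ^+ 6 = (n%:R * e) * (s / 6) ^+ 6 * n%:R ^+ 5 by field.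
have E : 16 * (1 + C) = 16 * (1 + C) * (6 / s) ^+ 6 * (s / 6) ^+ 6.
  by rewrite -mulrA -exprMn (_ : 6 / s * (s / 6) = 1) ?expr1n ?mulr1 //; field; rewrite gt_eqF.
apply: ler_pM; rewrite ?exprn_ge0 //.
- by rewrite !mulr_ge0 //; lra.
- by rewrite {1}E; apply: ler_wpM2r => //; rewrite exprn_ge0 // divr_ge0 // ltW.
- by rewrite ler_weXn2l.
Qed.

(** Subtract kappa mu^(5/2) times the renewal sequence, whose limit is known. Indices k with k mu
    close to n contribute at most e / 2 times P(S_k = n), and these probabilities sum to at most 1
    over k; the at most n + 1 other indices are exponentially small by [cpow_chernoff]. *)
Theorem weighted_renewal_cvg :
  pow52 n%:R * \sum_(k < n.+1) a k * cpow p k n @[n --> \oo] --> kappa * pow52 mu / mu.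
Proof.
have mu1 : 1 <= mu by apply: (mean_ge1 p_ge0 p0 sum_p sum_ip).
have k0 := kappa_ge0; set Lam := pow52 mu; have L0 : 0 < Lam by apply: pow52_gt0; lra.
have C0 : 0 <= kappa * Lam by rewrite mulr_ge0 // ltW.
have v_cvg := renewal_cvg p_ge0 p0 p1 sum_p (sum_tail_cvg p_ge0 sum_p sum_ip).
have diff0 : pow52 n%:R * (\sum_(k < n.+1) a k * cpow p k n) - kappa * Lam * renewal p n @[n --> \oo] --> (0 : R).
  apply/cvgr0Pnorm_le => e e0.
  have e20 : 0 < e / 2 by lra.
  have [d d0 [N1 H1]] := weight_window e20.
  have [s s0 Hs] := cpow_chernoff p_ge0 p0 sum_p sum_ip y1 p_exp d0.
  have [N2 H2] := poly_exp_small s0 C0 e20.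
  exists (N1 + N2)%N => // n /= Nn.
  have P0 k : 0 <= cpow p k n by apply: cpow_ge0.
  have -> : pow52 n%:R * (\sum_(k < n.+1) a k * cpow p k n) - kappa * Lam * renewal p n =
     \sum_(k < n.+1) (pow52 n%:R * a k - kappa * Lam) * cpow p k n.
    by rewrite /renewal /compo !big_distrr -sumrB; apply: eq_bigr => k _ /=; ring.
  apply: le_trans (ler_norm_sum _ _ _) _.
  apply: (@le_trans _ _ (\sum_(k < n.+1) (e / 2 * cpow p k n + (n.+1%:R ^+ 3 + kappa * Lam) * expR (- (s * n%:R))))).
    apply: ler_sum => k _; rewrite normrM (ger0_norm (P0 k)).
    have [win|out] := leP `|k%:R * mu - n%:R| (d * n%:R).
      rewrite ler_wpDr //; first by rewrite mulr_ge0 ?expR_ge0 // addr_ge0 // exprn_ge0.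
      by apply: ler_wpM2r => //; apply: H1 => //; lia.
    rewrite ler_wpDl //; first by rewrite mulr_ge0 //; lra.
    apply: ler_pM => //; last exact: Hs.
    apply: le_trans (ler_normB _ _) _; rewrite (ger0_norm C0) lerD2r.
    rewrite ger0_norm ?mulr_ge0 ?pow52_ge0 //.
    apply: (@le_trans _ _ (pow52 n%:R)); first by rewrite ler_piMr // pow52_ge0.
    case: (n) => [|m]; first by rewrite /pow52 expr0n mul0r exprn_ge0.
    have m1 : 1 <= m.+1%:R :> R by rewrite ler1n.
    have /andP[_ sx] := sqrt_le_ge1 m1.
    apply: (@le_trans _ _ (m.+1%:R ^+ 3)).
      by rewrite [_ ^+ 3]exprSr; apply: ler_wpM2l => //; apply: sqr_ge0.
    by apply: lerXn2r; rewrite ?nnegrE // ler_nat.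
  have sumE K : \sum_(k < n.+1) (e / 2 * cpow p k n + K) = e / 2 * renewal p n + n.+1%:R * K.
    rewrite big_split sumr_const card_ord mulr_natl /renewal /compo big_distrr; congr (_ + _).
    by apply: eq_bigr => k _; rewrite mul1r.
  rewrite sumE mulrA.
  have := renewal_le1 p_ge0 p0 sum_p n; have := renewal_ge0 p_ge0 n.
  have := H2 n; move: (renewal p n) => v h2 v0 v1.
  have {}h2 : n.+1%:R * (n.+1%:R ^+ 3 + kappa * Lam) * expR (- (s * n%:R)) <= e / 2 by apply: h2; lia.
  have : e / 2 * v <= e / 2 by rewrite ler_piMr //; lra.
  move=> h3; apply: (@le_trans _ _ (e / 2 + e / 2)); last by lra.
  exact: lerD.
have -> : (fun n => pow52 n%:R * \sum_(k < n.+1) a k * cpow p k n) =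
    (fun n => (pow52 n%:R * (\sum_(k < n.+1) a k * cpow p k n) - kappa * Lam * renewal p n) +
              kappa * Lam * renewal p n) by apply/funext => n; rewrite subrK.
by rewrite -[X in _ --> X]add0r; apply: cvgD => //; apply: cvgMr.
Qed.

End WeightedRenewal.

(** * Stirling's formula, with an unspecified constant *)

Section Stirling.

Variable R : realType.
Implicit Types x t : R.

Lemma derive_ge0_le (f f' : R -> R) x : 0 <= x ->
  (forall t, 0 <= t -> is_derive t (1 : R) f (f' t)) ->
  (forall t, 0 <= t -> 0 <= f' t) -> f 0 <= f x.
Proof.
move=> x0 df f'0.
apply: (@ger0_derive1_ndecr R f 0 x) => //.
- by move=> t; rewrite in_itv /= => /andP[t0 _]; have [] := df t (ltW t0).
- move=> t; rewrite in_itv /= => /andP[t0 _].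
  by have [_ d] := df t (ltW t0); rewrite derive1E d f'0 // ltW.
- apply: derivable_within_continuous => t; rewrite in_itv /= => /andP[t0 _].
  by have [] := df t t0.
Qed.

Lemma is_derive_shift (c t : R) : is_derive t (1 : R) (fun u => c + u) 1.
Proof.
have := is_deriveD (is_derive_cst (c : R) t (1 : R)) (is_derive_id t (1 : R)).
by rewrite add0r.
Qed.

Lemma is_derive_ln1D t : 0 <= t -> is_derive t (1 : R) (fun u => ln (1 + u)) (1 + t)^-1.
Proof.
move=> t0; have t1 : 0 < 1 + t by lra.
have := @is_derive1_comp R (@ln R) (fun u => 1 + u) t _ _ (is_derive1_ln t1) (is_derive_shift 1 t).
by rewrite mulr1.
Qed.

Lemma is_derive_invD (c t : R) : 0 < c + t ->
  is_derive t (1 : R) (fun u => (c + u)^-1) (- (c + t) ^- 2).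
Proof.
move=> ct; have c0 : c + t != 0 by rewrite gt_eqF.
have := @is_deriveV R (fun u => c + u) t _ _ c0 (is_derive_shift c t).
by rewrite /GRing.scale /= mulr1.
Qed.

Lemma is_derive_add (f g : R -> R) (t a b : R) : is_derive t (1 : R) f a ->
  is_derive t (1 : R) g b -> is_derive t (1 : R) (fun u => f u + g u) (a + b).
Proof. by move=> df dg; have := is_deriveD df dg. Qed.

Lemma is_derive_mulc (c : R) (f : R -> R) (t a : R) : is_derive t (1 : R) f a ->
  is_derive t (1 : R) (fun u => c * f u) (c * a).
Proof. by move=> df; have := is_deriveZ c df. Qed.

Lemma ln1D_ge x : 0 <= x -> 2 * x / (2 + x) <= ln (1 + x).
Proof.
move=> x0; pose f (u : R) := ln (1 + u) + 4 * (2 + u)^-1.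
pose f' (t : R) := (1 + t)^-1 + 4 * (- (2 + t) ^- 2).
have h : f 0 <= f x.
  apply: (@derive_ge0_le f f' x x0) => t t0.
    by apply: is_derive_add; [apply: is_derive_ln1D|apply/is_derive_mulc/is_derive_invD; lra].
  have t1 : 1 + t != 0 by rewrite gt_eqF //; lra.
  have t2 : 2 + t != 0 by rewrite gt_eqF //; lra.
  have -> : f' t = t ^+ 2 / ((1 + t) * (2 + t) ^+ 2) by rewrite /f'; field; rewrite t1 t2.
  by apply: divr_ge0; rewrite ?sqr_ge0 // mulr_ge0 ?sqr_ge0 //; lra.
move: h; rewrite /f addr0 ln1; have x2 : 2 + x != 0 by rewrite gt_eqF //; lra.
have -> : 2 * x / (2 + x) = 2 - 4 * (2 + x)^-1 by field.
have -> : (2 + 0 : R)^-1 = 2^-1 by rewrite addr0.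
lra.
Qed.

Lemma ln1D_le x : 0 <= x -> ln (1 + x) <= x * (2 + x) / (2 * (1 + x)).
Proof.
move=> x0; pose f (u : R) := 2^-1 * (1 + u) + (- 2^-1 * (1 + u)^-1 + -1 * ln (1 + u)).
pose f' (t : R) := 2^-1 * 1 + (- 2^-1 * (- (1 + t) ^- 2) + -1 * (1 + t)^-1).
have h : f 0 <= f x.
  apply: (@derive_ge0_le f f' x x0) => t t0.
    apply: is_derive_add; first exact/is_derive_mulc/is_derive_shift.
    apply: is_derive_add; apply: is_derive_mulc; last exact: is_derive_ln1D.
    by apply: is_derive_invD; lra.
  have t1 : 1 + t != 0 by rewrite gt_eqF //; lra.
  have -> : f' t = (1 - (1 + t)^-1) ^+ 2 / 2 by rewrite /f'; field; rewrite t1.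
  by apply: divr_ge0; rewrite ?sqr_ge0.
move: h; rewrite /f addr0 ln1 invr1; have x2 : 1 + x != 0 by rewrite gt_eqF //; lra.
have -> : x * (2 + x) / (2 * (1 + x)) = 2^-1 * (1 + x) - 2^-1 * (1 + x)^-1 by field.
lra.
Qed.

(* q_k = k^k e^(-k) / k! is asymptotically kappa / sqrt k, with kappa = 1 / sqrt (2 pi). *)
Definition stirq (k : nat) : R := k%:R ^+ k * expR (- k%:R) / k`!%:R.
Definition stirb (k : nat) : R := Num.sqrt k%:R * stirq k.

Lemma stirq_gt0 k : 0 < stirq k.
Proof.
apply: divr_gt0; last by rewrite ltr0n fact_gt0.
apply: mulr_gt0; last exact: expR_gt0.
by case: k => [|k]; rewrite ?expr0 // exprn_gt0.
Qed.

Lemma stirqS m : (0 < m)%N ->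
  stirq m.+1 = stirq m * expR (m%:R * ln (1 + m%:R^-1) - 1).
Proof.
move=> m0; have mR : 0 < m%:R :> R by rewrite ltr0n.
have x0 : 0 < 1 + m%:R^-1 :> R by rewrite addr_gt0 // invr_gt0.
rewrite expRD mulrC expRM_natl lnK ?posrE // /stirq.
have -> : m.+1%:R = m%:R * (1 + m%:R^-1) :> R.
  by rewrite mulrDr mulr1 mulfV ?gt_eqF // natr1.
rewrite factS natrM exprS -[m.+1%:R](natr1 m).
have -> : expR (- (m%:R * (1 + m%:R^-1))) = expR (- m%:R) * expR (- 1) :> R.
  by rewrite -expRD; congr expR; rewrite mulrDr mulr1 mulfV ?gt_eqF //; ring.
have f0 : m`!%:R != 0 :> R by rewrite pnatr_eq0 -lt0n fact_gt0.
rewrite exprMn; move: (expR (- m%:R)) (expR (- 1)) => u v.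
have m1 : m%:R + 1 != 0 :> R by rewrite gt_eqF // addr_gt0.
have mn : m%:R != 0 :> R by rewrite gt_eqF.
by field; rewrite ?f0 ?m1 ?mn.
Qed.

Lemma stirbS m : (0 < m)%N ->
  stirb m.+1 = stirb m * expR ((m%:R + 2^-1) * ln (1 + m%:R^-1) - 1).
Proof.
move=> m0; have mR : 0 < m%:R :> R by rewrite ltr0n.
have x0 : 0 < 1 + m%:R^-1 :> R by rewrite addr_gt0 // invr_gt0.
rewrite /stirb stirqS //.
have -> : m.+1%:R = m%:R * (1 + m%:R^-1) :> R.
  by rewrite mulrDr mulr1 mulfV ?gt_eqF // natr1.
rewrite sqrtrM ?ltW //.
have -> : Num.sqrt (1 + m%:R^-1 : R) = expR (2^-1 * ln (1 + m%:R^-1)).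
  rewrite -[X in Num.sqrt X](lnK (x := 1 + m%:R^-1)) ?posrE //.
  have -> : expR (ln (1 + m%:R^-1)) = expR (2^-1 * ln (1 + m%:R^-1)) ^+ 2 :> R.
    by rewrite -expRM_natl; congr expR; field.
  by rewrite sqrtr_sqr ger0_norm ?expR_ge0 // expRK.
have -> : (m%:R + 2^-1) * ln (1 + m%:R^-1) - 1 =
   2^-1 * ln (1 + m%:R^-1) + (m%:R * ln (1 + m%:R^-1) - 1) :> R by ring.
by rewrite [in RHS]expRD mulrACA.
Qed.

Lemma stirb_gt0 k : (0 < k)%N -> 0 < stirb k.
Proof. by move=> k0; rewrite mulr_gt0 ?stirq_gt0 // sqrtr_gt0 ltr0n. Qed.

(** The ratio of successive terms is exp ((m + 1/2) ln (1 + 1/m) - 1), and the lower bound 2 x / (2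
    + x) for ln (1 + x) at x = 1/m is exactly 1 / (m + 1/2). *)
Lemma stirb_ndecr m : (0 < m)%N -> stirb m <= stirb m.+1.
Proof.
move=> m0; rewrite stirbS //; apply: ler_peMr; first exact/ltW/stirb_gt0.
rewrite -[leLHS]expR0 ler_expR.
have mR : 0 < m%:R :> R by rewrite ltr0n.
have := @ln1D_ge m%:R^-1; rewrite invr_ge0 ltW // => /(_ isT).
have -> : 2 * m%:R^-1 / (2 + m%:R^-1) = (m%:R + 2^-1)^-1 :> R.
  by field; rewrite !gt_eqF //; lra.
move=> h; have m2 : 0 < m%:R + 2^-1 :> R by lra.
have := ler_wpM2l (ltW m2) h; rewrite mulfV ?gt_eqF //; lra.
Qed.

(** The upper bound for the logarithm makes the exponent of the ratio at most 1 / (4 m) - 1 / (4 (m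
    + 1)), which telescopes; this bounds [stirb] from above. *)
Lemma stirb_nincr m : (0 < m)%N ->
  stirb m.+1 * expR (4^-1 / m.+1%:R) <= stirb m * expR (4^-1 / m%:R).
Proof.
move=> m0; rewrite stirbS // -mulrA -expRD; apply: ler_wpM2l; first exact/ltW/stirb_gt0.
rewrite ler_expR.
have mR : 0 < m%:R :> R by rewrite ltr0n.
have := @ln1D_le m%:R^-1; rewrite invr_ge0 ltW // => /(_ isT) h.
have m2 : 0 <= m%:R + 2^-1 :> R by lra.
have := ler_wpM2l m2 h.
have -> : (m%:R + 2^-1) * (m%:R^-1 * (2 + m%:R^-1) / (2 * (1 + m%:R^-1))) =
  1 + 4^-1 / m%:R - 4^-1 / m.+1%:R :> R.
  by rewrite -natr1; field; rewrite !gt_eqF //; lra.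
move: (4^-1 / m.+1%:R) (4^-1 / m%:R) ((m%:R + 2^-1) * _) => u v z; lra.
Qed.

Lemma stirb_le m : (0 < m)%N -> stirb m <= expR (- 1) * expR (4^-1).
Proof.
move=> m0; apply: (@le_trans _ _ (stirb m * expR (4^-1 / m%:R))).
  by apply: ler_peMr; [exact/ltW/stirb_gt0|rewrite -[leLHS]expR0 ler_expR divr_ge0].
elim: m m0 => // -[_ _|m IH _].
  by rewrite /stirb /stirq sqrtr1 expr1 (_ : 1`! = 1)%N // !mul1r !divr1.
exact: le_trans (stirb_nincr _) (IH _).
Qed.

Lemma stirb_cvg_ex : exists2 kappa : R, 0 < kappa & stirb k @[k --> \oo] --> kappa.
Proof.
have c : cvgn (fun k => stirb k.+1).
  apply: nondecreasing_is_cvgn; first by apply/nondecreasing_seqP => k; apply: stirb_ndecr.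
  by exists (expR (- 1) * expR (4^-1)) => _ [k _ <-]; apply: stirb_le.
exists (limn (fun k => stirb k.+1)).
  apply: lt_le_trans (stirb_gt0 (ltn0Sn 0)) _.
  apply: (nondecreasing_cvgn_le (u_ := fun k => stirb k.+1)) => //.
  by apply/nondecreasing_seqP => k; apply: stirb_ndecr.
by rewrite -(cvg_shiftS stirb).
Qed.

Definition kappa : R := limn stirb.

Lemma stirb_cvg : stirb k @[k --> \oo] --> kappa.
Proof. by have [k _ c] := stirb_cvg_ex; apply/cvg_ex; exists k. Qed.

Lemma kappa_gt0 : 0 < kappa.
Proof. by have [k k0 c] := stirb_cvg_ex; rewrite /kappa (cvg_lim (@Rhausdorff R) c). Qed.

(** U_k e^(-k), the weights to which [weighted_renewal_cvg] is applied. *)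
Definition stirweight (k : nat) : R := cayley_unrooted R k * expR (- k%:R).

Lemma pow52_stirweight k : pow52 k%:R * stirweight k = stirb k.
Proof.
case: k => [|k]; first by rewrite /pow52 expr0n /stirb sqrtr0 /= !mul0r.
rewrite /stirweight /cayley_unrooted /cayley /= /pow52 /stirb /stirq [_ ^+ k.+1]exprS.
have f0 : k.+1`!%:R != 0 :> R by rewrite pnatr_eq0 -lt0n fact_gt0.
have k0 : k.+1%:R != 0 :> R by rewrite pnatr_eq0.
move: (expR _) (Num.sqrt _) => E S; move: (k.+1`!%:R) (k.+1%:R) f0 k0 => u v u0 v0.
by field; rewrite u0 v0.
Qed.

Lemma stirweight_cvg : pow52 k%:R * stirweight k @[k --> \oo] --> kappa.
Proof. by under eq_fun do rewrite pow52_stirweight; apply: stirb_cvg. Qed.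

Lemma stirweight_ge0 k : 0 <= stirweight k.
Proof. by rewrite mulr_ge0 ?expR_ge0 // divr_ge0 ?cayley_ge0. Qed.

Lemma stirweight_le1 k : stirweight k <= 1.
Proof.
case: k => [|k]; first by rewrite /stirweight /cayley_unrooted /cayley !mul0r.
have k1 : 1 <= k.+1%:R :> R by rewrite ler1n.
have p1 : 1 <= pow52 (k.+1%:R : R).
  have /andP[s1 _] := sqrt_le_ge1 k1; rewrite /pow52 -[leLHS]mulr1.
  by apply: ler_pM => //; apply: exprn_ege1.
apply: (@le_trans _ _ (pow52 k.+1%:R * stirweight k.+1)).
  by rewrite ler_peMl // stirweight_ge0.
rewrite pow52_stirweight; apply: le_trans (stirb_le _) _ => //.
by rewrite -expRD -[leRHS]expR0 ler_expR; lra.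
Qed.

Lemma expRN1_le : expR (- 1) <= 2 / 3 :> R.
Proof.
have e := expR_ge1Dxn 1 (ler01 : (0:R) <= 1).
have : 3 / 2 <= expR 1 :> R by move: e; rewrite expr1n (_ : 2`! = 2)%N //; lra.
have := expR_gt0 (1 : R); rewrite expRN; move: (expR 1) => x x0 x1.
by rewrite invf_ple ?posrE //; lra.
Qed.

Lemma cayley_expRN1 k : (0 < k)%N -> cayley R k * expR (- 1) ^+ k = stirq k / k%:R.
Proof.
case: k => // k _; rewrite -expRM_natl mulrN1 /cayley /stirq /= [_ ^+ k.+1]exprS.
have f0 : k.+1`!%:R != 0 :> R by rewrite pnatr_eq0 -lt0n fact_gt0.
have k0 : k.+1%:R != 0 :> R by rewrite pnatr_eq0.
move: (expR _) => E; move: (k.+1`!%:R) (k.+1%:R) f0 k0 => u v u0 v0.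
by field; rewrite u0 v0.
Qed.

Lemma stirq_step k : stirq k.+1 * (1 + (2 * k.+1%:R)^-1) <= stirq k.
Proof.
case: k => [|m].
  rewrite /stirq expr1 expr0 oppr0 expR0 fact0 mul1r !divr1 mulr1 mul1r.
  by have := expRN1_le; lra.
set k := m.+1; have kR : 0 < k%:R :> R by rewrite ltr0n.
rewrite stirqS // -mulrA; apply: ler_piMr; first exact/ltW/stirq_gt0.
apply: (@le_trans _ _ (expR (k%:R * ln (1 + k%:R^-1) - 1) * expR ((2 * k.+1%:R)^-1))).
  by rewrite ler_wpM2l ?expR_ge0 // expR_ge1Dx.
rewrite -expRD -[leRHS]expR0 ler_expR.
have := @ln1D_le k%:R^-1; rewrite invr_ge0 ltW // => /(_ isT) h.
have := ler_wpM2l (ltW kR) h.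
have -> : k%:R * (k%:R^-1 * (2 + k%:R^-1) / (2 * (1 + k%:R^-1))) = 1 - (2 * k.+1%:R)^-1 :> R.
  by rewrite -natr1; field; rewrite !gt_eqF //; lra.
move: (k%:R * _) (2 * k.+1%:R)^-1 => u v; lra.
Qed.

(** At x = 1 / e the terms are [stirq k / k], and [stirq_step] bounds each by twice the decrease of
    [stirq], so the sum telescopes. The true value of T(1 / e) is 1; the bound 2 is good enough. *)
Lemma peval_cayley_le N x : 0 <= x <= expR (- 1) -> peval (cayley R) N x <= 2.
Proof.
move=> /andP[x0 x1]; case: N => [|N]; first by rewrite /peval big_ord0.
apply: (@le_trans _ _ (2 * (1 - stirq N))); last first.
  by have := stirq_gt0 N; lra.
rewrite /peval big_ord_recl {1}/cayley mul0r mul0r add0r.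
under eq_bigr => i _ do rewrite lift0.
elim: N => [|N IH].
  by rewrite big_ord0 /stirq expr0 oppr0 expR0 fact0 !mul1r invr1 subrr mulr0.
rewrite big_ord_recr /=.
have h : cayley R N.+1 * x ^+ N.+1 <= stirq N.+1 / N.+1%:R.
  rewrite -cayley_expRN1 //; apply: ler_wpM2l; first exact: cayley_ge0.
  by apply: lerXn2r; rewrite ?nnegrE // expR_ge0.
have := stirq_step N.
have -> : stirq N.+1 * (1 + (2 * N.+1%:R)^-1) = stirq N.+1 + stirq N.+1 / N.+1%:R / 2.
  have n0 : N.+1%:R != 0 :> R by rewrite pnatr_eq0.
  by move: (stirq N.+1) (N.+1%:R) n0 => u v v0; field; rewrite v0.
move: IH h; move: (\sum_(i < N) _) (cayley R N.+1 * _) (stirq N.+1 / _) => u v w; lra.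
Qed.

End Stirling.

(** * The Stirling constant *)

Section Wallis.

Variable R : realType.
Implicit Types m : R.

Definition wallis (k : nat) : R := \prod_(i < k) (i.*2.+1%:R / i.*2.+2%:R).

Lemma wallisS k : wallis k.+1 = wallis k * (k.*2.+1%:R / k.*2.+2%:R).
Proof. by rewrite /wallis big_ord_recr. Qed.

Lemma wallis_fact k : wallis k * (4 ^+ k * k`!%:R ^+ 2) = k.*2`!%:R.
Proof.
elim: k => [|k IH]; first by rewrite /wallis big_ord0 fact0 expr0 expr1n !mulr1.
rewrite wallisS doubleS !factS !natrM -IH exprS exprMn.
have -> : k.*2.+2%:R = 2 * k.+1%:R :> R by rewrite -natrM; congr (_%:R); lia.
have : k.+1%:R != 0 :> R by rewrite pnatr_eq0.
by move: k.+1%:R => u u0; field.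
Qed.

(** Powers and exponentials cancel between k and 2 k, and the central binomial coefficient over 4^k
    remains. In the limit this expresses kappa^2 by Wallis' product, with no mention of pi. *)
Lemma stirq_wallis k : stirq R k ^+ 2 = stirq R k.*2 * wallis k.
Proof.
have f0 : k`!%:R != 0 :> R by rewrite pnatr_eq0 -lt0n fact_gt0.
have g0 : k.*2`!%:R != 0 :> R by rewrite pnatr_eq0 -lt0n fact_gt0.
have -> : wallis k = k.*2`!%:R / (4 ^+ k * k`!%:R ^+ 2).
  by rewrite -wallis_fact mulfK // mulf_neq0 ?expf_neq0.
rewrite /stirq; have -> : k.*2%:R ^+ k.*2 = 4 ^+ k * k%:R ^+ k ^+ 2 :> R.
  by rewrite -exprM muln2 -muln2 natrM exprMn mulrC [2 ^+ _]exprM mulnC [2 ^+ _ ^+ _]exprAC -natrX.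
have -> : expR (- k.*2%:R) = expR (- k%:R) ^+ 2 :> R.
  by rewrite expr2 -expRD -addnn natrD opprD.
have w0 : 4 ^+ k != 0 :> R by rewrite expf_neq0 // pnatr_eq0.
move: (4 ^+ k) w0 => w w0; by field; rewrite f0 g0 w0.
Qed.

Lemma stirb_wallis k : (0 < k)%N ->
  k%:R / 2 * wallis k ^+ 2 = stirb R k ^+ 4 / stirb R k.*2 ^+ 2.
Proof.
move=> k0; have k0R : 0 < k%:R :> R by rewrite ltr0n.
have q0 := stirq_gt0 R k.*2; have h := stirq_wallis k.
rewrite /stirb; move: (stirq R k) (stirq R k.*2) q0 h => p q q0 h.
rewrite !exprMn sqr_sqrtr // (exprM _ 2 2) sqr_sqrtr //.
rewrite (exprM _ 2 2) h -muln2 natrM.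
by field; rewrite !gt_eqF.
Qed.

Lemma double_cvgny : k.*2 @[k --> \oo] --> \oo.
Proof.
apply/cvgnyPge => A; near=> k.
by rewrite (@leq_trans k) //; [near: k; exists A|rewrite -addnn leq_addr].
Unshelve. all: by end_near. Qed.

Lemma cvg_exprn (u : nat -> R) (l : R) n :
  u k @[k --> \oo] --> l -> u k ^+ n @[k --> \oo] --> l ^+ n.
Proof.
move=> ul; elim: n => [|n IH]; first exact: cvg_cst.
rewrite exprS; have -> : (fun k => u k ^+ n.+1) = (fun k => u k * u k ^+ n).
  by apply/funext => k; rewrite exprS.
exact: cvgM.
Qed.

Lemma wallis_cvg : k%:R / 2 * wallis k ^+ 2 @[k --> \oo] --> kappa R ^+ 2.
Proof.
have k0 := kappa_gt0 R.
have c2 : stirb R k.*2 @[k --> \oo] --> kappa R.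
  exact: (cvg_comp _ _ double_cvgny (@stirb_cvg R)).
have -> : kappa R ^+ 2 = kappa R ^+ 4 / kappa R ^+ 2 by field; rewrite gt_eqF.
have : stirb R k ^+ 4 / stirb R k.*2 ^+ 2 @[k --> \oo] --> kappa R ^+ 4 / kappa R ^+ 2.
  apply: cvgM; first by apply: cvg_exprn; exact: stirb_cvg.
  by apply: cvgV; [rewrite expf_neq0 // gt_eqF|apply: cvg_exprn].
apply: cvg_trans; apply: near_eq_cvg; near=> k; rewrite stirb_wallis //.
by near: k; exists 1%N.
Unshelve. all: by end_near. Qed.

(* Convergents m + 1 / (2 m) and m + 1 / (2 m + 9 / (2 m)) of Brouncker's continued fraction. *)
Definition brouncker1 m : R := (2 * m ^+ 2 + 1) / (2 * m).
Definition brouncker2 m : R := m * (4 * m ^+ 2 + 11) / (4 * m ^+ 2 + 9).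

Lemma wallis_ratio k m : m = 4 * k%:R + 1 -> 
  wallis k.+1 ^+ 2 * (m + 3) ^+ 2 = wallis k ^+ 2 * (m + 1) ^+ 2.
Proof.
move=> ->; rewrite wallisS -!exprMn; congr (_ ^+ 2).
have -> : k.*2.+2%:R = 2 * k%:R + 2 :> R by rewrite -addn2 natrD -muln2 natrM mulrC.
have -> : k.*2.+1%:R = 2 * k%:R + 1 :> R by rewrite -addn1 natrD -muln2 natrM mulrC.
have : 2 * k%:R + 2 != 0 :> R by rewrite gt_eqF // ltr_wpDl.
by move: k%:R => u u0; field.
Qed.

(** Brouncker's fraction b satisfies b(m) b(m + 2) = (m + 1)^2, so the square of [wallis k] times
    b(4 k + 1) would be constant, equal to 8 kappa^2. With a convergent in place of b it is
    monotone. *)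
Lemma brouncker1_nincr k :
  wallis k.+1 ^+ 2 * brouncker1 (4 * k.+1%:R + 1) <= wallis k ^+ 2 * brouncker1 (4 * k%:R + 1).
Proof.
set m : R := 4 * k%:R + 1; have m0 : 0 < m by rewrite ltr_wpDl ?mulr_ge0.
have -> : 4 * k.+1%:R + 1 = m + 4 by rewrite /m -natr1; ring.
have m3 : 0 < m + 3 by lra.
have -> : wallis k.+1 ^+ 2 = wallis k ^+ 2 * (m + 1) ^+ 2 / (m + 3) ^+ 2.
  by rewrite -(@wallis_ratio k m) // mulfK // expf_neq0 // gt_eqF.
rewrite -mulrA -mulrA; apply: ler_wpM2l; first exact: sqr_ge0.
rewrite -subr_ge0 /brouncker1.
(* The numerator of the difference collapses to the constant 72, and to 2700 for the second
   convergent, so the sign is evident. *)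
have -> : (2 * m ^+ 2 + 1) / (2 * m) -
    (m + 1) ^+ 2 * ((m + 3) ^- 2 * ((2 * (m + 4) ^+ 2 + 1) / (2 * (m + 4)))) =
    72 / ((2 * m) * (m + 3) ^+ 2 * (2 * (m + 4))) by field; rewrite !gt_eqF //; lra.
by rewrite divr_ge0 // !mulr_ge0 ?sqr_ge0 //; lra.
Qed.

Lemma brouncker2_ndecr k :
  wallis k ^+ 2 * brouncker2 (4 * k%:R + 1) <= wallis k.+1 ^+ 2 * brouncker2 (4 * k.+1%:R + 1).
Proof.
set m : R := 4 * k%:R + 1; have m0 : 0 < m by rewrite ltr_wpDl ?mulr_ge0.
have -> : 4 * k.+1%:R + 1 = m + 4 by rewrite /m -natr1; ring.
have m3 : 0 < m + 3 by lra.
have -> : wallis k.+1 ^+ 2 = wallis k ^+ 2 * (m + 1) ^+ 2 / (m + 3) ^+ 2.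
  by rewrite -(@wallis_ratio k m) // mulfK // expf_neq0 // gt_eqF.
rewrite -[leRHS]mulrA -[leRHS]mulrA; apply: ler_wpM2l; first exact: sqr_ge0.
have d0 : 0 < 4 * m ^+ 2 + 9 by rewrite ltr_wpDl // mulr_ge0 // sqr_ge0.
have d4 : 0 < 4 * (m + 4) ^+ 2 + 9 by rewrite ltr_wpDl // mulr_ge0 // sqr_ge0.
rewrite -subr_ge0 /brouncker2.
have -> : (m + 1) ^+ 2 * ((m + 3) ^- 2 * ((m + 4) * (4 * (m + 4) ^+ 2 + 11) / (4 * (m + 4) ^+ 2 + 9))) -
    m * (4 * m ^+ 2 + 11) / (4 * m ^+ 2 + 9) =
    2700 / ((4 * m ^+ 2 + 9) * (m + 3) ^+ 2 * (4 * (m + 4) ^+ 2 + 9)) by field; rewrite !gt_eqF.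
apply: divr_ge0; first exact: ler0n.
by apply: mulr_ge0; [apply: mulr_ge0; [exact: ltW|exact: sqr_ge0]|exact: ltW].
Qed.

Lemma kappa_le K : kappa R ^+ 2 <= wallis K ^+ 2 * brouncker1 (4 * K%:R + 1) / 8.
Proof.
rewrite -(cvg_lim (@Rhausdorff R) wallis_cvg); apply: limr_le.
  by apply/cvg_ex; exists (kappa R ^+ 2); exact: wallis_cvg.
near=> k; have kK : (K <= k)%N by near: k; exists K.
have h : wallis k ^+ 2 * brouncker1 (4 * k%:R + 1) <= wallis K ^+ 2 * brouncker1 (4 * K%:R + 1).
  rewrite -(subnKC kK); elim: (k - K)%N => [|d IH]; first by rewrite addn0.
  by rewrite addnS; apply: le_trans (brouncker1_nincr _) IH.
have {h} := ler_wpM2r (_ : 0 <= 8^-1) h => /(_ ltac:(by rewrite invr_ge0)).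
apply: le_trans; set m : R := 4 * k%:R + 1; have m0 : 0 < m by rewrite ltr_wpDl ?mulr_ge0.
have : m <= brouncker1 m by rewrite /brouncker1 ler_pdivlMr; lra.
have mk : m = 4 * k%:R + 1 by [].
have := sqr_ge0 (wallis k); move: (brouncker1 m) (wallis k ^+ 2) => u w w0 mu.
have {mu} ku : 4 * k%:R <= u by lra.
have := ler_wpM2l w0 ku; lra.
Unshelve. all: by end_near. Qed.

Lemma kappa_ge K : wallis K ^+ 2 * brouncker2 (4 * K%:R + 1) / 8 <= kappa R ^+ 2.
Proof.
(* The factor 1 + 1 / (k + 1), with limit 1, absorbs the excess of (m + 1) / 8 = k / 2 + 1 / 4 over
   k / 2. *)
have c : k%:R / 2 * wallis k ^+ 2 * (1 + harmonic k) @[k --> \oo] --> kappa R ^+ 2.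
  rewrite -[X in _ --> X]mulr1 -[X in _ * X]addr0.
  by apply: cvgM; [exact: wallis_cvg|apply: cvgD; [exact: cvg_cst|exact: cvg_harmonic]].
rewrite -(cvg_lim (@Rhausdorff R) c); apply: limr_ge.
  by apply/cvg_ex; exists (kappa R ^+ 2).
near=> k; have kK : (K <= k)%N by near: k; exists K.
have k1 : (1 <= k)%N by near: k; exists 1%N.
have h : wallis K ^+ 2 * brouncker2 (4 * K%:R + 1) <= wallis k ^+ 2 * brouncker2 (4 * k%:R + 1).
  rewrite -(subnKC kK); elim: (k - K)%N => [|d IH]; first by rewrite addn0.
  by rewrite addnS; apply: le_trans IH (brouncker2_ndecr _).
have {h} := ler_wpM2r (_ : 0 <= 8^-1) h => /(_ ltac:(by rewrite invr_ge0)) h.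
apply: le_trans h _; set m : R := 4 * k%:R + 1; have m0 : 0 < m by rewrite ltr_wpDl ?mulr_ge0.
have b2 : brouncker2 m <= m + 1.
  have d0 : 0 < 4 * m ^+ 2 + 9 by rewrite ltr_wpDl // mulr_ge0 // sqr_ge0.
  by rewrite /brouncker2 ler_pdivrMr //; nra.
have k1R : 1 <= k%:R :> R by rewrite ler1n.
have hk : (k%:R / 2) * (1 + harmonic k) >= (m + 1) / 8 :> R.
  have n0 : 0 < k%:R + 1 :> R by lra.
  rewrite /harmonic /= -[k.+1%:R]natr1 /m -subr_ge0.
  have -> : k%:R / 2 * (1 + (k%:R + 1)^-1) - (4 * k%:R + 1 + 1) / 8 =
    (k%:R - 1) / (4 * (k%:R + 1)) :> R by field; rewrite gt_eqF.
  by rewrite divr_ge0 ?subr_ge0 // mulr_ge0 // ltW.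
have -> : k%:R / 2 * wallis k ^+ 2 * (1 + harmonic k) = wallis k ^+ 2 * (k%:R / 2 * (1 + harmonic k)) by ring.
rewrite -[leLHS]mulrA; apply: ler_wpM2l; first exact: sqr_ge0.
by apply: le_trans hk; lra.
Unshelve. all: by end_near. Qed.

End Wallis.

(** * The singularity of the tree series *)

Section Singularity.

Variable R : realType.
Implicit Types x y t : R.
Local Notation r := (rseq R).
Local Notation phi := (phi R).

Lemma rseq_ge0 n : 0 <= r n. Proof. exact: ler0n. Qed.

(** From 1 - s <= exp (-s) at s = t / (n + 1); it reduces numerical upper bounds for exponentials to
    rational arithmetic. *)
Lemma expR_le_inv t n : t < n.+1%:R -> expR t <= (1 - t / n.+1%:R) ^- n.+1.
Proof.
move=> tn; have n0 : 0 < n.+1%:R :> R by rewrite ltr0n.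
have d0 : 0 < 1 - t / n.+1%:R by rewrite subr_gt0 ltr_pdivrMr // mul1r.
have -> : expR t = expR (t / n.+1%:R) ^+ n.+1.
  by rewrite -expRM_natl mulrC divfK ?gt_eqF.
rewrite -exprVn; apply: lerXn2r; rewrite ?nnegrE ?expR_ge0 ?invr_ge0 ?(ltW d0) //.
rewrite -[leLHS]invrK lef_pV2 ?posrE ?invr_gt0 ?expR_gt0 // -expRN.
exact: expR_ge1Dx.
Qed.

Lemma peval_expseq_le N x : 0 <= x -> peval (expseq R) N x <= expR x.
Proof.
move=> x0; rewrite /expR; set u := series (exp_coeff x).
have -> : peval (expseq R) N x = u N.
  by rewrite /u /series /= big_mkord; apply: eq_bigr => i _; rewrite exp_coeffE.
apply: nondecreasing_cvgn_le; last exact: is_cvg_series_exp_coeff.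
apply/nondecreasing_seqP => k; rewrite /u /series /= big_nat_recr //= lerDl exp_coeffE /=.
by rewrite mulr_ge0 ?invr_ge0 // exprn_ge0.
Qed.

Lemma peval_pos_seq_le N x : 0 <= x < 1 -> peval (pos_seq R) N x <= x / (1 - x).
Proof.
move=> /andP[x0 x1]; have d : 0 < 1 - x by lra.
case: N => [|N]; first by rewrite /peval big_ord0 divr_ge0 // ltW.
rewrite ler_pdivlMr // /peval big_ord_recl mul0r add0r.
under eq_bigr => i _ do rewrite lift0 /pos_seq mul1r.
suff -> : (\sum_(i < N) x ^+ i.+1) * (1 - x) = x - x ^+ N.+1 by rewrite gerBl exprn_ge0.
elim: N => [|N IH]; first by rewrite big_ord0 mul0r expr1 subrr.
by rewrite big_ord_recr /= mulrDl IH [x ^+ N.+2]exprS; ring.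
Qed.

Lemma aseqE m : aseq R m = \sum_(1 <= d < m | (d %| m)%N) r d * d%:R / m%:R.
Proof.
rewrite /aseq /psi /psin natrD [1%:R + _]addrC addrK natr_sum big_distrl /=.
by apply: eq_bigr => d _; rewrite natrM [_%:R * _]mulrC.
Qed.

(** Writing m = k d with k >= 2 regroups the sum over proper divisors d of m into the series r(x^k)
    / k. *)
Lemma peval_aseq_le N x : 0 <= x ->
  peval (aseq R) N x <= \sum_(2 <= k < N) peval r N.-1 (x ^+ k) / k%:R.
Proof.
move=> x0; pose g d k := r d * (x ^+ k) ^+ d / k%:R.
have g0 d k : 0 <= g d k by rewrite divr_ge0 // mulr_ge0 // ?rseq_ge0 // !exprn_ge0.
have -> : \sum_(2 <= k < N) peval r N.-1 (x ^+ k) / k%:R =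
    \sum_(2 <= k < N) \sum_(d < N.-1) g d k.
  by apply: eq_bigr => k _; rewrite /peval big_distrl.
apply: (@le_trans _ _ (\sum_(m < N) \sum_(2 <= k < N) \sum_(d < N.-1)
    if m == (k * d)%N :> nat then g d k else 0)).
  apply: ler_sum => m _; rewrite aseqE big_distrl exchange_big /=.
  have -> : \sum_(1 <= d < m | (d %| m)%N) r d * d%:R / m%:R * x ^+ m =
      \sum_(d < N.-1) if [&& (0 < d)%N, (d < m)%N & (d %| m)%N] then r d * d%:R / m%:R * x ^+ m else 0.
    rewrite -(big_mkord xpredT (fun d => if [&& (0 < d)%N, (d < m)%N & (d %| m)%N] then r d * d%:R / m%:R * x ^+ m else 0)).
    have mN := ltn_ord m.
    have [m0|m0] := posnP m.
      rewrite m0 [LHS]big_geq // [RHS]big1 // => d _; by case: ifP => // /and3P[_ + _]; rewrite ltn0.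
    rewrite (@big_cat_nat _ _ _ m 0 N.-1) //=; last by lia.
    rewrite [X in _ = _ + X]big_nat_cond [X in _ = _ + X]big1 ?addr0; last first.
      by move=> d; rewrite andbT => /andP[md _]; case: ifP => // /and3P[_]; lia.
    rewrite [RHS]big_ltn // ltnn add0r big_mkcond /=.
    by apply: eq_big_nat => d /andP[-> ->].
  apply: ler_sum => d _; case: ifP => [/and3P[d0 dm /dvdnP[k mk]]|_]; last first.
    by apply: sumr_ge0 => k _; case: ifP.
  have k2 : (2 <= k)%N by nia.
  have kN : (k < N)%N by have := ltn_ord m; nia.
  rewrite (bigD1_seq k) ?mem_index_iota ?k2 ?iota_uniq //= mk eqxx ler_wpDr //.
    by apply: sumr_ge0 => j _; case: ifP.
  rewrite /g natrM -exprM -[leLHS]mulrA [_^-1 * _]mulrC.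
  have -> : r d * d%:R * (x ^+ (k * d) / (k%:R * d%:R)) = r d * x ^+ (k * d) / k%:R.
    by field; rewrite !pnatr_eq0; lia.
  by [].
rewrite exchange_big /=; apply: ler_sum => k _; rewrite exchange_big /=; apply: ler_sum => d _.
rewrite -big_mkcond /=.
have [kdN|kdN] := ltnP (k * d) N.
  rewrite (bigD1 (Ordinal kdN)) //= big1 ?addr0 // => m /andP[/eqP em /eqP nm].
  by case: nm; apply: val_inj.
by rewrite big1 // => m /eqP em; have := ltn_ord m; lia.
Qed.

Definition x0 : R := 5^-1.

(** Since r has no constant term, r(y) / y is nondecreasing, so r(x^k) <= x^k r(x0) / x0 <= 10 x^k
    for k >= 2. The factor 1 / k is kept at k = 2 and replaced by 1 / 3 in the geometric
    remainder. *)
Lemma peval_aseq_bound N x : 0 <= x < 1 -> x ^+ 2 <= x0 -> peval r N.-1 x0 <= 2 ->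
  peval (aseq R) N x <= 10 * (x ^+ 2 / 2 + x ^+ 3 / (3 * (1 - x))).
Proof.
move=> /andP[xge0 x1] x2 hr; apply: le_trans (peval_aseq_le _ xge0) _.
have xk k : (2 <= k)%N -> x ^+ k <= x0.
  move=> k2; apply: le_trans x2; apply: ler_wiXn2l => //; exact: ltW.
apply: (@le_trans _ _ (\sum_(2 <= k < N) 10 * (x ^+ k / k%:R))).
  apply: ler_sum_nat => k /andP[k2 _].
  have -> : 10 * (x ^+ k / k%:R) = (2 * (x ^+ k / x0)) / k%:R by rewrite /x0 invrK; ring.
  apply: ler_wpM2r; first by rewrite invr_ge0.
  have y0 : 0 <= x ^+ k / x0 by rewrite divr_ge0 ?exprn_ge0 // /x0 invr_ge0.
  apply: (@le_trans _ _ (x ^+ k / x0 * peval r N.-1 x0)); last first.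
    by rewrite [2 * _]mulrC; apply: ler_wpM2l.
  rewrite /peval big_distrr; apply: ler_sum => -[[|d] lt_d] _ /=.
    by rewrite /rseq ntree0 !mul0r mulr0.
  rewrite mulrCA; apply: ler_wpM2l; first exact: rseq_ge0.
  rewrite [x0 ^+ d.+1]exprS mulrA divfK ?invr_eq0 // exprS.
  apply: ler_wpM2l; first exact: exprn_ge0.
  by apply: lerXn2r; rewrite ?nnegrE ?exprn_ge0 ?invr_ge0 // xk.
rewrite -big_distrr /=; apply: ler_wpM2l => //.
have d0 : 0 < 1 - x by lra.
have [N2|N3] := leqP N 2.
  by rewrite big_geq // addr_ge0 // divr_ge0 ?exprn_ge0 // mulr_ge0 // ltW.
case: N N3 {hr} => [|[|[|N]]] // _.
rewrite big_ltn // lerD2l.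
apply: (@le_trans _ _ (\sum_(3 <= k < N.+3) x ^+ k / 3)).
  apply: ler_sum_nat => k /andP[k3 _]; apply: ler_wpM2l; first exact: exprn_ge0.
  by rewrite lef_pV2 ?posrE ?ltr0n ?ler_nat //; lia.
have geo M : \sum_(3 <= k < M.+3) x ^+ k <= x ^+ 3 / (1 - x).
  rewrite ler_pdivlMr //.
  suff -> : (\sum_(3 <= k < M.+3) x ^+ k) * (1 - x) = x ^+ 3 - x ^+ M.+3 by rewrite gerBl exprn_ge0.
  elim: M => [|M IH]; first by rewrite big_geq // mul0r subrr.
  by rewrite big_nat_recr //= mulrDl IH [x ^+ M.+4]exprS; ring.
rewrite -big_distrl /= invfM [3^-1 * _]mulrC mulrA.
by apply: ler_wpM2r; rewrite ?invr_ge0.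
Qed.

Lemma peval_phi_le N x : 0 <= x < 1 -> x ^+ 2 <= x0 -> peval r N.-1 x0 <= 2 ->
  peval phi N x <= x / (1 - x) * expR (10 * (x ^+ 2 / 2 + x ^+ 3 / (3 * (1 - x)))).
Proof.
move=> xb x2 hr; have [xge0 x1] := andP xb.
have e0 i : 0 <= expseq R i by rewrite /expseq invr_ge0.
have E0 i : 0 <= compo (expseq R) (aseq R) i by apply: compo_ge0 => // k; apply: aseq_ge0.
apply: le_trans (cprod_eval_le _ _ E0 xge0) _; first by move=> i; apply: ler0n.
apply: ler_pM; rewrite ?peval_ge0 //.
  exact: peval_pos_seq_le.
apply: le_trans (compo_eval_le _ (aseq0 R) e0 (aseq_ge0 R) xge0) _.
apply: le_trans (peval_expseq_le _ _) _; first exact: peval_ge0 (aseq_ge0 R) xge0.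
by rewrite ler_expR; apply: peval_aseq_bound.
Qed.

(** Induction on the truncation order: r up to degree N needs phi up to degree N, which needs r only
    below degree N. If r(1/5) <= 2 so far, then phi(1/5) <= exp (7/30) / 4 <= 1 / e, and T is at
    most 2 there. *)
Lemma peval_rseq_x0 N : peval r N x0 <= 2.
Proof.
elim/ltn_ind: N => -[_|N IH]; first by rewrite /peval big_ord0.
have x00 : 0 <= x0 by rewrite /x0 invr_ge0.
have -> : peval r N.+1 x0 = peval (compo (cayley R) phi) N.+1 x0.
  by apply: eq_bigr => i _; rewrite rseq_compo.
apply: le_trans (compo_eval_le _ (phi0 R) (cayley_ge0 R) (phi_ge0 R) x00) _.
apply: peval_cayley_le; rewrite peval_ge0 ?phi_ge0 //=; last exact: phi_ge0.
apply: le_trans (peval_phi_le _ _ _) _.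
- by rewrite x00 /x0; lra.
- by rewrite /x0; lra.
- exact: IH.
have -> : x0 / (1 - x0) = 4^-1 by rewrite /x0; field.
rewrite -[expR (-1)]mul1r expRN ler_pdivlMr ?expR_gt0 // -mulrA -expRD.
have h : 10 * (x0 ^+ 2 / 2 + x0 ^+ 3 / (3 * (1 - x0))) + 1 = 37 / 30 by rewrite /x0; field.
rewrite h; have : expR (37 / 30) <= 4 :> R.
  apply: le_trans (expR_le_inv (n := 7) _) _; first by lra.
  by rewrite -[leRHS]invrK lef_pV2 ?posrE; lra.
by lra.
Qed.

Lemma rseq_le n : r n <= 2 * 5 ^+ n.
Proof.
have x00 : 0 <= x0 by rewrite /x0 invr_ge0.
have := peval_rseq_x0 n.+1; rewrite /peval big_ord_recr /= => h.
have : r n * x0 ^+ n <= 2.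
  apply: le_trans h; rewrite lerDr; apply: sumr_ge0 => i _.
  by rewrite mulr_ge0 ?rseq_ge0 // exprn_ge0.
by rewrite /x0 exprVn ler_pdivrMr // exprn_gt0.
Qed.

(* Any x1 with rho < x1 and x1 ^ 2 <= x0 would do: then r(x1 ^ k) converges for all k >= 2. *)
Definition x1 : R := 11 / 25.

Lemma peval_phi_x1 N : peval phi N x1 <= 4.
Proof.
apply: le_trans (peval_phi_le _ _ (peval_rseq_x0 _)) _.
- by rewrite /x1; apply/andP; split; lra.
- by rewrite /x1 /x0; lra.
have h : 10 * (x1 ^+ 2 / 2 + x1 ^+ 3 / (3 * (1 - x1))) <= 3 / 2.
  by rewrite /x1 (_ : 3 * (1 - 11 / 25) = 42 / 25); lra.
have -> : x1 / (1 - x1) = 11 / 14 by rewrite /x1; field.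
have : expR (10 * (x1 ^+ 2 / 2 + x1 ^+ 3 / (3 * (1 - x1)))) <= 5.
  apply: (@le_trans _ _ (expR (3 / 2))); first by rewrite ler_expR.
  apply: le_trans (expR_le_inv (n := 15) _) _; first by lra.
  by rewrite -[leRHS]invrK lef_pV2 ?posrE; lra.
lra.
Qed.

End Singularity.

(** * The radius rho *)

Section Rho.

Variable R : realType.
Implicit Types x y t : R.
Local Notation phi := (phi R).
Local Notation x1 := (x1 R).

(** By n <= 10 (11/10)^n and (11/10) (2/5) = 11/25, derivatives on [0, 2/5] are paid for by the
    value at [x1]. *)
Lemma nat_exp_le (n : nat) x : 0 <= x <= 2 / 5 -> n%:R * x ^+ n <= 10 * x1 ^+ n.
Proof.
move=> /andP[x0 x2]; have q0 : 0 <= (11 / 10 : R) by lra.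
apply: (@le_trans _ _ (n%:R * (2 / 5) ^+ n)).
  by apply: ler_wpM2l => //; apply: lerXn2r; rewrite ?nnegrE //; lra.
have -> : x1 = 11 / 10 * (2 / 5) by rewrite /x1; field.
rewrite [in leRHS]exprMn [leRHS]mulrA; apply: ler_wpM2r; first by apply: exprn_ge0; lra.
have : n%:R / 10 <= (11 / 10 : R) ^+ n; last by lra.
elim: n => [|n IH]; first by rewrite mul0r.
have h : 1 <= (11 / 10 : R) ^+ n by apply: exprn_ege1; lra.
rewrite exprS -[n.+1]addn1 natrD; lra.
Qed.

Lemma exprB_le (n : nat) x y : 0 <= x <= y -> y ^+ n - x ^+ n <= n%:R * y ^+ n.-1 * (y - x).
Proof.
move=> /andP[x0 xy]; rewrite subrXX mulrC.
have y0 := le_trans x0 xy; apply: ler_wpM2r; first by rewrite subr_ge0.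
apply: (@le_trans _ _ (\sum_(i < n) y ^+ n.-1)); last by rewrite sumr_const card_ord mulr_natl.
apply: ler_sum => i _; have -> : n.-1 = (n.-1 - i + i)%N by have := ltn_ord i; lia.
rewrite exprD; have -> : (n.-1 - i + i - i = n.-1 - i)%N by lia.
by apply: ler_wpM2l; [exact: exprn_ge0|apply: lerXn2r].
Qed.

(** 100 = 25 * 4: i y^(i-1) is at most 25 x1^i by [nat_exp_le] at 2/5, and phi(x1) is at most 4. *)
Lemma peval_phi_lip N x y : 0 <= x <= y -> y <= 2 / 5 ->
  peval phi N y <= peval phi N x + 100 * (y - x).
Proof.
move=> /andP[x0 xy] y2; have y0 := le_trans x0 xy.
rewrite -lerBlDl -sumrB.
apply: (@le_trans _ _ (\sum_(i < N) 25 * (y - x) * (phi i * x1 ^+ i))); last first.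
  rewrite -big_distrr /=; have := peval_phi_x1 R N; rewrite /peval.
  have : 0 <= y - x by lra.
  by move=> h1 h2; nra.
apply: ler_sum => i _; rewrite -mulrBr [leRHS]mulrCA; apply: ler_wpM2l; first exact: phi_ge0.
apply: le_trans (exprB_le _ _) _; first by rewrite x0.
have -> : 25 * (y - x) * x1 ^+ i = 25 * x1 ^+ i * (y - x) by rewrite mulrAC.
apply: ler_wpM2r; first by rewrite subr_ge0.
case: i => -[|i] lt_i /=; first by rewrite mul0r mulr_ge0 ?exprn_ge0 // /x1; lra.
have := nat_exp_le (x := 2 / 5) i.+1; rewrite [(2 / 5) ^+ _]exprS => h.
have {}h : i.+1%:R * (2 / 5 * (2 / 5) ^+ i) <= 10 * x1 ^+ i.+1 :> R.
  by apply: h; apply/andP; split; lra.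
apply: (@le_trans _ _ (i.+1%:R * (2 / 5) ^+ i)); last by lra.
by apply: ler_wpM2l => //; apply: lerXn2r; rewrite ?nnegrE //; lra.
Qed.

(** A supremum defined through partial sums, in place of a root found by continuity. The cap 2/5
    keeps it in the range of the Lipschitz bound; that the cap is not reached is settled by the
    numerical certificate. *)
Definition rho : R := sup [set x | 0 <= x <= 2 / 5 /\ forall N, peval phi N x <= expR (-1)].

Lemma rho_has_sup : has_sup [set x | 0 <= x <= 2 / 5 /\ forall N, peval phi N x <= expR (-1)].
Proof.
split; last by exists (2 / 5) => x /= [/andP[]].
exists 0; split=> [|N /=]; first by apply/andP; split; lra.
rewrite /peval big1 ?expR_ge0 // => -[[|i] lt_i] _; first by rewrite phi0 mul0r.
by rewrite exprS mul0r mulr0.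
Qed.

Lemma rho_ge x : 0 <= x <= 2 / 5 -> (forall N, peval phi N x <= expR (-1)) -> x <= rho.
Proof. by move=> h1 h2; apply: (ub_le_sup (proj2 rho_has_sup)). Qed.

Lemma rho_le N x : 0 <= x -> expR (-1) < peval phi N x -> rho <= x.
Proof.
move=> x0 h; apply: ge_sup; first by case: rho_has_sup.
move=> y /= [/andP[y0 _] /(_ N) hy]; rewrite leNgt; apply/negP => xy.
have : peval phi N x <= peval phi N y.
  apply: ler_sum => i _; apply: ler_wpM2l; first exact: phi_ge0.
  by apply: lerXn2r; rewrite ?nnegrE // ltW.
by lra.
Qed.

Lemma rho_bounds : 0 <= rho <= 2 / 5.
Proof.
apply/andP; split.
  apply: rho_ge => [|N]; first by apply/andP; split; lra.
  rewrite /peval big1 ?expR_ge0 // => -[[|i] lt_i] _; first by rewrite phi0 mul0r.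
  by rewrite exprS mul0r mulr0.
by apply: ge_sup => [|y /= [/andP[]]//]; case: rho_has_sup.
Qed.

Lemma peval_rho_le N : peval phi N rho <= expR (-1).
Proof.
rewrite leNgt; apply/negP => h; have /andP[rho0 rho2] := rho_bounds.
pose e := peval phi N rho - expR (-1).
have e0 : 0 < e / 100 by rewrite /e; lra.
have [y [/andP[y0 y2] hy] ry] := sup_adherent e0 rho_has_sup.
have yr : y <= rho by apply: rho_ge; rewrite ?y0.
have := @peval_phi_lip N y rho; rewrite y0 yr => /(_ isT rho2).
by move: ry (hy N); rewrite -/rho /e; lra.
Qed.

(** If the limit fell short of 1 / e, the Lipschitz bound would allow [rho] to be enlarged. *)
Lemma peval_rho_cvg : rho < 2 / 5 -> peval phi n rho @[n --> \oo] --> expR (-1).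
Proof.
move=> rho2; have /andP[rho0 _] := rho_bounds.
have nd : nondecreasing_seq (fun n => peval phi n rho).
  by move=> n m nm; apply: peval_le => //; apply: phi_ge0.
have cv : cvgn (fun n => peval phi n rho).
  apply: nondecreasing_is_cvgn => //; exists (expR (-1)) => _ [n _ <-]; exact: peval_rho_le.
suff e : limn (fun n => peval phi n rho) = expR (-1) by rewrite -e.
apply/eqP; rewrite eq_le; apply/andP; split.
  by apply: limr_le => //; apply: nearW => n; apply: peval_rho_le.
rewrite leNgt; apply/negP; set l := limn _ => ll.
pose d := Num.min (2 / 5 - rho) ((expR (-1) - l) / 100).
have d0 : 0 < d by rewrite lt_min; apply/andP; split; lra.
have [d1 d2] : d <= 2 / 5 - rho /\ d <= (expR (-1) - l) / 100.
  by split; rewrite /d ge_min lexx ?orbT.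
suff : rho + d <= rho by lra.
apply: rho_ge => [|N]; first by apply/andP; split; lra.
have := @peval_phi_lip N rho (rho + d); rewrite rho0 lerDl ltW // => /(_ isT) h.
have {}h := h ltac:(lra).
have := nondecreasing_cvgn_le nd cv N; rewrite -/l.
lra.
Qed.

End Rho.

(** * Asymptotics of the number of graphs *)

Section Asymptotics.

Variable R : realType.
Implicit Types x y t : R.
Local Notation r := (rseq R).
Local Notation phi := (phi R).
Local Notation x1 := (x1 R).
Local Notation rho := (rho R).

Hypotheses (rho_gt0 : 0 < rho) (rho_lt : rho < 2 / 5).

Definition step i : R := expR 1 * (phi i * rho ^+ i).

Definition step_mean : R := limn (fun n => \sum_(i < n) i%:R * step i).

Lemma step_ge0 i : 0 <= step i.
Proof. by rewrite mulr_ge0 ?expR_ge0 // mulr_ge0 ?phi_ge0 // exprn_ge0 // ltW. Qed.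

Lemma step0 : step 0 = 0.
Proof. by rewrite /step phi0 mul0r mulr0. Qed.

Lemma step1 : 0 < step 1.
Proof. by rewrite /step phi1 mul1r mulr_gt0 ?expR_gt0. Qed.

Lemma sum_step : \sum_(i < n) step i @[n --> \oo] --> (1 : R).
Proof.
have e1 : expR 1 * expR (-1) = 1 :> R by rewrite -expRD subrr expR0.
have : expR 1 * peval phi n rho @[n --> \oo] --> expR 1 * expR (-1).
  by apply: cvgMr; exact: peval_rho_cvg.
rewrite e1; apply: cvg_trans; apply: near_eq_cvg; near=> n.
by rewrite /peval big_distrr.
Unshelve. all: by end_near.
Qed.

Lemma sum_nat_phi_le N x : 0 <= x <= 2 / 5 -> \sum_(i < N) i%:R * (phi i * x ^+ i) <= 40.
Proof.
move=> xb; apply: (@le_trans _ _ (\sum_(i < N) 10 * (phi i * x1 ^+ i))); last first.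
  by rewrite -big_distrr /=; have := peval_phi_x1 R N; rewrite /peval; lra.
apply: ler_sum => i _; rewrite mulrCA [leRHS]mulrCA; apply: ler_wpM2l; first exact: phi_ge0.
exact: nat_exp_le.
Qed.

Lemma sum_nat_step_le N : \sum_(i < N) i%:R * step i <= expR 1 * 40.
Proof.
under eq_bigr => i _ do rewrite mulrCA.
rewrite -big_distrr /=; apply: ler_wpM2l; first exact: expR_ge0.
by apply: sum_nat_phi_le; rewrite !ltW.
Qed.

Lemma sum_nat_step : \sum_(i < n) i%:R * step i @[n --> \oo] --> step_mean.
Proof.
apply: nondecreasing_is_cvgn.
  by apply/nondecreasing_seqP => k; rewrite big_ord_recr lerDl mulr_ge0 // step_ge0.
by exists (expR 1 * 40) => _ [n _ <-]; exact: sum_nat_step_le.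
Qed.

Lemma cpow_step k n : cpow step k n = expR k%:R * (rho ^+ n * cpow phi k n).
Proof.
elim: k n => [|k IH] n /=.
  rewrite expR0 mul1r /one_seq; case: n => [|n]; by rewrite ?expr0 ?mul1r // mulr0.
rewrite /cprod !big_distrr /=; apply: eq_bigr => i _.
rewrite IH /step -[k.+1]add1n natrD expRD.
have -> : rho ^+ n = rho ^+ i * rho ^+ (n - i) by rewrite -exprD subnKC // -ltnS.
ring.
Qed.

Lemma compo_cayley_step n :
  \sum_(k < n.+1) stirweight R k * cpow step k n = rho ^+ n * compo (cayley_unrooted R) phi n.
Proof.
rewrite /compo big_distrr; apply: eq_bigr => k _ /=.
rewrite cpow_step /stirweight expRN; have := expR_gt0 (k%:R : R) => h.
by field; rewrite gt_eqF.
Qed.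

(** The exponential moment that the large deviation bound requires, taken at x1 / rho > 1. *)
Lemma step_exp N : peval step N (x1 / rho) <= expR 1 * 4.
Proof.
have -> : peval step N (x1 / rho) = expR 1 * peval phi N x1.
  rewrite /peval big_distrr; apply: eq_bigr => i _ /=.
  have -> : x1 ^+ i = rho ^+ i * (x1 / rho) ^+ i by rewrite -exprMn mulrCA divff ?mulr1 // gt_eqF.
  by rewrite /step -!mulrA.
by apply: ler_wpM2l; [exact: expR_ge0|exact: peval_phi_x1].
Qed.

Lemma compo_cayley_asymp :
  pow52 n%:R * (rho ^+ n * compo (cayley_unrooted R) phi n) @[n --> \oo] -->
    kappa R * pow52 step_mean / step_mean.
Proof.
have -> : (fun n => pow52 n%:R * (rho ^+ n * compo (cayley_unrooted R) phi n)) =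
    (fun n => pow52 n%:R * \sum_(k < n.+1) stirweight R k * cpow step k n).
  by apply/funext => n; rewrite compo_cayley_step.
apply: (weighted_renewal_cvg step_ge0 step0 step1 sum_step sum_nat_step (y := x1 / rho) _ step_exp).
- by rewrite ltr_pdivlMr // mul1r /x1; move: rho_lt; lra.
- exact: stirweight_ge0.
- exact: stirweight_le1.
- exact: stirweight_cvg.
Qed.

Lemma pow52_le (x : R) : 1 <= x -> pow52 x <= x ^+ 3.
Proof.
move=> x1; have /andP[_ h] := sqrt_le_ge1 x1.
by rewrite /pow52 [x ^+ 3]exprSr; apply: ler_wpM2l; rewrite ?sqr_ge0.
Qed.

Lemma pow52_rho_rseq_cvg :
  pow52 n%:R * (rho ^+ n * ((if odd n then 0 else r n./2 / 2) - (n./2)%:R)) @[n --> \oo] --> (0 : R).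
Proof.
apply/cvgr0Pnorm_le => e e0.
(* 9/10 = (2/5) (9/4): [rho] is at most 2/5, r_(n/2) is at most 2 * 5^(n/2), and 5 <= (9/4)^2. *)
pose s := - ln (9 / 10 : R).
have s0 : 0 < s by rewrite /s oppr_gt0 ln_lt0 //; apply/andP; split; lra.
have [N HN] := poly_exp_small s0 ler01 e0.
near=> n; have nN : (N <= n)%N by near: n; exists N.
have n1 : (1 <= n)%N by near: n; exists 1%N.
apply: le_trans (HN n nN).
have -> : expR (- (s * n%:R)) = (9 / 10) ^+ n.
  by rewrite /s mulNr opprK mulrC expRM_natl lnK // posrE; lra.
have [rho0 rho2] := andP (rho_bounds R).
have a5 : 5 ^+ n./2 <= (9 / 4) ^+ n :> R.
  apply: (@le_trans _ _ (((9 / 4 : R) ^+ 2) ^+ n./2)); first by apply: lerXn2r; rewrite ?nnegrE; lra.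
  by rewrite -exprM; apply: ler_weXn2l; lra || lia.
have b1 : 1 <= (9 / 4) ^+ n :> R by apply: exprn_ege1; lra.
have bn : (if odd n then 0 else r n./2 / 2) <= (9 / 4) ^+ n.
  by have := rseq_le R n./2; case: ifP => _; lra.
have bn0 : 0 <= (if odd n then 0 else r n./2 / 2).
  by case: ifP => _ //; rewrite divr_ge0 // rseq_ge0.
have hn : (n./2)%:R <= n%:R :> R by rewrite ler_nat; lia.
have hn0 : 0 <= (n./2)%:R :> R by [].
have n1R : 1 <= n%:R :> R by rewrite ler1n.
set w := (if odd n then _ else _) in bn bn0 *.
have wb : `|w - (n./2)%:R| <= n%:R * (9 / 4) ^+ n.
  by rewrite ler_norml; apply/andP; split; nra.
rewrite normrM (ger0_norm (pow52_ge0 _)) normrM (ger0_norm (exprn_ge0 _ rho0)).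
have c1 : rho ^+ n * `|w - (n./2)%:R| <= n%:R * (9 / 10) ^+ n.
  apply: (@le_trans _ _ ((2 / 5) ^+ n * (n%:R * (9 / 4) ^+ n))).
    by apply: ler_pM => //; rewrite ?exprn_ge0 //; apply: lerXn2r; rewrite ?nnegrE; lra.
  by rewrite mulrCA -exprMn (_ : 2 / 5 * (9 / 4) = 9 / 10) //; field.
have q0 : 0 <= (9 / 10) ^+ n :> R by apply: exprn_ge0; lra.
apply: (@le_trans _ _ (n%:R ^+ 3 * (n%:R * (9 / 10) ^+ n))).
  apply: ler_pM => //; [exact: pow52_ge0| |exact: pow52_le].
  by rewrite mulr_ge0 // exprn_ge0.
rewrite mulrA; apply: ler_wpM2r => //.
have le1 : n%:R <= n.+1%:R :> R by rewrite ler_nat.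
have le3 : n%:R ^+ 3 <= n.+1%:R ^+ 3 :> R by apply: lerXn2r; rewrite ?nnegrE.
rewrite mulrC; apply: ler_pM => //.
by apply: le_trans le3 _; rewrite lerDl.
Unshelve. all: by end_near. Qed.

Theorem num_conn_3leaf_power_asymp :
  pow52 n%:R * (rho ^+ n * (num_conn_3leaf_power n)%:R) @[n --> \oo] -->
    kappa R * pow52 step_mean / step_mean.
Proof.
rewrite -[X in _ --> X]addr0.
apply: cvg_trans (cvgD compo_cayley_asymp pow52_rho_rseq_cvg).
apply: near_eq_cvg; near=> n; have n1 : (0 < n)%N by near: n; exists 1%N.
by rewrite (num_conn_3leaf_power_compo R n1) -[in RHS]addrA [in RHS]mulrDr [in RHS]mulrDr.
Unshelve. all: by end_near. Qed.

Lemma step_mean_ge1 : 1 <= step_mean.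
Proof. exact: (mean_ge1 step_ge0 step0 sum_step sum_nat_step). Qed.

Definition growth_const : R := kappa R * pow52 step_mean / step_mean.

Lemma growth_const_gt0 : 0 < growth_const.
Proof.
have m0 : 0 < step_mean := lt_le_trans ltr01 step_mean_ge1.
rewrite /growth_const divr_gt0 //; apply: mulr_gt0; [exact: kappa_gt0|exact: pow52_gt0].
Qed.

(** Squaring removes the half-integer power, so the constant can be bracketed by rational bounds on
    kappa^2 and mu alone. *)
Lemma growth_const_sqr : growth_const ^+ 2 = kappa R ^+ 2 * step_mean ^+ 3.
Proof.
have m0 : 0 < step_mean := lt_le_trans ltr01 step_mean_ge1.
rewrite /growth_const /pow52 !exprMn sqr_sqrtr ?ltW //.
by field; rewrite gt_eqF.
Qed.

Lemma powR_pow52 (n : nat) : (0 < n)%N -> n%:R `^ (- (5%:R / 2%:R)) = (pow52 n%:R)^-1 :> R.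
Proof.
move=> n0; have n0R : 0 < n%:R :> R by rewrite ltr0n.
rewrite powRN; congr (_^-1); rewrite (_ : 5%:R / 2%:R = 2%:R + 2^-1); last by field.
by rewrite powRD ?powR_mulrn ?powR12_sqrt ?ler0n // gt_eqF ?implybT.
Qed.

Theorem num_conn_3leaf_power_ratio :
  (num_conn_3leaf_power n)%:R /
    (growth_const * rho^-1 ^+ n * n%:R `^ (- (5%:R / 2%:R))) @[n --> \oo] --> (1 : R).
Proof.
have c0 := growth_const_gt0.
rewrite -[X in _ --> X](@mulVf _ growth_const) ?gt_eqF //.
apply: cvg_trans (cvgMr num_conn_3leaf_power_asymp).
apply: near_eq_cvg; near=> n; have n1 : (0 < n)%N by near: n; exists 1%N.
rewrite /= powR_pow52 // exprVn.
have p0 : 0 < pow52 (n%:R : R) by rewrite pow52_gt0 ?ltr0n.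
have q0 : 0 < rho ^+ n by rewrite exprn_gt0.
by field; rewrite !gt_eqF.
Unshelve. all: by end_near. Qed.

End Asymptotics.

(** * Rational brackets for e, phi and z phi' *)

Section Brackets.

Variable R : realType.
Implicit Types x y t z : R.
Local Notation phi := (phi R).
Local Notation x1 := (x1 R).
Local Notation NR a := ((nat_of_bin a)%:R : R).

Lemma natr_binD (a b : N) : (NR (N.add a b)) = (NR a) + (NR b).
Proof. by rewrite nat_of_bin_add natrD. Qed.

Lemma natr_binM (a b : N) : (NR (N.mul a b)) = (NR a) * (NR b).
Proof. by rewrite nat_of_bin_mul natrM. Qed.

Lemma natr_binX (a : N) n : (NR (N.pow a (bin_of_nat n))) = (NR a) ^+ n.
Proof.
elim: n => [|n IH]; first by rewrite expr0 N.pow_0_r.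
have -> : bin_of_nat n.+1 = N.succ (bin_of_nat n).
  by apply: (can_inj nat_of_binK); rewrite nat_of_bin_succ !bin_of_natK.
by rewrite N.pow_succ_r' natr_binM IH exprS.
Qed.

Lemma natr_bin_le (a b : N) : N.leb a b -> (NR a) <= (NR b).
Proof.
move=> /N.leb_le h; rewrite -(N.sub_add a b h) natr_binD lerDr; exact: ler0n.
Qed.

Lemma natr_bin_lt (a b : N) : N.ltb a b -> (NR a) < (NR b).
Proof.
move=> /N.ltb_lt /N.le_succ_l /N.leb_le /natr_bin_le; rewrite nat_of_bin_succ.
by apply: lt_le_trans; rewrite ltr_nat.
Qed.

(* Horner's scheme: the quotient of the two components is i! sum_j f j (a / b)^j if the j-th entry
   of l is (i + j)! f j. *)
Fixpoint horner_frac (a b : N) (i : nat) (l : seq N) : N * N :=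
  if l is f :: l' then
    let: (p, q) := horner_frac a b i.+1 l' in
    let q' := N.mul b (N.mul (bin_of_nat i.+1) q) in (N.add (N.mul q' f) (N.mul a p), q')
  else (0%num, 1%num).

Lemma horner_frac2 a b i f l : (horner_frac a b i (f :: l)).2 =
  N.mul b (N.mul (bin_of_nat i.+1) (horner_frac a b i.+1 l).2).
Proof. by rewrite [horner_frac _ _ _ _]/=; case: (horner_frac a b i.+1 l). Qed.

Lemma horner_frac1 a b i f l : (horner_frac a b i (f :: l)).1 =
  N.add (N.mul (horner_frac a b i (f :: l)).2 f) (N.mul a (horner_frac a b i.+1 l).1).
Proof. by rewrite [horner_frac _ _ _ _]/=; case: (horner_frac a b i.+1 l). Qed.

Lemma horner_fracE (a b : N) i l (f : nat -> R) : NR b != 0 ->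
  (forall j, (j < size l)%N -> NR (nth 0%num l j) = (i + j)`!%:R * f j) ->
  NR (horner_frac a b i l).1 =
    NR (horner_frac a b i l).2 * (i`!%:R * \sum_(j < size l) f j * (NR a / NR b) ^+ j).
Proof.
move=> b0; elim: l i f => [|f0 l IH] i f hl; first by rewrite big_ord0 !mulr0.
rewrite horner_frac1 natr_binD !natr_binM (IH i.+1 (fun j => f j.+1)) => [|j jl]; last first.
  by rewrite addSnnS -(hl j.+1).
rewrite horner_frac2 !natr_binM bin_of_natK (hl 0%N isT) addn0 big_ord_recl expr0 mulr1 factS natrM.
under [in RHS]eq_bigr => j _ do rewrite lift0 exprS mulrCA.
by rewrite -big_distrr /=; set S := \sum_(_ < _) _; field.
Qed.

Lemma horner_frac_den (a b : N) i l :
  NR (horner_frac a b i l).2 * i`!%:R = NR b ^+ size l * (i + size l)`!%:R.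
Proof.
elim: l i => [|f0 l IH] i; first by rewrite addn0.
rewrite horner_frac2 !natr_binM bin_of_natK [size _]/= addnS -addSn exprS -[RHS]mulrA -IH factS natrM.
ring.
Qed.

Lemma expR1_ge n : \sum_(i < n) i`!%:R^-1 <= expR 1 :> R.
Proof.
have := @peval_expseq_le R n 1 ler01; rewrite /peval /expseq.
by under eq_bigr => i _ do rewrite expr1n mulr1.
Qed.

Lemma expR1_le n : (0 < n)%N -> expR 1 <= \sum_(i < n) i`!%:R^-1 + 2 / n`!%:R :> R.
Proof.
(* The partial sum plus 2 / m! does not increase with m, because 2 / (m + 1) <= 1. *)
move=> n0; have step m : (0 < m)%N ->
    \sum_(i < m.+1) i`!%:R^-1 + 2 / m.+1`!%:R <= \sum_(i < m) i`!%:R^-1 + 2 / m`!%:R :> R.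
  move=> m0; rewrite big_ord_recr /= -addrA lerD2l factS natrM invfM.
  have : 0 <= (m`!%:R : R)^-1 by rewrite invr_ge0.
  have : (m.+1%:R : R)^-1 <= 2^-1 by rewrite lef_pV2 ?posrE ?ltr0n // ler_nat.
  by move: (m.+1%:R^-1) (m`!%:R^-1) => u v hu hv; nra.
have le m : \sum_(i < n + m) i`!%:R^-1 + 2 / (n + m)`!%:R <= \sum_(i < n) i`!%:R^-1 + 2 / n`!%:R :> R.
  elim: m => [|m IH]; first by rewrite addn0.
  by rewrite addnS; apply: le_trans (step _ _) IH; rewrite addn_gt0 n0.
rewrite /expR; apply: limr_le; first exact: is_cvg_series_exp_coeff.
near=> k; have nk : (n <= k)%N by near: k; exists n.
apply: (@le_trans _ _ (\sum_(i < k) i`!%:R^-1)).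
  rewrite /series /= big_mkord; apply: ler_sum => i _.
  by rewrite exp_coeffE expr1n mulr1.
by apply: le_trans (le (k - n)%N); rewrite subnKC // lerDl divr_ge0.
Unshelve. all: by end_near. Qed.

(** From degree n on, each power of z is at most (z / x1)^n times that of x1, and phi(x1) <= 4. *)
Lemma peval_phi_tail N n z : 0 <= z <= x1 -> (n <= N)%N ->
  peval phi N z <= peval phi n z + 4 * (z / x1) ^+ n.
Proof.
move=> /andP[z0 z1] nN; have x10 : 0 < x1 by rewrite /x1; lra.
have q01 : 0 <= z / x1 <= 1 by rewrite divr_ge0 ?(ltW x10) //= ler_pdivrMr // mul1r.
have [d ->] : exists d, N = (n + d)%N by exists (N - n)%N; rewrite subnKC.
rewrite /peval big_split_ord /= lerD2l.
apply: (@le_trans _ _ (\sum_(i < d) (z / x1) ^+ n * (phi (n + i) * x1 ^+ (n + i)))).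
  apply: ler_sum => i _; rewrite mulrCA; apply: ler_wpM2l; first exact: phi_ge0.
  have {1}-> : z = z / x1 * x1 by rewrite divfK ?gt_eqF.
  rewrite exprMn; apply: ler_wpM2r; first by rewrite exprn_ge0 ?ltW.
  by rewrite exprD ler_piMr ?exprn_ge0 ?exprn_ile1 //; case/andP: q01.
rewrite -big_distrr /= mulrC; apply: ler_wpM2r; first by rewrite exprn_ge0; case/andP: q01.
apply: le_trans (peval_phi_x1 R (n + d)); rewrite /peval big_split_ord /= lerDr.
by apply: sumr_ge0 => i _; rewrite mulr_ge0 ?phi_ge0 // exprn_ge0 // ltW.
Qed.

(** The factor i is absorbed by i <= 10 (11/10)^i, that is by evaluating phi at 11/10 x; 40 = 10 *
    4. *)
Lemma sum_nat_phi_tail N n x : 0 <= x -> 11 / 10 * x <= x1 -> (n <= N)%N ->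
  \sum_(i < N) i%:R * (phi i * x ^+ i) <=
  \sum_(i < n) i%:R * (phi i * x ^+ i) + 40 * (11 / 10 * x / x1) ^+ n.
Proof.
move=> x0 xx nN; have [d Nd] : exists d, N = (n + d)%N by exists (N - n)%N; rewrite subnKC.
rewrite Nd big_split_ord /= lerD2l.
have le10 (i : nat) : i%:R <= 10 * (11 / 10) ^+ i :> R.
  elim: i => [|i IH]; first by lra.
  have h : 1 <= (11 / 10 : R) ^+ i by apply: exprn_ege1; lra.
  have {IH} : i%:R / 10 <= (11 / 10 : R) ^+ i by lra.
  by rewrite exprS -[i.+1]addn1 natrD; lra.
apply: (@le_trans _ _ (10 * \sum_(i < d) phi (n + i) * (11 / 10 * x) ^+ (n + i))).
  rewrite big_distrr; apply: ler_sum => i _ /=.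
  rewrite mulrCA [leRHS]mulrCA; apply: ler_wpM2l; first exact: phi_ge0.
  by rewrite exprMn mulrA; apply: ler_wpM2r; rewrite ?exprn_ge0.
have z0 : 0 <= 11 / 10 * x by lra.
have := @peval_phi_tail N n (11 / 10 * x); rewrite z0 xx.
move=> /(_ isT nN); rewrite Nd /peval big_split_ord /=; lra.
Qed.

End Brackets.

(** * Inequalities to be checked in binary arithmetic *)

Section Certificates.

Variable R : realType.
Implicit Types (a b p q : N) (x : R).
Local Notation phi := (phi R).
Local Notation x1 := (x1 R).
Local Notation rho := (rho R).
Local Notation e := (expR 1 : R).
Local Notation NR a := ((nat_of_bin a)%:R : R).

Definition natr_binE := (@natr_binD R, @natr_binM R, @natr_binX R).

(** A list of ones encodes the coefficients 1 / j!, so q = n! and p / q is the partial sum of e; the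
    remainder 2 / n! becomes 2 after multiplication by q. *)
Lemma expR1_bounds n p q : (0 < n)%N -> horner_frac 1 1 0 (nseq n 1%num) = (p, q) ->
  NR p <= e * NR q <= NR p + 2.
Proof.
move=> n0 pq; have := @horner_fracE R 1 1 0 (nseq n 1%num) (fun j => j`!%:R^-1) (oner_neq0 _).
have := horner_frac_den R 1 1 0 (nseq n 1%num); rewrite pq size_nseq fact0 mulr1 expr1n mul1r add0n.
move=> /= qn -> => [|j jn]; last by rewrite nth_nseq jn add0n mulfV // pnatr_eq0 -lt0n fact_gt0.
rewrite mul1r qn.
under eq_bigr => j _ do rewrite divr1 expr1n mulr1.
have f0 : 0 < n`!%:R :> R by rewrite ltr0n fact_gt0.
rewrite [e * _]mulrC ler_pM2l // expR1_ge /=.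
have := ler_wpM2l (ltW f0) (expR1_le R n0); rewrite mulrDr [_ * (2 / _)]mulrCA mulfV ?mulr1 //.
Qed.

Lemma expR1_le_bin n p q (E T : N) : (0 < n)%N -> horner_frac 1 1 0 (nseq n 1%num) = (p, q) ->
  N.ltb 0 q -> N.leb (N.mul (N.add p 2) T) (N.mul E q) -> e * NR T <= NR E.
Proof.
move=> n0 pq /(natr_bin_lt R) q0 /(natr_bin_le R); rewrite !natr_binE => h.
have /andP[_ eq2] := expR1_bounds n0 pq.
rewrite -(ler_pM2r q0) mulrAC; apply: le_trans h.
by apply: ler_wpM2r => //; exact: ler0n.
Qed.

Lemma expR1_ge_bin n p q (E T : N) : (0 < n)%N -> horner_frac 1 1 0 (nseq n 1%num) = (p, q) ->
  N.ltb 0 q -> N.leb (N.mul E q) (N.mul p T) -> NR E <= e * NR T.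
Proof.
move=> n0 pq /(natr_bin_lt R) q0 /(natr_bin_le R); rewrite !natr_binE => h.
have /andP[eq1 _] := expR1_bounds n0 pq.
rewrite -(ler_pM2r q0) [_ * NR T * _]mulrAC; apply: le_trans h _.
by apply: ler_wpM2r => //; exact: ler0n.
Qed.

Variables (n : nat) (F : seq N).
Hypothesis sizeF : size F = n.+1.
Hypothesis F_phi : forall i, (i <= n)%N -> NR (nth 0%num F i) = i`!%:R * phi i.+1.

Definition scale_index : seq N := [seq N.mul (bin_of_nat i.+1) (nth 0%num F i) | i <- iota 0 n.+1].

Lemma peval_phi_bin a b p q : N.ltb 0 b -> horner_frac a b 0 F = (p, q) ->
  peval phi n.+2 (NR a / NR b) * (NR b * NR q) = NR a * NR p.
Proof.
move=> /(natr_bin_lt R) /gt_eqF/negbT b0 pq.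
have := @horner_fracE R a b 0 F (fun j => phi j.+1) b0; rewrite pq sizeF fact0 mul1r => /= ->.
  rewrite /peval big_ord_recl phi0 mul0r add0r.
  under [in LHS]eq_bigr => j _ do rewrite lift0 exprS mulrCA.
  by rewrite -big_distrr /=; set S := \sum_(_ < _) _; field.
by move=> j jn; rewrite add0n F_phi.
Qed.

Lemma sum_nat_phi_bin a b p q : N.ltb 0 b -> horner_frac a b 0 scale_index = (p, q) ->
  (\sum_(i < n.+2) i%:R * (phi i * (NR a / NR b) ^+ i)) * (NR b * NR q) = NR a * NR p.
Proof.
move=> /(natr_bin_lt R) /gt_eqF/negbT b0 pq.
have := @horner_fracE R a b 0 scale_index (fun j => j.+1%:R * phi j.+1) b0.
rewrite pq size_map size_iota fact0 mul1r => /= ->.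
  rewrite big_ord_recl mul0r add0r.
  set S := \sum_(_ < _) _; set S' := \sum_(_ < _) _.
  have -> : S = NR a / NR b * S'; last by field.
  by rewrite /S /S' big_distrr; apply: eq_bigr => j _ /=; rewrite /bump /= add1n exprS; ring.
move=> j jn; rewrite add0n (nth_map 0%N) ?size_iota // nth_iota // natr_binM bin_of_natK add0n F_phi //.
by rewrite mulrCA.
Qed.

Lemma divr_bin a b : N.ltb 0 b -> NR a / NR b * NR b = NR a.
Proof. by move=> /(natr_bin_lt R) /gt_eqF/negbT b0; rewrite divfK. Qed.

(** [E] / [T] bounds e from above and 1 / [T'] bounds the tail of phi: x <= 33/125 makes x / x1 at
    most 3/5. The last check says that e times the truncated phi plus 1 / [T'] is at most 1, with
    denominators cleared. *)
Lemma rho_ge_bin a b p q (E T T' : N) : N.ltb 0 b -> N.ltb 0 q -> N.ltb 0 T -> N.ltb 0 T' ->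
  e * NR T <= NR E -> horner_frac a b 0 F = (p, q) ->
  N.leb (N.mul 125 a) (N.mul 33 b) ->
  N.leb (N.mul (N.mul 4 (N.pow 3 (bin_of_nat n.+2))) T') (N.pow 5 (bin_of_nat n.+2)) ->
  N.leb (N.mul E (N.add (N.mul (N.mul a p) T') (N.mul b q))) (N.mul (N.mul T T') (N.mul b q)) ->
  NR a / NR b <= rho.
Proof.
move=> b0 q0 T0 T'0 eT pq /(natr_bin_le R) ab /(natr_bin_le R) tl /(natr_bin_le R) main.
have X := peval_phi_bin b0 pq; have xb := divr_bin a b0.
move: b0 q0 T0 T'0 => /(natr_bin_lt R) b0 /(natr_bin_lt R) q0 /(natr_bin_lt R) T0 /(natr_bin_lt R) T'0.
move: ab tl main; rewrite !natr_binE => ab tl main.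
set x := NR a / NR b in X xb *.
have x0 : 0 <= x by rewrite divr_ge0.
have xle : x <= 33 / 125.
  rewrite -(ler_pM2r b0) xb; move: ab; rewrite /=; lra.
have x1E : x1 = 11 / 25 by [].
have tail : 4 * (x / x1) ^+ n.+2 <= (NR T')^-1.
  apply: (@le_trans _ _ (4 * (3 / 5) ^+ n.+2)).
    apply: ler_wpM2l => //; apply: lerXn2r; rewrite ?nnegrE.
    - by apply: divr_ge0; rewrite ?x1E; lra.
    - lra.
    - by rewrite ler_pdivrMr x1E; lra.
  rewrite -[leRHS]mul1r ler_pdivlMr // expr_div_n.
  have f5 : 0 < 5 ^+ n.+2 :> R by rewrite exprn_gt0.
  by rewrite mulrA mulrAC ler_pdivrMr // mul1r.
apply: rho_ge => [|N]; first by apply/andP; split; lra.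
have pN : peval phi N x <= peval phi n.+2 x + (NR T')^-1.
  have [nN|Nn] := leqP n.+2 N.
    apply: le_trans (peval_phi_tail (z := x) _ nN) _; last by rewrite lerD2l.
    by rewrite x0 x1E /=; lra.
  apply: (@le_trans _ _ (peval phi n.+2 x)); last by rewrite lerDl invr_ge0.
  by apply: peval_le => //; [exact: phi_ge0|exact: ltnW].
rewrite expRN -[leRHS]mul1r ler_pdivlMr ?expR_gt0 //.
have e0 : 0 < e := expR_gt0 _.
apply: (@le_trans _ _ ((peval phi n.+2 x + (NR T')^-1) * e)); first by apply: ler_wpM2r => //; exact: ltW.
have bq : 0 < NR b * NR q by rewrite mulr_gt0.
have K : 0 < NR T * NR T' * (NR b * NR q) by rewrite !mulr_gt0.
rewrite -(ler_pM2r K) mul1r; apply: le_trans main.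
have -> : (peval phi n.+2 x + (NR T')^-1) * e * (NR T * NR T' * (NR b * NR q)) =
   (e * NR T) * (peval phi n.+2 x * (NR b * NR q) * NR T' + NR b * NR q).
  by field; rewrite gt_eqF.
by rewrite X; apply: ler_wpM2r.
Qed.

Lemma rho_le_bin a b p q (E T : N) : N.ltb 0 b -> N.ltb 0 q -> N.ltb 0 T ->
  NR E <= e * NR T -> horner_frac a b 0 F = (p, q) ->
  N.ltb (N.mul T (N.mul b q)) (N.mul E (N.mul a p)) -> rho <= NR a / NR b.
Proof.
move=> b0 q0 T0 eT pq /(natr_bin_lt R); rewrite !natr_binE => main.
have X := peval_phi_bin b0 pq.
move: b0 q0 T0 => /(natr_bin_lt R) b0 /(natr_bin_lt R) q0 /(natr_bin_lt R) T0.
apply: (@rho_le _ n.+2); first by rewrite divr_ge0.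
have e0 : 0 < e := expR_gt0 _.
rewrite expRN -[ltLHS]mul1r ltr_pdivrMr //.
have K : 0 < NR T * (NR b * NR q) by rewrite !mulr_gt0.
rewrite -(ltr_pM2r K) mul1r; apply: lt_le_trans main _.
set y := peval _ _ _ in X *.
have -> : y * e * (NR T * (NR b * NR q)) = (e * NR T) * (y * (NR b * NR q)) by ring.
by rewrite X; apply: ler_wpM2r; rewrite ?mulr_ge0.
Qed.

Section Mean.

Hypotheses (rho_gt0 : 0 < rho) (rho_lt : rho < 2 / 5).

Lemma step_mean_ge_bin a b p q (E T M S : N) : N.ltb 0 b -> N.ltb 0 q -> N.ltb 0 T ->
  NR E <= e * NR T -> horner_frac a b 0 scale_index = (p, q) -> NR a / NR b <= rho ->
  N.leb (N.mul (N.mul M T) (N.mul b q)) (N.mul (N.mul E (N.mul a p)) S) ->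
  NR M <= step_mean R * NR S.
Proof.
move=> b0 q0 T0 eT pq ab /(natr_bin_le R); rewrite !natr_binE => main.
have X := sum_nat_phi_bin b0 pq.
move: b0 q0 T0 => /(natr_bin_lt R) b0 /(natr_bin_lt R) q0 /(natr_bin_lt R) T0.
set y := \sum_(_ < _) _ in X.
have ym : e * y <= step_mean R.
  apply: le_trans (sum_ip_le (step_ge0 rho_gt0) (sum_nat_step rho_gt0 rho_lt) n.+2).
  rewrite /y big_distrr; apply: ler_sum => i _ /=; rewrite /step mulrCA; apply: ler_wpM2l => //.
  apply: ler_wpM2l; first exact: expR_ge0.
  apply: ler_wpM2l; first exact: phi_ge0.
  by apply: lerXn2r; rewrite ?nnegrE ?divr_ge0 // ltW.
apply: le_trans (ler_wpM2r (ler0n _ _) ym).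
have K : 0 < NR T * (NR b * NR q) by rewrite !mulr_gt0.
rewrite -(ler_pM2r K) [leLHS]mulrA; apply: le_trans main _.
have -> : e * y * NR S * (NR T * (NR b * NR q)) = (e * NR T) * (y * (NR b * NR q)) * NR S by ring.
by rewrite X; apply: ler_wpM2r => //; apply: ler_wpM2r => //; rewrite mulr_ge0.
Qed.

(** Here x <= 13/50 makes 11/10 x / x1 at most 13/20, and 1 / [T'] bounds the resulting tail of z
    phi'. *)
Lemma step_mean_le_bin a b p q (E T T' M S : N) : N.ltb 0 b -> N.ltb 0 q -> N.ltb 0 T -> N.ltb 0 T' ->
  e * NR T <= NR E -> horner_frac a b 0 scale_index = (p, q) -> rho <= NR a / NR b ->
  N.leb (N.mul 50 a) (N.mul 13 b) ->
  N.leb (N.mul (N.mul 40 (N.pow 13 (bin_of_nat n.+2))) T') (N.pow 20 (bin_of_nat n.+2)) ->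
  N.leb (N.mul (N.mul E (N.add (N.mul (N.mul a p) T') (N.mul b q))) S)
        (N.mul M (N.mul (N.mul T T') (N.mul b q))) ->
  step_mean R * NR S <= NR M.
Proof.
move=> b0 q0 T0 T'0 eT pq rx /(natr_bin_le R) ab /(natr_bin_le R) tl /(natr_bin_le R) main.
have X := sum_nat_phi_bin b0 pq; have xb := divr_bin a b0.
move: b0 q0 T0 T'0 => /(natr_bin_lt R) b0 /(natr_bin_lt R) q0 /(natr_bin_lt R) T0 /(natr_bin_lt R) T'0.
move: ab tl main; rewrite !natr_binE => ab tl main.
set x := NR a / NR b in X xb rx; set y := \sum_(_ < _) _ in X.
have x0 : 0 <= x by rewrite divr_ge0.
have xle : x <= 13 / 50.
  rewrite -(ler_pM2r b0) xb; move: ab; rewrite /=; lra.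
have x1E : x1 = 11 / 25 by [].
have tail : 40 * (11 / 10 * x / x1) ^+ n.+2 <= (NR T')^-1.
  apply: (@le_trans _ _ (40 * (13 / 20) ^+ n.+2)).
    apply: ler_wpM2l => //; apply: lerXn2r; rewrite ?nnegrE.
    - by apply: divr_ge0; rewrite ?x1E; lra.
    - lra.
    - by rewrite ler_pdivrMr x1E; lra.
  rewrite -[leRHS]mul1r ler_pdivlMr // expr_div_n.
  have f5 : 0 < 20 ^+ n.+2 :> R by rewrite exprn_gt0.
  by rewrite mulrA mulrAC ler_pdivrMr // mul1r.
have e0 : 0 < e := expR_gt0 _.
have my : step_mean R <= e * (y + (NR T')^-1).
  rewrite -(cvg_lim (@Rhausdorff R) (sum_nat_step rho_gt0 rho_lt)); apply: limr_le.
    by apply/cvg_ex; exists (step_mean R); exact: sum_nat_step.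
  near=> N; have nN : (n.+2 <= N)%N by near: N; exists n.+2.
  have -> : \sum_(i < N) i%:R * step R i = e * \sum_(i < N) i%:R * (phi i * rho ^+ i).
    by rewrite big_distrr; apply: eq_bigr => i _; rewrite /step /= mulrCA.
  apply: ler_wpM2l; first exact: ltW.
  apply: (@le_trans _ _ (\sum_(i < N) i%:R * (phi i * x ^+ i))).
    apply: ler_sum => i _; apply: ler_wpM2l => //; apply: ler_wpM2l; first exact: phi_ge0.
    by apply: lerXn2r; rewrite ?nnegrE // ltW.
  apply: le_trans (sum_nat_phi_tail x0 _ nN) _; first by rewrite x1E; lra.
  by rewrite lerD2l.
apply: le_trans (ler_wpM2r (ler0n _ _) my) _.
have K : 0 < NR T * NR T' * (NR b * NR q) by rewrite !mulr_gt0.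
rewrite -(ler_pM2r K); apply: le_trans main.
have -> : e * (y + (NR T')^-1) * NR S * (NR T * NR T' * (NR b * NR q)) =
   (e * NR T) * (y * (NR b * NR q) * NR T' + NR b * NR q) * NR S.
  by field; rewrite gt_eqF.
rewrite X; apply: ler_wpM2r => //; apply: ler_wpM2r => //.
Unshelve. all: by end_near. Qed.

End Mean.

Definition bin_prod (f : nat -> N) (s : seq nat) : N := foldr (fun i => N.mul (f i)) 1%num s.

Lemma wallis_bin K :
  wallis R K * NR (bin_prod (fun i => bin_of_nat i.*2.+2) (iota 0 K)) =
    NR (bin_prod (fun i => bin_of_nat i.*2.+1) (iota 0 K)).
Proof.
have natr_prod (f : nat -> N) s : NR (bin_prod f s) = \prod_(i <- s) NR (f i).
  by elim: s => [|i s IH]; rewrite ?big_nil // big_cons -IH -natr_binM.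
rewrite !natr_prod /wallis -(big_mkord xpredT (fun i => i.*2.+1%:R / i.*2.+2%:R)) /index_iota subn0.
rewrite -big_split; apply: eq_bigr => i _; rewrite !bin_of_natK; apply: divfK.
by rewrite pnatr_eq0.
Qed.

Lemma kappa_ge_bin K A B m (L Q : N) : bin_prod (fun i => bin_of_nat i.*2.+1) (iota 0 K) = A ->
  bin_prod (fun i => bin_of_nat i.*2.+2) (iota 0 K) = B -> bin_of_nat (4 * K).+1 = m -> N.ltb 0 B ->
  N.leb (N.mul (N.mul L (N.mul 8 (N.mul B B))) (N.add (N.mul 4 (N.mul m m)) 9))
        (N.mul (N.mul (N.mul A A) (N.mul m (N.add (N.mul 4 (N.mul m m)) 11))) Q) ->
  NR L <= kappa R ^+ 2 * NR Q.
Proof.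
move=> eA eB em /(natr_bin_lt R) B0 /(natr_bin_le R); rewrite !natr_binE => main.
have w := wallis_bin K; rewrite eA eB in w.
have mE : NR m = 4 * K%:R + 1 by rewrite -em bin_of_natK -natr1 natrM.
have m0 : 0 < NR m by rewrite mE ltr_wpDl ?mulr_ge0.
apply: le_trans (ler_wpM2r (ler0n _ _) (kappa_ge R K)); rewrite -mE /brouncker2.
move: main; rewrite -w; move: (NR m) (NR B) (wallis R K) (NR Q) (NR L) m0 B0 => m' B' w' Q' L' m0 B0 main.
have d0 : 0 < 4 * m' ^+ 2 + 9 by rewrite ltr_wpDl // mulr_ge0 // sqr_ge0.
have K0 : 0 < 8 * (B' * B') * (4 * m' ^+ 2 + 9) by rewrite !mulr_gt0.
rewrite -(ler_pM2r K0).
have -> : w' ^+ 2 * (m' * (4 * m' ^+ 2 + 11) / (4 * m' ^+ 2 + 9)) / 8 * Q' * (8 * (B' * B') * (4 * m' ^+ 2 + 9)) =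
  w' * B' * (w' * B') * (m' * (4 * (m' * m') + 11)) * Q' by field; rewrite gt_eqF.
have -> : L' * (8 * (B' * B') * (4 * m' ^+ 2 + 9)) = L' * (8 * (B' * B')) * (4 * (m' * m') + 9) by ring.
exact: main.
Qed.

Lemma kappa_le_bin K A B m (L Q : N) : bin_prod (fun i => bin_of_nat i.*2.+1) (iota 0 K) = A ->
  bin_prod (fun i => bin_of_nat i.*2.+2) (iota 0 K) = B -> bin_of_nat (4 * K).+1 = m -> N.ltb 0 B ->
  N.leb (N.mul (N.mul (N.mul A A) (N.add (N.mul 2 (N.mul m m)) 1)) Q)
        (N.mul (N.mul L (N.mul 8 (N.mul B B))) (N.mul 2 m)) ->
  kappa R ^+ 2 * NR Q <= NR L.
Proof.
move=> eA eB em /(natr_bin_lt R) B0 /(natr_bin_le R); rewrite !natr_binE => main.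
have w := wallis_bin K; rewrite eA eB in w.
have mE : NR m = 4 * K%:R + 1 by rewrite -em bin_of_natK -natr1 natrM.
have m0 : 0 < NR m by rewrite mE ltr_wpDl ?mulr_ge0.
apply: le_trans (ler_wpM2r (ler0n _ _) (kappa_le R K)) _; rewrite -mE /brouncker1.
move: main; rewrite -w; move: (NR m) (NR B) (wallis R K) (NR Q) (NR L) m0 B0 => m' B' w' Q' L' m0 B0 main.
have K0 : 0 < 8 * (B' * B') * (2 * m') by rewrite !mulr_gt0.
rewrite -(ler_pM2r K0).
have -> : w' ^+ 2 * ((2 * m' ^+ 2 + 1) / (2 * m')) / 8 * Q' * (8 * (B' * B') * (2 * m')) =
  w' * B' * (w' * B') * (2 * (m' * m') + 1) * Q' by field; rewrite gt_eqF.
have -> : L' * (8 * (B' * B') * (2 * m')) = L' * (8 * (B' * B')) * (2 * m') by ring.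
exact: main.
Qed.

End Certificates.

(** * The numerical certificate and the conclusion *)

(** Meaning of the data: a / b <= rho <= a' / b, E / T <= e <= E' / T, M / S <= mu <= M' / S and L /
    Tr <= kappa^2 <= L' / Tr; c, c' over [Dc] and g, g' over [Dg] are the decimals claimed for the
    constant and the growth rate. [Tr] and [Tm] are also the reciprocals of the tail bounds for phi
    and z phi'. The truncation degree gives 80 = 78 + 2, and 150 is the number of factors taken from
    Wallis' product. *)
Definition certificate (F : seq N) (a a' b T Tr Tm S E E' M M' L L' c c' g g' Dc Dg : N) : bool :=
  let: (pe, qe) := horner_frac 1 1 0 (nseq 21 1%num) in
  let: (p, q) := horner_frac a b 0 F in
  let: (p', q') := horner_frac a' b 0 F in
  let: (r, s) := horner_frac a b 0 (scale_index 78 F) in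
  let: (r', s') := horner_frac a' b 0 (scale_index 78 F) in
  let A := bin_prod (fun i => bin_of_nat i.*2.+1) (iota 0 150) in
  let B := bin_prod (fun i => bin_of_nat i.*2.+2) (iota 0 150) in
  let m := bin_of_nat (4 * 150).+1 in
  [&& [&& N.ltb 0 a, N.ltb 0 b, N.ltb 0 T, N.ltb 0 Tr, N.ltb 0 Tm & N.ltb 0 S],
    [&& N.leb (N.mul 125 a) (N.mul 33 b),
      N.leb (N.mul 50 a') (N.mul 13 b),
      N.leb (N.mul 3 a') (N.mul 1 b),
      N.leb (N.mul (N.mul 4 (N.pow 3 (bin_of_nat 80))) Tr) (N.pow 5 (bin_of_nat 80)) &
      N.leb (N.mul (N.mul 40 (N.pow 13 (bin_of_nat 80))) Tm) (N.pow 20 (bin_of_nat 80))],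
    [&& N.leb (N.mul g a') (N.mul Dg b),
      N.ltb (N.mul Dg b) (N.mul g' a),
      N.leb (N.mul (N.mul (N.mul c c) Tr) (N.mul (N.mul S S) S))
        (N.mul (N.mul Dc Dc) (N.mul L (N.mul (N.mul M M) M))) &
      N.ltb (N.mul (N.mul Dc Dc) (N.mul L' (N.mul (N.mul M' M') M')))
        (N.mul (N.mul (N.mul c' c') Tr) (N.mul (N.mul S S) S))],
    [&& N.ltb 0 qe, N.ltb 0 q, N.ltb 0 q', N.ltb 0 s, N.ltb 0 s' & N.ltb 0 B],
    N.leb (N.mul E qe) (N.mul pe T), N.leb (N.mul (N.add pe 2) T) (N.mul E' qe),
    N.leb (N.mul E' (N.add (N.mul (N.mul a p) Tr) (N.mul b q))) (N.mul (N.mul T Tr) (N.mul b q)),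
    N.ltb (N.mul T (N.mul b q')) (N.mul E (N.mul a' p')),
    N.leb (N.mul (N.mul M T) (N.mul b s)) (N.mul (N.mul E (N.mul a r)) S),
    N.leb (N.mul (N.mul E' (N.add (N.mul (N.mul a' r') Tm) (N.mul b s'))) S)
          (N.mul M' (N.mul (N.mul T Tm) (N.mul b s'))),
    N.leb (N.mul (N.mul L (N.mul 8 (N.mul B B))) (N.add (N.mul 4 (N.mul m m)) 9))
          (N.mul (N.mul (N.mul A A) (N.mul m (N.add (N.mul 4 (N.mul m m)) 11))) Tr) &
    N.leb (N.mul (N.mul (N.mul A A) (N.add (N.mul 2 (N.mul m m)) 1)) Tr)
          (N.mul (N.mul L' (N.mul 8 (N.mul B B))) (N.mul 2 m))].

Section Bounds.

Variable R : realType.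
Local Notation rho := (rho R).
Local Notation NR a := ((nat_of_bin a)%:R : R).

Lemma decimal_digits_intro (x : R) (m : N) (d : nat) :
  NR m <= x * NR (N.pow 10 (bin_of_nat d)) < NR (N.succ m) -> decimal_digits x m d.
Proof.
rewrite natr_binX nat_of_bin_succ => /andP[mx xm].
have d0 : 0 < 10%:R ^+ d :> R by rewrite exprn_gt0.
by rewrite /decimal_digits ler_pdivrMr // ltr_pdivlMr // mx.
Qed.

(** c is accessible only through c^2 = k u^3. The brackets of k and u give one for the square of c
    D, and comparing squares decides the comparison of the nonnegative numbers themselves. *)
Lemma sqr_bracket (c k u S Q D : R) (k0 k1 u0 u1 m0 m1 : R) :
  0 <= c -> c ^+ 2 = k * u ^+ 3 -> 0 < S -> 0 < Q -> 0 <= D -> 0 <= k0 -> 0 <= u0 -> 0 <= m1 ->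
  k0 <= k * Q <= k1 -> u0 <= u * S <= u1 ->
  m0 * m0 * Q * (S * S * S) <= D * D * (k0 * (u0 * u0 * u0)) ->
  D * D * (k1 * (u1 * u1 * u1)) < m1 * m1 * Q * (S * S * S) ->
  m0 <= c * D < m1.
Proof.
move=> c0 cE S0 Q0 D0 k00 u00 m10 /andP[kl kr] /andP[ul ur] lo hi.
have K0 : 0 < Q * (S * S * S) by rewrite !mulr_gt0.
have cD0 : 0 <= c * D by rewrite mulr_ge0.
have E : (c * D) ^+ 2 * (Q * (S * S * S)) = D * D * (k * Q * (u * S * (u * S) * (u * S))).
  by rewrite exprMn cE; ring.
have u0' := le_trans u00 ul.
apply/andP; split.
  have h2 : m0 ^+ 2 <= (c * D) ^+ 2.
    rewrite -(ler_pM2r K0) E; apply: (le_trans (y := D * D * (k0 * (u0 * u0 * u0)))).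
      by move: lo; rewrite !mulrA expr2.
    apply: ler_wpM2l; first exact: mulr_ge0.
    by rewrite !ler_pM ?mulr_ge0.
  rewrite leNgt; apply/negP => h; move: h2; apply/negP.
  by rewrite -ltNge ltr_pXn2r // nnegrE // ltW // (le_lt_trans cD0).
rewrite -(@ltr_pXn2r _ 2) ?nnegrE // -(ltr_pM2r K0) E.
apply: (@le_lt_trans _ _ (D * D * (k1 * (u1 * u1 * u1)))); last by move: hi; rewrite !mulrA expr2.
apply: ler_wpM2l; first exact: mulr_ge0.
have kQ0 := le_trans k00 kl; move: (k * Q) (u * S) kQ0 u0' kr ur => v w v0 w0 kr ur.
by rewrite !ler_pM ?mulr_ge0.
Qed.

Lemma certificate_bounds F a a' b T Tr Tm S E E' M M' L L' c c' g g' Dc Dg : size F = 79%N ->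
  (forall i, (i <= 78)%N -> NR (nth 0%num F i) = i`!%:R * phi R i.+1) ->
  certificate F a a' b T Tr Tm S E E' M M' L L' c c' g g' Dc Dg ->
  [/\ 0 < rho < 2 / 5, NR g <= rho^-1 * NR Dg < NR g' &
    NR c <= growth_const R * NR Dc < NR c'].
Proof.
move=> sF hF; rewrite /certificate.
case ee: (horner_frac 1 1 0 _) => [pe qe].
case eq1: (horner_frac a b 0 F) => [p q]; case eq2: (horner_frac a' b 0 F) => [p' q'].
case es1: (horner_frac a b 0 _) => [r s]; case es2: (horner_frac a' b 0 _) => [r' s'].
move eB: (bin_prod _ _) => B; move eA: (bin_prod _ _) => A; move em: (bin_of_nat (4 * 150).+1) => m.
case/and4P=> /and5P[a0 b0 T0 Tr0 /andP[Tm0 S0]] /and5P[ab1 ab2 ab3 tl1 tl2].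
case/and4P=> gl gr cl cr; case/andP=> /and5P[qe0 q0 q'0 s0 /andP[s'0 B0]] /and5P[e1 e2 c1 c2 /and4P[m1 m2 k1 k2]].
have eT := expR1_ge_bin R (ltn0Sn 20) ee qe0 e1.
have eT' := expR1_le_bin R (ltn0Sn 20) ee qe0 e2.
have lo := rho_ge_bin sF hF b0 q0 T0 Tr0 eT' eq1 ab1 tl1 c1.
have hi := rho_le_bin sF hF b0 q'0 T0 eT eq2 c2.
have b0R := natr_bin_lt R b0; have a0R := natr_bin_lt R a0.
have rho0 : 0 < rho by apply: lt_le_trans lo; rewrite divr_gt0.
(* The check 3 a' <= b gives rho <= 1/3, which shows that the cap in the definition of [rho] is not
   reached. *)
have rho2 : rho < 2 / 5.
  apply: le_lt_trans hi _; rewrite ltr_pdivrMr //.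
  by move/(natr_bin_le R): ab3; rewrite !natr_binM /= in b0R *; lra.
have mlo := step_mean_ge_bin hF rho0 rho2 b0 s0 T0 eT es1 lo m1.
have mhi := step_mean_le_bin hF rho0 rho2 b0 s'0 T0 Tm0 eT' es2 hi ab2 tl2 m2.
have klo := kappa_ge_bin R eA eB em B0 k1.
have khi := kappa_le_bin R eA eB em B0 k2.
split; first by rewrite rho0.
  rewrite mulrC; apply/andP; split.
    rewrite ler_pdivlMr //; apply: le_trans (ler_wpM2l (ler0n _ _) hi) _.
    by rewrite mulrA ler_pdivrMr // -!natr_binM; exact: natr_bin_le.
  rewrite ltr_pdivrMr //; apply: lt_le_trans (ler_wpM2l (ler0n _ _) lo).
  by rewrite mulrA ltr_pdivlMr // -!natr_binM; exact: natr_bin_lt.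
apply: (@sqr_bracket _ (kappa R ^+ 2) (step_mean R) (NR S) (NR Tr) _
  (NR L) (NR L') (NR M) (NR M')) => //.
- exact: ltW (growth_const_gt0 rho0 rho2).
- exact: growth_const_sqr rho0 rho2.
- exact: (natr_bin_lt R S0).
- exact: (natr_bin_lt R Tr0).
- by rewrite klo.
- by rewrite mlo.
- by rewrite -!natr_binM; exact: natr_bin_le.
- by rewrite -!natr_binM; exact: natr_bin_lt.
Qed.

End Bounds.

Definition phi_values : seq N := phi_table (psin_table 78) 78.

Lemma phi_valuesP (R : realType) : size phi_values = 79%N /\
  forall i, (i <= 78)%N -> (nat_of_bin (nth 0%num phi_values i))%:R = i`!%:R * phi R i.+1.
Proof. rewrite /phi_values; exact: (phi_tableP _ (leqnn 78) (psin_tableP 78)). Qed.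

(* With a / 2 ^ 50 the singularity lies in [a / 2 ^ 50, (a + 1) / 2 ^ 50]; the other large constants
   bracket 10 ^ 18 e, 10 ^ 16 mu and 10 ^ 17 kappa ^ 2 = 10 ^ 17 / (2 pi). *)
Lemma certificate_holds :
  certificate phi_values 292559859362291 292559859362292 1125899906842624
    (N.pow 10 18) (N.pow 10 17) (N.pow 10 13) (N.pow 10 16)
    2718281828459045235 2718281828459045236 14679750029308226 14679750029311060
    15915494309189531 15915494309326769
    70955825396 (N.succ 70955825396) 3848442876 (N.succ 3848442876)
    (N.pow 10 (bin_of_nat 11)) (N.pow 10 (bin_of_nat 9)).
Proof. by vm_compute. Qed.

Theorem corollary2 (R : realType) :
  [seq bin_of_nat (num_conn_3leaf_power n) | n <- iota 1 20] =
    [:: 1; 1; 2; 5; 12; 32; 82; 227; 629; 1840; 5456; 16701; 51939; 164688;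
        529070; 1722271; 5664786; 18813360; 62996841; 212533216]%num
  /\
  exists c gamma : R,
    [/\ decimal_digits c 70955825396%num 11,
        decimal_digits gamma 3848442876%num 9 &
        (num_conn_3leaf_power n)%:R
          / (c * gamma ^+ n * n%:R `^ (- (5%:R / 2%:R))) @[n --> \oo] --> (1 : R)].
Proof.
split; first exact: num_conn_3leaf_power_first_values.
have [size_phi phi_val] := phi_valuesP R; have := certificate_holds.
move=> /(certificate_bounds size_phi phi_val) [/andP[rho_gt0 rho_lt] gammaP cP].
exists (growth_const R), (rho R)^-1.
split; [exact: decimal_digits_intro cP|exact: decimal_digits_intro gammaP|].
exact: num_conn_3leaf_power_ratio.
Qed.
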